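(* Let $p>6$ and assume that $h$ satisfies $(h_1)$ and $(h_2)$. Then equation (E) has a ground state sign-changing solution $v\in H^{s,2}$, i.e. $v\in\mathcal{M}_{s,2}$, $J_{s,2}'(v)=0$ and $J_{s,2}(v)=\inf_{w\in\mathcal{M}_{s,2}}J_{s,2}(w)$.
   Context: Let $d\ge 1$ and $s\in(0,1)$. $\mathbb{Z}^d$ is the integer lattice graph (vertices $\mathbb{Z}^d$, edges between $x,y$ with $\sum_i|x_i-y_i|=1$), with graph distance $|x-y|=\sum_{i=1}^d|x_i-y_i|$ and counting measure $\mu$; $\int_{\mathbb{Z}^d}f\,d\mu:=\sum_{x\in\mathbb{Z}^d}f(x)$. The weight $w_s(x,y)$, defined for $x\neq y$, is symmetric, positive, and satisfies $c_{s,d}|x-y|^{-d-2s}\le w_s(x,y)\le C_{s,d}|x-y|^{-d-2s}$ for some constants $0<c_{s,d}\le C_{s,d}$. For $u,v:\mathbb{Z}^d\to\mathbb{R}$ set $\nabla^s u\nabla^s v(x)=\frac12\sum_{y\neq x}w_s(x,y)(u(x)-u(y))(v(x)-v(y))$, $|\nabla^s u|^2(x)=\nabla^s u\nabla^s u(x)$, $\|\nabla^s u\|_2^2:=\int_{\mathbb{Z}^d}|\nabla^s u|^2d\mu$, and $(-\Delta)^s u(x)=\sum_{y\neq x}w_s(x,y)(u(x)-u(y))$; $\|u\|_q$ denotes the $\ell^q(\mathbb{Z}^d)$ norm. Fix constants $a,b>0$ and $p>2$. The potential $h:\mathbb{Z}^d\to\mathbb{R}$ may satisfy: $(h_1)$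 there is $h_0>0$ with $h(x)\ge h_0$ for all $x$; $(h_2)$ there is $x_0\in\mathbb{Z}^d$ with $h(x)\to\infty$ as $|x-x_0|\to\infty$. $W^{s,2}(\mathbb{Z}^d)$ is the completion of finitely supported functions under $\|u\|_{W^{s,2}}^2=\int(|\nabla^s u|^2+u^2)d\mu$, and $H^{s,2}=\{u\in W^{s,2}:\int h u^2d\mu<\infty\}$ is the Hilbert space with inner product $\langle u,v\rangle_{H^{s,2}}=\int(a\nabla^s u\nabla^s v+huv)d\mu$ and norm $\|u\|_{H^{s,2}}$. Equation (E) is $\left(a+b\int_{\mathbb{Z}^d}|\nabla^s u|^2d\mu\right)(-\Delta)^s u+h(x)u=|u|^{p-2}u\log u^2$ on $\mathbb{Z}^d$ (with $|t|^{p-2}t\log t^2:=0$ at $t=0$). The energy is $J_{s,2}(u)=\frac12\|u\|_{H^{s,2}}^2+\frac b4\|\nabla^s u\|_2^4+\frac{2}{p^2}\int|u|^pd\mu-\frac1p\int|u|^p\log u^2d\mu$, a $C^1$ functional on $H^{s,2}$ with $\langle J_{s,2}'(u),\phi\rangle=\int(a\nabla^s u\nabla^s\phi+hu\phi)d\mu+b\|\nabla^s u\|_2^2\int\nabla^s u\nabla^s\phi\,d\mu-\int|u|^{p-2}u\phi\log u^2d\mu$. A weak solution is a critical point of $J_{s,2}$; nontrivial means $\neq0$. $u^+=\max\{u,0\}$, $u^-=\min\{u,0\}$. Nehari manifold: $\mathcal{N}_{s,2}=\{v\in H^{s,2}\setminus\{0\}:\langle J_{s,2}'(v),v\rangle=0\}$.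 Sign-changing Nehari set: $\mathcal{M}_{s,2}=\{v\in H^{s,2}: v^\pm\neq0,\ \langle J_{s,2}'(v),v^+\rangle=\langle J_{s,2}'(v),v^-\rangle=0\}$. A ground state solution is a nontrivial weak solution $u$ with $J_{s,2}(u)=\inf_{\mathcal{N}_{s,2}}J_{s,2}$; a sign-changing solution is a weak solution $u$ with $u^\pm\not\equiv0$; a ground state sign-changing solution is a sign-changing solution $u$ with $J_{s,2}(u)=\inf_{\mathcal{M}_{s,2}}J_{s,2}$. For $u\in H^{s,2}$, $K(u)=\sum_{x}\sum_{y\neq x}w_s(x,y)[u^+(y)u^-(x)+u^-(y)u^+(x)]$. *)

(* Defs.v *)
From HB Require Import structures.
From mathcomp Require Import all_boot all_order all_algebra.
From mathcomp Require Import all_classical all_reals all_analysis.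
Set Implicit Arguments. Unset Strict Implicit. Unset Printing Implicit Defensive.
Import Order.TTheory GRing.Theory Num.Theory.
Import numFieldNormedType.Exports.
Local Open Scope classical_set_scope.
Local Open Scope ring_scope.

Definition Zd (d : nat) := {ffun 'I_d -> int}.

Definition distZ (d : nat) (x y : Zd d) : nat := (\sum_(i < d) absz (x i - y i))%N.

Section Defs.
Variables (R : realType) (d : nat).
Implicit Types (u v phi : Zd d -> R).

(* Unordered (absolutely convergent) sum over Z^d of a real family:
   sum of positive parts minus sum of negative parts. *)
Definition sumZ (f : Zd d -> R) : R :=
  fine (\esum_(x in [set: Zd d]) (Num.max (f x) 0)%:E)
  - fine (\esum_(x in [set: Zd d]) (Num.max (- f x) 0)%:E).

Variable w : Zd d -> Zd d -> R.

Definition gradprod u v (x : Zd d) : R :=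
  2^-1 * sumZ (fun y => if y == x then 0 else w x y * (u x - u y) * (v x - v y)).

(* |nabla^s u|^2 (x), as an extended nonnegative sum (for arbitrary u) *)
Definition gradsqE u (x : Zd d) : \bar R :=
  \esum_(y in [set y | y != x]) (2^-1 * w x y * (u x - u y) ^+ 2)%:E.

Definition normW2E u : \bar R :=
  \esum_(x in [set: Zd d]) (gradsqE u x + (u x ^+ 2)%:E)%E.

Definition fin_supp u := finite_set [set x | u x != 0].

(* W^{s,2}(Z^d): completion of finitely supported functions under the
   W^{s,2} norm, realized as functions on Z^d *)
Definition inW u := exists un : nat -> (Zd d -> R),
  (forall n, fin_supp (un n)) /\
  ((fun n => normW2E (fun x => un n x - u x)) @ \oo --> 0%E).

Variables (a b p : R) (h : Zd d -> R).

Definition inH u :=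
  inW u /\ (\esum_(x in [set: Zd d]) (h x * u x ^+ 2)%:E < +oo)%E.

Definition gradnorm2 u : R := sumZ (gradprod u u).

Definition normH2 u : R := sumZ (fun x => a * gradprod u u x + h x * u x ^+ 2).

Definition J u : R :=
  2^-1 * normH2 u + b / 4 * gradnorm2 u ^+ 2
  + 2 / p ^+ 2 * sumZ (fun x => powR `|u x| p)
  - p^-1 * sumZ (fun x => powR `|u x| p * ln (u x ^+ 2)).

Definition dJ u phi : R :=
  sumZ (fun x => a * gradprod u phi x + h x * u x * phi x)
  + b * gradnorm2 u * sumZ (gradprod u phi)
  - sumZ (fun x => powR `|u x| (p - 2) * u x * phi x * ln (u x ^+ 2)).

Definition pos_part u := fun x => Num.max (u x) 0.
Definition neg_part u := fun x => Num.min (u x) 0.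

Definition Mset u :=
  inH u /\ pos_part u <> (fun _ => 0) /\ neg_part u <> (fun _ => 0)
  /\ dJ u (pos_part u) = 0 /\ dJ u (neg_part u) = 0.

End Defs.

(* Main.v *)
(* A bounded kernel row sum makes the Dirichlet form E continuous on l^2, so H is the
   space of functions with sum of h u^2 finite.  For u with parts P = u^+ and N = u^-,
   the energy on the cone { e^s P + e^t N } is an explicit function of (s, t) in which
   the coupling E(P, N) is nonnegative; hence each Nehari derivative is monotone in the
   other variable, and the cone meets the sign-changing Nehari set M.  Since p > 4, a
   point of M maximizes the energy on its own cone.

   Minimization: J controls sum of h u^2 on M, and as h tends to infinity a minimizing
   sequence converges in l^2 to some v; v^+ and v^- are nonzero because every u in M
   takes values above 1 and below -1.  Projecting v to M and using the maximum property
   together with lower semicontinuity gives a minimizer.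

   Criticality: if dJ(v, c delta_x) < 0, the cone over v + e c delta_x meets M at
   parameters close to those of v, at a point of the form V + k c delta_x with V in the
   cone over v and k > 0.  Then J(V) <= J(v) <= J(V + k c delta_x), while the derivative
   of J near v in this direction is negative.  The functions delta_x span a dense
   subspace of H. *)

(* The maps [u -> u^+] and [u -> u^-] are only Lipschitz, so the set M is not handled as a manifold
   and no multiplier rule is used. What replaces it: at a point of M both Nehari derivatives are
   strictly positive at [(-r, -r)] and strictly negative at [(r, r)], for every [r > 0]. Strict
   signs survive a small perturbation, and two such corners force a common zero inside the box.
   Differentiation then concerns a single scalar function, because a change at one site alters the
   quadratic terms polynomially and the nonlinear sum in one term only.

   Exponential parameters keep both scalings positive and turn [ln ((e^s t)^2)] into
   [2 s + ln (t^2)], so the nonlinear sums scale in closed form. The maximum property on a cone is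
   then a direct inequality without second derivatives: Bernoulli compares [e^(p z)] with [e^(2 z)]
   and [e^(4 z)], and convexity decouples the squared Dirichlet energy. *)
Require Import Defs.
From HB Require Import structures.
From mathcomp Require Import all_boot all_order all_algebra.
From mathcomp Require Import finmap ring lra.
From mathcomp Require Import all_classical all_reals all_analysis.
Set Implicit Arguments.
Unset Strict Implicit.
Unset Printing Implicit Defensive.
Import Order.TTheory GRing.Theory Num.Theory.
Import numFieldNormedType.Exports.
Local Open Scope classical_set_scope.
Local Open Scope ring_scope.

(** * Unordered sums of real families over the lattice *)

Section LatticeSums.
Variables (R : realType) (d : nat).
Local Notation T := (Zd d).
Implicit Types (f g : T -> R) (A : {fset T}).

(** Absolute summability through finite partial sums, so that comparison arguments stay in [R];
    [fset_le_esum] and [esum_le_fset] are the bridge to [\esum]. *)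
Definition summ f := exists M : R, forall A, \sum_(x <- A) `|f x| <= M.

Definition nnsum f : R := fine (\esum_(x in [set: T]) (f x)%:E).

Lemma fset_le_esum f A : (forall x, 0 <= f x) ->
  ((\sum_(x <- A) f x)%:E <= \esum_(x in [set: T]) (f x)%:E)%E.
Proof.
move=> f0; apply: esum_ge; exists [set` A]; first by split=> //; exact: finite_fset.
by rewrite fsbig_finite//= set_fsetK sumEFin.
Qed.

Lemma esum_le_fset f M : (forall A, \sum_(x <- A) f x <= M) ->
  (\esum_(x in [set: T]) (f x)%:E <= M%:E)%E.
Proof.
move=> fM; apply: ge_ereal_sup => _ [X [finX _] <-].
by rewrite fsbig_finite//= sumEFin lee_fin.
Qed.

Lemma summ_le f g : summ g -> (forall x, `|f x| <= `|g x|) -> summ f.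
Proof.
move=> [M gM] fg; exists M => A; apply: le_trans (gM A).
by apply: ler_sum => x _; exact: fg.
Qed.

Lemma summ_le0 f g : summ g -> (forall x, `|f x| <= g x) -> summ f.
Proof.
by move=> sg fg; apply: summ_le sg _ => x; exact: le_trans (fg x) (ler_norm _).
Qed.

Lemma summD f g : summ f -> summ g -> summ (fun x => f x + g x).
Proof.
move=> [M fM] [N gN]; exists (M + N) => A.
apply: le_trans (lerD (fM A) (gN A)); rewrite -big_split/=.
by apply: ler_sum => x _; exact: ler_normD.
Qed.

Lemma summZ c f : summ f -> summ (fun x => c * f x).
Proof.
move=> [M fM]; exists (`|c| * M) => A.
under eq_bigr do rewrite normrM.
by rewrite -mulr_sumr ler_wpM2l.
Qed.

Lemma summN f : summ f -> summ (fun x => - f x).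
Proof. by move=> sf; apply: summ_le sf _ => x; rewrite normrN. Qed.

Lemma summB f g : summ f -> summ g -> summ (fun x => f x - g x).
Proof. by move=> sf sg; apply: summD => //; exact: summN. Qed.

Lemma summ_norm f : summ f -> summ (fun x => `|f x|).
Proof. by move=> sf; apply: summ_le sf _ => x; rewrite normr_id. Qed.

Lemma summ_const0 : summ (fun=> 0).
Proof. by exists 0 => A; rewrite big1// => x _; rewrite normr0. Qed.

Lemma summ_fin_num f : (forall x, 0 <= f x) -> summ f ->
  (\esum_(x in [set: T]) (f x)%:E \is a fin_num)%E.
Proof.
move=> f0 [M fM]; rewrite ge0_fin_numE; last by apply: esum_ge0 => x _; rewrite lee_fin.
apply: le_lt_trans (ltry M); apply: esum_le_fset => A; apply: le_trans (fM A).
by apply: ler_sum => x _; exact: ler_norm.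
Qed.

Lemma nnsumE f : (forall x, 0 <= f x) -> summ f ->
  (\esum_(x in [set: T]) (f x)%:E = (nnsum f)%:E)%E.
Proof. by move=> f0 sf; rewrite fineK// summ_fin_num. Qed.

Lemma esum_summ f : (forall x, 0 <= f x) ->
  (\esum_(x in [set: T]) (f x)%:E < +oo)%E -> summ f.
Proof.
move=> f0 foo; exists (nnsum f) => A.
rewrite (eq_bigr f) => [|x _]; last by rewrite ger0_norm.
rewrite -lee_fin fineK ?fset_le_esum// ge0_fin_numE//.
by apply: esum_ge0 => x _; rewrite lee_fin.
Qed.

Lemma nnsumD f g : (forall x, 0 <= f x) -> (forall x, 0 <= g x) ->
  summ f -> summ g -> nnsum (fun x => f x + g x) = nnsum f + nnsum g.
Proof.
move=> f0 g0 sf sg; apply: EFin_inj; rewrite EFinD -!nnsumE//.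
- by rewrite -esumD// => x _; rewrite lee_fin.
- by move=> x; rewrite addr_ge0.
- exact: summD.
Qed.

Lemma nnsum0 : nnsum (fun=> 0) = 0.
Proof. by rewrite /nnsum esum1. Qed.

Lemma sumZ_nnsum f : (forall x, 0 <= f x) -> sumZ f = nnsum f.
Proof.
move=> f0; rewrite /sumZ -/(nnsum (fun x => Num.max (f x) 0)).
rewrite -/(nnsum (fun x => Num.max (- f x) 0)).
rewrite (_ : (fun x => Num.max (- f x) 0) = (fun=> 0)); last first.
  by apply/funext => x; apply/max_idPr; rewrite oppr_le0.
rewrite nnsum0 subr0; congr nnsum; apply/funext => x.
by apply/max_idPl.
Qed.

(** The value does not depend on the splitting: with the canonical parts [P] and [N] of [f - g] one
    has [P + g = N + f] pointwise, and [nnsum] is additive. *)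
Lemma sumZ_nnsumB f g : (forall x, 0 <= f x) -> (forall x, 0 <= g x) ->
  summ f -> summ g -> sumZ (fun x => f x - g x) = nnsum f - nnsum g.
Proof.
move=> f0 g0 sf sg; rewrite /sumZ.
set P := fun x => Num.max (f x - g x) 0.
set N := fun x => Num.max (- (f x - g x)) 0.
rewrite -/(nnsum P) -/(nnsum N).
have P0 x : 0 <= P x by rewrite le_max lexx orbT.
have N0 x : 0 <= N x by rewrite le_max lexx orbT.
have sB := summB sf sg.
have sP : summ P.
  apply: summ_le sB _ => x; rewrite /P; case: (leP (f x - g x)) => // _.
  by rewrite normr0.
have sN : summ N.
  apply: summ_le sB _ => x; rewrite /N; case: (leP (- (f x - g x)) 0) => _.
    by rewrite normr0.
  by rewrite normrN.
have : nnsum P + nnsum g = nnsum N + nnsum f.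
  rewrite -!nnsumD//; congr nnsum; apply/funext => x; rewrite /P /N.
  by case: (leP (f x - g x)) => ?; case: (leP (- _)) => ?; lra.
by move=> ?; lra.
Qed.

Lemma posnegE f : f = (fun x => Num.max (f x) 0 - Num.max (- f x) 0).
Proof. by apply/funext => x; case: (leP (f x)) => ?; case: (leP (- _)) => ?; lra. Qed.

Lemma summ_pos f : summ f -> summ (fun x => Num.max (f x) 0).
Proof.
move=> sf; apply: summ_le sf _ => x.
by case: (leP (f x)) => // _; rewrite normr0.
Qed.

Lemma sumZD f g : summ f -> summ g -> sumZ (fun x => f x + g x) = sumZ f + sumZ g.
Proof.
move=> sf sg.
have m0 (k : T -> R) x : 0 <= Num.max (k x) 0 by rewrite le_max lexx orbT.
have sf1 := summ_pos sf; have sf2 := summ_pos (summN sf).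
have sg1 := summ_pos sg; have sg2 := summ_pos (summN sg).
have -> : (fun x => f x + g x) =
    (fun x => (Num.max (f x) 0 + Num.max (g x) 0)
            - (Num.max (- f x) 0 + Num.max (- g x) 0)).
  apply/funext => x; rewrite {1}(posnegE f) {1}(posnegE g); ring.
rewrite sumZ_nnsumB; [|by move=> x; rewrite addr_ge0// le_max lexx orbT..|exact: summD|exact: summD].
rewrite !nnsumD//.
- by rewrite /sumZ /nnsum; ring.
- exact: (m0 (fun x => - f x)).
- exact: (m0 (fun x => - g x)).
Qed.

Lemma sumZN f : sumZ (fun x => - f x) = - sumZ f.
Proof.
rewrite /sumZ opprB; congr (_ - fine _); apply: eq_esum => x _.
by rewrite opprK.
Qed.

Lemma sumZB f g : summ f -> summ g -> sumZ (fun x => f x - g x) = sumZ f - sumZ g.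
Proof. by move=> sf sg; rewrite sumZD ?sumZN//; exact: summN. Qed.

Lemma sumZ_ge0 f : (forall x, 0 <= f x) -> 0 <= sumZ f.
Proof.
by move=> f0; rewrite sumZ_nnsum// fine_ge0// esum_ge0// => x _; rewrite lee_fin.
Qed.

Lemma ler_sumZ f g : summ f -> summ g -> (forall x, f x <= g x) -> sumZ f <= sumZ g.
Proof.
move=> sf sg fg; rewrite -subr_ge0 -sumZB//; apply: sumZ_ge0 => x.
by rewrite subr_ge0.
Qed.

Lemma ler_fset_sumZ f A : (forall x, 0 <= f x) -> summ f ->
  \sum_(x <- A) f x <= sumZ f.
Proof. by move=> f0 sf; rewrite sumZ_nnsum// -lee_fin -nnsumE// fset_le_esum. Qed.

(** The uniform bound on finite sums also yields summability, so this is the usual way to establish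
    both at once. *)
Lemma sumZ_le_fset f M : (forall x, 0 <= f x) ->
  (forall A, \sum_(x <- A) f x <= M) -> sumZ f <= M.
Proof.
move=> f0 fM; have sf : summ f.
  exists M => A; rewrite (eq_bigr f)// => x _; by rewrite ger0_norm.
by rewrite sumZ_nnsum// -lee_fin -nnsumE// esum_le_fset.
Qed.

Lemma sumZ_approx f (e : R) : (forall x, 0 <= f x) -> 0 < e ->
  exists A, sumZ f < \sum_(x <- A) f x + e.
Proof.
move=> f0 e0; apply: contrapT => /forallNP nA.
have : sumZ f <= sumZ f - e.
  apply: sumZ_le_fset => // A; rewrite lerBrDr leNgt; exact/negP/nA.
by move=> ?; lra.
Qed.

Lemma ler_term_sumZ f x : (forall x, 0 <= f x) -> summ f -> f x <= sumZ f.
Proof.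
by move=> f0 sf; have := ler_fset_sumZ [fset x]%fset f0 sf; rewrite big_seq_fset1.
Qed.

Lemma sumZ0 : sumZ (fun _ : T => 0 : R) = 0.
Proof. by rewrite sumZ_nnsum// nnsum0. Qed.

Lemma sumZ_eq f g : (forall x, f x = g x) -> sumZ f = sumZ g.
Proof. by move=> fg; congr sumZ; apply/funext. Qed.

Lemma sumZ_norm_le f : summ f -> `|sumZ f| <= sumZ (fun x => `|f x|).
Proof.
move=> sf; have sn := summ_norm sf; rewrite ler_norml; apply/andP; split.
  rewrite -sumZN; apply: ler_sumZ => //; first exact: summN.
  by move=> x; have := ler_norm (- f x); rewrite normrN; lra.
by apply: ler_sumZ => // x; exact: ler_norm.
Qed.

Lemma summ_sum (I : Type) (r : seq I) (F : I -> T -> R) :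
  (forall i, summ (F i)) -> summ (fun x => \sum_(i <- r) F i x).
Proof.
move=> sF; elim: r => [|i r ih].
  by under eq_fun do rewrite big_nil; exact: summ_const0.
by under eq_fun do rewrite big_cons; apply: summD.
Qed.

Lemma sumZ_sum (I : Type) (r : seq I) (F : I -> T -> R) :
  (forall i, summ (F i)) ->
  sumZ (fun x => \sum_(i <- r) F i x) = \sum_(i <- r) sumZ (F i).
Proof.
move=> sF; elim: r => [|i r ih].
  by under sumZ_eq do rewrite big_nil; rewrite big_nil sumZ0.
by under sumZ_eq do rewrite big_cons; rewrite big_cons sumZD ?ih//; exact: summ_sum.
Qed.

Lemma summ_single f x : (forall y, y != x -> f y = 0) -> summ f.
Proof.
move=> fx; exists `|f x| => A.
case: (boolP (x \in A)) => xA.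
  rewrite (big_fsetD1 x)//= big_seq big1 ?addr0// => y.
  by rewrite !inE => /andP[/fx -> _]; rewrite normr0.
rewrite big_seq big1// => y yA; rewrite fx ?normr0//.
by apply: contraNneq xA => <-.
Qed.

Lemma sumZ_single f x : (forall y, y != x -> f y = 0) -> sumZ f = f x.
Proof.
have key g : (forall y, 0 <= g y) -> (forall y, y != x -> g y = 0) -> sumZ g = g x.
  move=> g0 gx; apply/le_anti/andP; split; last first.
    by apply: ler_term_sumZ => //; exact: summ_single gx.
  apply: sumZ_le_fset => // A; case: (boolP (x \in A)) => xA.
    rewrite (big_fsetD1 x)//= big_seq big1 ?addr0// => y.
    by rewrite !inE => /andP[/gx -> _].
  rewrite big_seq big1// => y yA; rewrite gx//.
  by apply: contraNneq xA => <-.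
move=> fx; rewrite {1}(posnegE f) sumZB; first last.
- by apply: (@summ_single _ x) => y /fx ->; rewrite oppr0 maxxx.
- by apply: (@summ_single _ x) => y /fx ->; rewrite maxxx.
rewrite !key.
- by rewrite [RHS](congr1 (@^~ x) (posnegE f)).
- by move=> y; rewrite le_max lexx orbT.
- by move=> y /fx ->; rewrite oppr0 maxxx.
- by move=> y; rewrite le_max lexx orbT.
- by move=> y /fx ->; rewrite maxxx.
Qed.

(** For [c > 0] and [f >= 0] each inequality is a comparison of finite sums, the second one after
    division by [c]. Splitting [f] and negating [c] give the rest. *)
Lemma sumZZ c f : summ f -> sumZ (fun x => c * f x) = c * sumZ f.
Proof.
have pos (k : R) g : 0 < k -> (forall x, 0 <= g x) -> summ g ->
    sumZ (fun x => k * g x) = k * sumZ g.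
  move=> k0 g0 sg; apply/le_anti/andP; split.
    apply: sumZ_le_fset => [x|A]; first by rewrite mulr_ge0// ltW.
    by rewrite -mulr_sumr ler_pM2l// ler_fset_sumZ.
  rewrite mulrC -ler_pdivlMr//; apply: sumZ_le_fset => // A.
  rewrite ler_pdivlMr// mulrC mulr_sumr; apply: ler_fset_sumZ => [x|].
    by rewrite mulr_ge0// ltW.
  exact: summZ.
have pos' (k : R) g : 0 < k -> summ g -> sumZ (fun x => k * g x) = k * sumZ g.
  move=> k0 sg; have s1 := summ_pos sg; have s2 := summ_pos (summN sg).
  rewrite [in RHS](posnegE g) sumZB// mulrBr -!pos//.
  - rewrite -sumZB; [|exact: summZ..]; apply: sumZ_eq => x.
    by rewrite {1}(posnegE g) mulrBr.
  - by move=> x; rewrite le_max lexx orbT.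
  - by move=> x; rewrite le_max lexx orbT.
move=> sf; have [c0|c0|->] := ltgtP c 0; last 2 first.
- exact: pos'.
- by rewrite mul0r; under sumZ_eq do rewrite mul0r; rewrite sumZ0.
have := pos' (- c) f; rewrite oppr_gt0 => /(_ c0 sf).
under sumZ_eq do rewrite mulNr.
by rewrite sumZN mulNr => /oppr_inj.
Qed.

End LatticeSums.
(** * Summability of the kernel *)

Section KernelSum.
Variable R : realType.

(** Integral comparison without an integral. Dividing by [(n+2)^(-t)] and putting [x = (n+1)/(n+2)]
    leaves [1 + t (1 - x) <= x^(-t)], which follows from [1 + z <= e^z] and [ln x <= x - 1]. *)
Lemma powR_telescope (t : R) (n : nat) : 0 < t ->
  n.+2%:R `^ (- (1 + t)) <= (n.+1%:R `^ (- t) - n.+2%:R `^ (- t)) / t.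
Proof.
move=> t0; rewrite ler_pdivlMr//.
have k0 : 0 < n.+1%:R :> R by rewrite ltr0n.
have k1 : 0 < n.+2%:R :> R by rewrite ltr0n.
have -> : - (1 + t) = - t + - 1 by ring.
rewrite powRD; last by rewrite (gt_eqF k1) implybT.
rewrite powR_inv1//; set y := n.+2%:R `^ (- t).
pose x : R := n.+1%:R / n.+2%:R.
have x0 : 0 < x by rewrite divr_gt0.
have -> : n.+1%:R `^ (- t) = y * x `^ (- t).
  rewrite /y -powRM ?ltW// /x mulrC divfK// gt_eqF//.
have -> : n.+2%:R^-1 = 1 - x :> R.
  have e : n.+2%:R = n.+1%:R + 1 :> R by rewrite natr1.
  have : n.+2%:R != 0 :> R by rewrite gt_eqF.
  by rewrite /x e => ?; field.
have y0 : 0 <= y by exact: powR_ge0.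
suff : 1 + t * (1 - x) <= x `^ (- t) by move=> /(ler_wpM2l y0); lra.
rewrite /powR gt_eqF//; apply: le_trans (expR_ge1Dx _).
rewrite lerD2l mulNr -mulrN ler_pM2l//.
by have := @le_ln1Dx R (x - 1); rewrite [1 + _]addrC subrK; lra.
Qed.

Lemma sum_powR_le (t : R) (n : nat) : 0 < t ->
  \sum_(j < n) j.+1%:R `^ (- (1 + t)) <= 1 + t^-1.
Proof.
move=> t0; case: n => [|n].
  by rewrite big_ord0 addr_ge0// invr_ge0 ltW.
(* The telescoped remainder is kept in the bound so that the induction closes. *)
suff : \sum_(j < n.+1) j.+1%:R `^ (- (1 + t)) <= 1 + (1 - n.+1%:R `^ (- t)) / t.
  by move=> /le_trans; apply; rewrite lerD2l ler_pdivrMr// mulVf ?gt_eqF//.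
elim: n => [|n ih]; first by rewrite big_ord1 !powR1 subrr mul0r addr0.
rewrite big_ord_recr/=; apply: le_trans (lerD ih (powR_telescope n t0)) _.
by rewrite -addrA -mulrDl addrA subrK.
Qed.

Definition int_code (c : nat * bool) : int := if c.2 then c.1%:Z else - c.1%:Z.

Lemma int_codeK (z : int) : int_code (absz z, 0 <= z) = z.
Proof. by case: z => n //=; rewrite /int_code/= NegzE. Qed.

(** A point [y] is encoded by the pairs (magnitude, sign) of the coordinates of [x - y]. Over all
    codes the sum of products factorizes, the factor 2 counting signs; 0 has two codes, hence only
    an inequality. *)
Lemma box_prod_sum (d M : nat) (g : nat -> R) (x : Zd d) (A : {fset Zd d}) :
  (forall n, 0 <= g n) ->
  (forall y i, y \in A -> (absz (x i - y i) <= M)%N) ->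
  \sum_(y <- A) \prod_(i < d) g (absz (x i - y i)) <=
  (2 * \sum_(j < M.+1) g j) ^+ d.
Proof.
move=> g0 AM.
pose enc (y : Zd d) : {ffun 'I_d -> 'I_M.+1 * bool} :=
  [ffun i => (inord (absz (x i - y i)), 0 <= x i - y i)].
pose H (f : {ffun 'I_d -> 'I_M.+1 * bool}) := \prod_(i < d) g (f i).1.
have HE y : y \in A -> \prod_(i < d) g (absz (x i - y i)) = H (enc y).
  by move=> yA; apply: eq_bigr => i _; rewrite ffunE/= inordK// ltnS AM.
have -> : (2 * \sum_(j < M.+1) g j) ^+ d = \sum_f H f.
  rewrite /H -(bigA_distr_bigA (fun (_ : 'I_d) (c : 'I_M.+1 * bool) => g c.1)).
  rewrite prodr_const card_ord; congr (_ ^+ _).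
  rewrite -(pair_bigA _ (fun (j : 'I_M.+1) (_ : bool) => g j))/= mulr_sumr.
  by apply: eq_bigr => j _; rewrite big_bool/=; ring.
rewrite big_seq (eq_bigr _ HE) -big_seq -(big_map enc xpredT H).
have uA : uniq [seq enc y | y <- A].
  rewrite map_inj_in_uniq ?fset_uniq// => y z yA zA /ffunP e.
  apply/ffunP => i; have := e i; rewrite !ffunE => -[e1 e2].
  have : absz (x i - y i) = absz (x i - z i).
    by have := congr1 val e1; rewrite /= !inordK// ltnS AM.
  move=> e3; have : x i - y i = x i - z i.
    by rewrite -(int_codeK (x i - y i)) -(int_codeK (x i - z i)) e2 e3.
  by move/addrI/oppr_inj.
rewrite big_uniq//= [leRHS](bigID (mem [seq enc y | y <- A]))/=.
by rewrite lerDl sumr_ge0// => f _; apply: prodr_ge0.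
Qed.

Lemma distZ_ge (d : nat) (x y : Zd d) i : (absz (x i - y i) <= distZ x y)%N.
Proof. by rewrite /distZ (bigD1 i)//= leq_addr. Qed.

Lemma distZ_gt0 (d : nat) (x y : Zd d) : x != y -> (0 < distZ x y)%N.
Proof.
apply: contraNT; rewrite -leqNgt leqn0 => /eqP e.
apply/eqP/ffunP => i; apply/eqP; rewrite -subr_eq0 -absz_eq0 -leqn0 -e.
exact: distZ_ge.
Qed.

(* Each factor satisfies [1 + |x_i - y_i| <= 2 |x - y|], which dominates the
   kernel by a product of summable one-dimensional kernels. *)
Lemma powR_dist_le_prod (d : nat) (s : R) (x y : Zd d) :
  (0 < d)%N -> 0 < s -> x != y ->
  (distZ x y)%:R `^ (- (d%:R + 2 * s)) <=
  2 `^ (d%:R + 2 * s) *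
    \prod_(i < d) (absz (x i - y i)).+1%:R `^ (- (1 + 2 * s / d%:R)).
Proof.
move=> d0 s0 /distZ_gt0; set n := distZ x y => n0.
have d0' : 0 < d%:R :> R by rewrite ltr0n.
(* The exponent [d + 2 s] is shared equally among the [d] coordinates; each share [1 + t] exceeds 1,
   so the one-dimensional series converges. *)
set t := 2 * s / d%:R; have t0 : 0 < t by rewrite divr_gt0// mulr_gt0.
have n0' : 0 < n%:R :> R by rewrite ltr0n.
have qE : - (d%:R + 2 * s) = - (1 + t) * d%:R by rewrite /t; field; rewrite gt_eqF.
have : (2 * n%:R) `^ (- (d%:R + 2 * s)) <=
   \prod_(i < d) (absz (x i - y i)).+1%:R `^ (- (1 + t)).
  rewrite qE powRrM powR_mulrn ?powR_ge0//.
  rewrite -[in leLHS](card_ord d) -prodr_const; apply: ler_prod => i _.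
  rewrite powR_ge0/= !powRN lef_pV2 ?posrE ?powR_gt0 ?ltr0n ?mulr_gt0//.
  apply: ge0_ler_powR; rewrite ?nnegrE ?ler0n ?mulr_ge0 ?ler0n//; first lra.
  rewrite -natrM ler_nat mul2n -addnn -addn1 addnC leq_add//.
  exact: distZ_ge.
move=> /(ler_wpM2l (powR_ge0 2 (d%:R + 2 * s))).
apply: le_trans; rewrite powRM// mulrA -powRD.
  by rewrite subrr powRr0 mul1r.
by rewrite pnatr_eq0 implybT.
Qed.

Lemma dist_row_sum (d : nat) (s : R) : (0 < d)%N -> 0 < s ->
  exists W : R, forall (x : Zd d) (A : {fset Zd d}),
    \sum_(y <- A | y != x) (distZ x y)%:R `^ (- (d%:R + 2 * s)) <= W.
Proof.
move=> d0 s0; have d0' : 0 < d%:R :> R by rewrite ltr0n.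
set t := 2 * s / d%:R; have t0 : 0 < t by rewrite divr_gt0// mulr_gt0.
exists (2 `^ (d%:R + 2 * s) * (2 * (1 + t^-1)) ^+ d) => x A.
apply: (@le_trans _ _ (2 `^ (d%:R + 2 * s) *
   \sum_(y <- A) \prod_(i < d) (absz (x i - y i)).+1%:R `^ (- (1 + t)))).
  rewrite mulr_sumr big_mkcond/=; apply: ler_sum => y _.
  case: ifPn => [yx|_]; first by rewrite powR_dist_le_prod// eq_sym.
  by rewrite mulr_ge0 ?powR_ge0// prodr_ge0// => i _; exact: powR_ge0.
rewrite ler_wpM2l ?powR_ge0//.
(* The box depends on [A], but the bound [1 + t^-1] on the one-dimensional sums does not. *)
pose M := \max_(y <- A) distZ x y.
apply: le_trans (@box_prod_sum d M (fun n => n.+1%:R `^ (- (1 + t))) x A _ _) _.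
- by move=> n; exact: powR_ge0.
- move=> y i yA; apply: leq_trans (distZ_ge x y i) _.
  by rewrite /M; apply: (@leq_bigmax_seq _ _ xpredT).
- apply: lerXn2r; rewrite ?nnegrE.
  + by rewrite mulr_ge0// sumr_ge0// => j _; exact: powR_ge0.
  + by rewrite mulr_ge0// addr_ge0// invr_ge0 ltW.
  + by rewrite ler_pM2l// sum_powR_le.
Qed.

End KernelSum.
(** * The Dirichlet form on square-summable functions *)

Section SquareSummable.
Variables (R : realType) (d : nat).
Local Notation T := (Zd d).
Implicit Types (u v : T -> R) (A : {fset T}).

Definition l2 u := summ (fun x => u x ^+ 2).

Lemma l2_le u v : l2 v -> (forall x, `|u x| <= `|v x|) -> l2 u.
Proof.
move=> lv uv; apply: summ_le lv _ => x.
by rewrite !normrX lerXn2r ?nnegrE.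
Qed.

Lemma l2Z c u : l2 u -> l2 (fun x => c * u x).
Proof.
by move=> lu; rewrite /l2; under eq_fun do rewrite exprMn; exact: summZ.
Qed.

Lemma l2D u v : l2 u -> l2 v -> l2 (fun x => u x + v x).
Proof.
move=> lu lv; apply: summ_le0 (summD (summZ 2 lu) (summZ 2 lv)) _ => x.
by rewrite ger0_norm ?sqr_ge0//; have := sqr_ge0 (u x - v x); lra.
Qed.

Lemma l2N u : l2 u -> l2 (fun x => - u x).
Proof. by move=> lu; apply: l2_le lu _ => x; rewrite normrN. Qed.

Lemma l2B u v : l2 u -> l2 v -> l2 (fun x => u x - v x).
Proof. by move=> lu lv; apply: l2D => //; exact: l2N. Qed.

Lemma normM_le_sqr (a b : R) : `|a * b| <= a ^+ 2 + b ^+ 2.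
Proof.
rewrite normrM -(real_normK (num_real a)) -(real_normK (num_real b)).
have := sqr_ge0 (`|a| - `|b|); have := sqr_ge0 (`|a| + `|b|); lra.
Qed.

Lemma summM u v : l2 u -> l2 v -> summ (fun x => u x * v x).
Proof.
by move=> lu lv; apply: summ_le0 (summD lu lv) _ => x; exact: normM_le_sqr.
Qed.

Lemma sumZ_tail (f : T -> R) (e : R) : (forall x, 0 <= f x) -> summ f -> 0 < e ->
  exists A, sumZ (fun x => if x \in A then 0 else f x) < e.
Proof.
move=> f0 sf e0; have [A fA] := sumZ_approx f0 e0; exists A.
have s1 : summ (fun x => if x \in A then f x else 0).
  by apply: summ_le sf _ => x; case: ifP; rewrite ?normr0.
have s2 : summ (fun x => if x \in A then 0 else f x).
  by apply: summ_le sf _ => x; case: ifP; rewrite ?normr0.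
have : sumZ f = sumZ (fun x => if x \in A then f x else 0) +
    sumZ (fun x => if x \in A then 0 else f x).
  by rewrite -sumZD//; apply: sumZ_eq => x; case: ifP; rewrite ?addr0 ?add0r.
have : \sum_(x <- A) f x <= sumZ (fun x => if x \in A then f x else 0).
  apply: le_trans (ler_fset_sumZ A _ s1); last by move=> x; case: ifP.
  by rewrite big_seq [leRHS]big_seq; apply: ler_sum => x ->.
lra.
Qed.

Lemma sqr_term_le u x : l2 u -> u x ^+ 2 <= sumZ (fun y => u y ^+ 2).
Proof. by move=> lu; apply: ler_term_sumZ lu => y; exact: sqr_ge0. Qed.

Lemma l2_bounded u : l2 u -> exists2 M, 0 < M & forall x, `|u x| <= M.
Proof.
move=> lu; set S := sumZ (fun y => u y ^+ 2).
have S0 : 0 <= S by apply: sumZ_ge0 => x; exact: sqr_ge0.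
(* [1 + S] replaces a square root: [r^2 <= S] implies [2 r <= 1 + S]. *)
exists (1 + S) => [|x]; first lra.
have := sqr_term_le x lu; rewrite -/S -(real_normK (num_real (u x))) => h.
by have := sqr_ge0 (`|u x| - 1); have := normr_ge0 (u x); nra.
Qed.

End SquareSummable.

Section DirichletForm.
Variables (R : realType) (d : nat).
Local Notation T := (Zd d).
Variable w : T -> T -> R.
Variable W : R.
Hypothesis wC : forall x y : T, x != y -> w x y = w y x.
Hypothesis w_gt0 : forall x y : T, x != y -> 0 < w x y.
Hypothesis wW : forall (x : T) (A : {fset T}), \sum_(y <- A | y != x) w x y <= W.
Implicit Types (u v : T -> R) (A : {fset T}).

(** The weight is unspecified on the diagonal; setting it to 0 there lets all sums run over the
    whole lattice. *)
Definition ker (x y : T) := if y == x then 0 else w x y.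

Lemma ker_ge0 x y : 0 <= ker x y.
Proof. by rewrite /ker; case: eqVneq => // yx; rewrite ltW// w_gt0// eq_sym. Qed.

Lemma kerC x y : ker x y = ker y x.
Proof. by rewrite /ker eq_sym; case: eqVneq => // /wC. Qed.

Lemma sum_ker x A : \sum_(y <- A) ker x y <= W.
Proof.
apply: le_trans (wW x A); rewrite [leRHS]big_mkcond/=; apply: ler_sum => y _.
by rewrite /ker; case: eqP.
Qed.

Lemma W_ge0 (x : T) : 0 <= W.
Proof.
by apply: le_trans (sum_ker x fset0); rewrite sumr_ge0// => y _; exact: ker_ge0.
Qed.

Lemma summ_ker x : summ (ker x).
Proof.
exists W => A; apply: le_trans (sum_ker x A); apply: ler_sum => y _.
by rewrite ger0_norm ?ker_ge0.
Qed.

Lemma sumZ_ker x : sumZ (ker x) <= W.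
Proof. by apply: sumZ_le_fset => [y|A]; [exact: ker_ge0|exact: sum_ker]. Qed.

Lemma ker_le x y : ker x y <= W.
Proof.
exact: le_trans (ler_term_sumZ y (ker_ge0 x) (summ_ker x)) (sumZ_ker x).
Qed.

Definition row u v x y := ker x y * ((u x - u y) * (v x - v y)).

Lemma gradprodE u v x : gradprod w u v x = 2^-1 * sumZ (row u v x).
Proof.
congr (_ * _); apply: sumZ_eq => y; rewrite /row /ker.
by case: ifP; rewrite ?mul0r ?mulrA.
Qed.

Definition colsum (f : T -> R) x := sumZ (fun y => ker x y * f y).

Lemma summ_ker_mul f x : (forall y, 0 <= f y) -> summ f ->
  summ (fun y => ker x y * f y).
Proof.
move=> f0 sf; apply: summ_le0 (summZ W sf) _ => y.
by rewrite ger0_norm ?mulr_ge0 ?ker_ge0// ler_wpM2r// ker_le.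
Qed.

Lemma colsum_ge0 f x : (forall y, 0 <= f y) -> 0 <= colsum f x.
Proof. by move=> f0; apply: sumZ_ge0 => y; rewrite mulr_ge0 ?ker_ge0. Qed.

(* Exchanging only a finite sum over [x] with the sum over [y] makes Tonelli
   unnecessary. *)
Lemma sum_colsum f A : (forall y, 0 <= f y) -> summ f ->
  \sum_(x <- A) colsum f x <= W * sumZ f.
Proof.
move=> f0 sf; rewrite -sumZ_sum => [|x]; last exact: summ_ker_mul.
rewrite -sumZZ//; apply: ler_sumZ.
- by apply: summ_sum => x; exact: summ_ker_mul.
- exact: summZ.
move=> y; rewrite -mulr_suml ler_wpM2r//; apply: le_trans (sum_ker y A).
(* Symmetry turns a column sum into a row sum, which [W] bounds. *)
by rewrite (eq_bigr (ker y))// => x _; exact: kerC.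
Qed.

Lemma summ_colsum f : (forall y, 0 <= f y) -> summ f -> summ (colsum f).
Proof.
move=> f0 sf; exists (W * sumZ f) => A; apply: le_trans (sum_colsum A f0 sf).
by apply: ler_sum => x _; rewrite ger0_norm ?colsum_ge0.
Qed.

Lemma sumZ_colsum f : (forall y, 0 <= f y) -> summ f ->
  sumZ (colsum f) <= W * sumZ f.
Proof.
move=> f0 sf; apply: sumZ_le_fset => [x|A]; first exact: colsum_ge0.
exact: sum_colsum.
Qed.

Let q u v x := u x ^+ 2 + v x ^+ 2.

Let q0 u v x : 0 <= q u v x.
Proof. by rewrite addr_ge0 ?sqr_ge0. Qed.

Lemma row_le u v x y : `|row u v x y| <= ker x y * q u v x + ker x y * q u v y.
Proof.
rewrite /row normrM ger0_norm ?ker_ge0// -mulrDr ler_wpM2l ?ker_ge0//.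
rewrite ler_norml /q; apply/andP; split.
  have := sqr_ge0 ((u x - u y) + (v x - v y)); have := sqr_ge0 (u x + u y).
  by have := sqr_ge0 (v x + v y); nra.
have := sqr_ge0 ((u x - u y) - (v x - v y)); have := sqr_ge0 (u x + u y).
by have := sqr_ge0 (v x + v y); nra.
Qed.

Lemma summ_row_bound u v x : l2 u -> l2 v ->
  summ (fun y => ker x y * q u v x + ker x y * q u v y).
Proof.
move=> lu lv; apply: summD; last exact: (summ_ker_mul x (q0 u v) (summD lu lv)).
by under eq_fun do rewrite mulrC; apply: summZ; exact: summ_ker.
Qed.

Lemma summ_row u v x : l2 u -> l2 v -> summ (row u v x).
Proof.
move=> lu lv; apply: summ_le0 (summ_row_bound x lu lv) _ => y.
exact: row_le.
Qed.

Lemma gradprod_le u v x : l2 u -> l2 v ->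
  `|gradprod w u v x| <= 2^-1 * (W * q u v x + colsum (q u v) x).
Proof.
move=> lu lv; rewrite gradprodE normrM gtr0_norm ?invr_gt0// ler_pM2l ?invr_gt0//.
have sr := summ_row x lu lv.
apply: le_trans (sumZ_norm_le sr) _.
apply: (@le_trans _ _ (sumZ (fun y => ker x y * q u v x + ker x y * q u v y))).
  apply: ler_sumZ; [exact: summ_norm|exact: summ_row_bound|exact: row_le].
rewrite sumZD; first last.
- exact: (summ_ker_mul x (q0 u v) (summD lu lv)).
- by under eq_fun do rewrite mulrC; apply: summZ; exact: summ_ker.
rewrite lerD2r; under sumZ_eq do rewrite mulrC.
rewrite sumZZ; last exact: summ_ker.
by rewrite mulrC ler_wpM2r// sumZ_ker.
Qed.

Lemma summ_gradprod_bound u v : l2 u -> l2 v ->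
  summ (fun x => 2^-1 * (W * q u v x + colsum (q u v) x)).
Proof.
move=> lu lv; have sq : summ (q u v) by exact: summD.
by apply: summZ; apply: summD; [exact: summZ|exact: summ_colsum].
Qed.

Lemma summ_gradprod u v : l2 u -> l2 v -> summ (gradprod w u v).
Proof.
move=> lu lv; apply: summ_le0 (summ_gradprod_bound lu lv) _ => x.
exact: gradprod_le.
Qed.

Local Notation E u v := (sumZ (gradprod w u v)).

Lemma E_le u v : l2 u -> l2 v ->
  `|E u v| <= W * (sumZ (fun x => u x ^+ 2) + sumZ (fun x => v x ^+ 2)).
Proof.
move=> lu lv; have sg := summ_gradprod lu lv.
apply: le_trans (sumZ_norm_le sg) _.
have sq : summ (q u v) by exact: summD.
apply: (@le_trans _ _ (sumZ (fun x => 2^-1 * (W * q u v x + colsum (q u v) x)))).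
  apply: ler_sumZ; [exact: summ_norm|exact: summ_gradprod_bound|].
  by move=> x; exact: gradprod_le.
have sc : summ (colsum (q u v)) by exact: summ_colsum.
rewrite sumZZ; last by apply: summD => //; exact: summZ.
rewrite sumZD//; last exact: summZ.
rewrite sumZZ// -sumZD//.
by have := sumZ_colsum (q0 u v) sq; rewrite -/(q u v); lra.
Qed.

Lemma E_sqr_le u : l2 u -> E u u <= 2 * W * sumZ (fun x => u x ^+ 2).
Proof. by move=> lu; have := E_le lu lu; have := ler_norm (E u u); lra. Qed.

Lemma gradprodC u v : gradprod w u v = gradprod w v u.
Proof.
apply/funext => x; rewrite !gradprodE; congr (_ * _); apply: sumZ_eq => y.
by rewrite /row; ring.
Qed.

Lemma E_C u v : E u v = E v u.
Proof. by rewrite gradprodC. Qed.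

Lemma gradprodDl u u' v : l2 u -> l2 u' -> l2 v ->
  gradprod w (fun x => u x + u' x) v = (fun x => gradprod w u v x + gradprod w u' v x).
Proof.
move=> lu lu' lv; apply/funext => x; rewrite !gradprodE -mulrDr -sumZD; [|exact: summ_row..].
by congr (_ * _); apply: sumZ_eq => y; rewrite /row; ring.
Qed.

Lemma gradprodZl c u v : l2 u -> l2 v ->
  gradprod w (fun x => c * u x) v = (fun x => c * gradprod w u v x).
Proof.
move=> lu lv; apply/funext => x; rewrite !gradprodE mulrCA -(sumZZ c); last exact: summ_row.
by congr (_ * _); apply: sumZ_eq => y; rewrite /row; ring.
Qed.

Lemma E_Dl u u' v : l2 u -> l2 u' -> l2 v -> E (fun x => u x + u' x) v = E u v + E u' v.
Proof. by move=> *; rewrite gradprodDl// sumZD//; exact: summ_gradprod. Qed.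

Lemma E_Dr u u' v : l2 u -> l2 u' -> l2 v -> E v (fun x => u x + u' x) = E v u + E v u'.
Proof. by move=> *; rewrite E_C E_Dl// (E_C v u) (E_C v u'). Qed.

Lemma E_Zl c u v : l2 u -> l2 v -> E (fun x => c * u x) v = c * E u v.
Proof. by move=> *; rewrite gradprodZl// sumZZ//; exact: summ_gradprod. Qed.

Lemma E_Zr c u v : l2 u -> l2 v -> E v (fun x => c * u x) = c * E v u.
Proof. by move=> *; rewrite E_C E_Zl// (E_C v u). Qed.

Lemma gradprod_ge0 u x : 0 <= gradprod w u u x.
Proof.
rewrite gradprodE mulr_ge0 ?invr_ge0//; apply: sumZ_ge0 => y.
by rewrite mulr_ge0 ?ker_ge0// -expr2 sqr_ge0.
Qed.

Lemma E_ge0 u : 0 <= E u u.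
Proof. by apply: sumZ_ge0 => x; exact: gradprod_ge0. Qed.

(** Disjoint supports reduce [(u x - u y) (v x - v y)] to [- u x v y - u y v x], which is
    nonnegative for opposite signs. *)
Lemma E_disjoint_ge0 u v : (forall x, 0 <= u x) -> (forall x, v x <= 0) ->
  (forall x, u x * v x = 0) -> 0 <= E u v.
Proof.
move=> u0 v0 uv; apply: sumZ_ge0 => x; rewrite gradprodE mulr_ge0 ?invr_ge0//.
apply: sumZ_ge0 => y; rewrite mulr_ge0 ?ker_ge0//.
have := uv x; have := uv y.
have := mulr_ge0_le0 (u0 x) (v0 y); have := mulr_ge0_le0 (u0 y) (v0 x).
by lra.
Qed.

Lemma gradsqE_l2 u x : l2 u -> gradsqE w u x = (gradprod w u u x)%:E.
Proof.
move=> lu; have sr := summZ 2^-1 (summ_row x lu lu).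
have r0 y : 0 <= 2^-1 * row u u x y.
  by rewrite mulr_ge0 ?invr_ge0// mulr_ge0 ?ker_ge0// -expr2 sqr_ge0.
rewrite /gradsqE esum_mkcond gradprodE -sumZZ; last exact: summ_row.
rewrite sumZ_nnsum// -nnsumE//; apply: eq_esum => y _.
have -> : (y \in [set y | y != x]) = (y != x) by apply/idP/idP; rewrite inE.
rewrite /row /ker; case: eqVneq => _ /=; first by rewrite mul0r mulr0.
by congr EFin; ring.
Qed.

Lemma normW2E_l2 u : l2 u -> exists2 r : R, normW2E w u = r%:E &
  0 <= r <= (2 * W + 1) * sumZ (fun x => u x ^+ 2).
Proof.
move=> lu; have sg := summ_gradprod lu lu.
exists (sumZ (fun x => gradprod w u u x + u x ^+ 2)).
  have g0 x : 0 <= gradprod w u u x + u x ^+ 2.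
    by rewrite addr_ge0 ?gradprod_ge0 ?sqr_ge0.
  rewrite sumZ_nnsum// -nnsumE//; last exact: summD.
  by apply: eq_esum => x _; rewrite gradsqE_l2// EFinD.
rewrite sumZ_ge0/= => [|x]; last by rewrite addr_ge0 ?gradprod_ge0 ?sqr_ge0.
by rewrite sumZD//; have := E_sqr_le lu; lra.
Qed.

(** The approximants truncate [u] along an enumeration of the lattice. By [normW2E_l2] their error
    in [W^{s,2}] is at most a multiple of an l^2 tail. *)
Lemma l2_inW u : l2 u -> inW w u.
Proof.
move=> lu.
pose un n (x : T) : R := if (choice.pickle x < n)%N then u x else 0.
have lg n : l2 (fun x => un n x - u x).
  apply: l2_le lu _ => x; rewrite /un; case: ifP => _; first by rewrite subrr normr0.
  by rewrite sub0r normrN.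
exists un; split=> [n|].
  apply: (@sub_finite_set _ _ (choice.pickle @^-1` `I_n)).
    by move=> x /=; rewrite /un; case: ifP => //; rewrite eqxx.
  by apply: finite_preimage; [move=> x y _ _; exact: (pcan_inj choice.pickleK)|exact: finite_II].
have [r rE rP] : exists2 r : nat -> R, (forall n, normW2E w (fun x => un n x - u x) = (r n)%:E)
    & forall n, 0 <= r n <= (2 * W + 1) * sumZ (fun x => (un n x - u x) ^+ 2).
  have /choice[r rP] : forall n, exists r : R, normW2E w (fun x => un n x - u x) = r%:E /\
      0 <= r <= (2 * W + 1) * sumZ (fun x => (un n x - u x) ^+ 2).
    by move=> n; have [r ? ?] := normW2E_l2 (lg n); exists r.
  by exists r => n; have [] := rP n.
under eq_fun do rewrite rE.
apply: cvg_EFin; first by near=> n.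
have W1 : 0 < 2 * W + 1 by have := W_ge0 (finfun (fun=> 0)); lra.
apply/cvgrPdist_lt => e e0.
have [A Ae] := sumZ_tail (fun x => sqr_ge0 (u x)) lu (divr_gt0 e0 W1).
near=> n.
rewrite sub0r normrN; have /andP[r0 rle] := rP n; rewrite ger0_norm//.
apply: le_lt_trans rle _; rewrite mulrC -ltr_pdivlMr//.
apply: le_lt_trans Ae; apply: ler_sumZ => [||x].
- exact: lg.
- by apply: summ_le lu _ => x; case: ifP; rewrite ?normr0.
have nA : forall x, x \in A -> (choice.pickle x < n)%N.
  move=> y yA; have : (\max_(z <- A) choice.pickle z < n)%N by near: n; exists (\max_(z <- A) choice.pickle z).+1.
  by apply: leq_ltn_trans; apply: (@leq_bigmax_seq _ _ xpredT).
case: ifPn => xA; first by rewrite /un nA// subrr expr0n.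
by rewrite /un; case: ifP => _; rewrite ?subrr ?expr0n ?sqr_ge0// sub0r sqrrN.
Unshelve. all: by end_near. Qed.

End DirichletForm.
(** * The logarithmic power nonlinearity *)

Section PowLog.
Variables (R : realType) (p : R).
Hypothesis p3 : 3 < p.
Implicit Types c s t x y a e M : R.

(** One family containing [|t|^p], [|t|^p ln (t^2)] and the primitive [Flog], so that each estimate
    is proved once. It is closed under scaling by [plog_expR]. *)
Definition plog (c1 c2 t : R) : R := `|t| `^ p * (c1 + c2 * ln (t ^+ 2)).

Let p0 : 0 < p. Proof. by have := p3; lra. Qed.

Lemma plog_norm c1 c2 t : plog c1 c2 `|t| = plog c1 c2 t.
Proof. by rewrite /plog normr_id real_normK ?num_real. Qed.

Lemma plogN c1 c2 t : plog c1 c2 (- t) = plog c1 c2 t.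
Proof. by rewrite /plog normrN sqrrN. Qed.

Lemma plog0 c1 c2 : plog c1 c2 0 = 0.
Proof. by rewrite /plog normr0 powR0 ?mul0r// gt_eqF. Qed.

Lemma plog_gt0E c1 c2 t : 0 < t -> plog c1 c2 t = t `^ p * (c1 + c2 * (2 * ln t)).
Proof. by move=> t0; rewrite /plog gtr0_norm// lnXn// mulr_natl. Qed.

Definition dplog (c1 c2 t : R) : R :=
  t `^ (p - 1) * (p * c1 + 2 * c2 + 2 * p * c2 * ln t).

Lemma is_derive_plog c1 c2 t : 0 < t ->
  is_derive t 1 (fun t => t `^ p * (c1 + c2 * (2 * ln t))) (dplog c1 c2 t).
Proof.
move=> t0.
have d1 := is_derive1_powR p t0; have d2 := is_derive1_ln t0.
apply: is_derive_eq.
rewrite /dplog -!/(_ *: _) /GRing.scale/=.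
have -> : t `^ p = t * t `^ (p - 1) by rewrite mulr_powRB1// ltW.
by field; rewrite gt_eqF.
Qed.

(** From [|ln t| <= t + t^-1]: the singular term costs one power of [t], which is available because
    [p > 3]. *)
Lemma powlog_bound (k1 k2 M : R) : 0 < M ->
  exists2 C, 0 <= C & forall t, 0 < t -> t <= M ->
    `|t `^ (p - 1) * (k1 + k2 * ln t)| <= C * t.
Proof.
move=> M0.
set B := M `^ (p - 2); set B' := M `^ (p - 3).
have B0 : 0 <= B by exact: powR_ge0. have B'0 : 0 <= B' by exact: powR_ge0.
exists (B * `|k1| + `|k2| * (B * M + B')) => [|t t0 tM].
  by rewrite addr_ge0 ?mulr_ge0// addr_ge0// mulr_ge0// ltW.
have e1 : t `^ (p - 1) = t * t `^ (p - 2).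
  rewrite -(@mulr_powRB1 _ t (p - 1)) ?ltW//; last by have := p3; lra.
  by congr (_ * _ `^ _); ring.
have e2 : t `^ (p - 2) = t * t `^ (p - 3).
  rewrite -(@mulr_powRB1 _ t (p - 2)) ?ltW//; last by have := p3; lra.
  by congr (_ * _ `^ _); ring.
have b1 : t `^ (p - 2) <= B.
  by apply: ge0_ler_powR; rewrite ?nnegrE//; have := p3; lra.
have b2 : t `^ (p - 3) <= B'.
  by apply: ge0_ler_powR; rewrite ?nnegrE//; have := p3; lra.
have l : `|ln t| <= t + t^-1.
  have := ln_sublinear t0; have := @ln_sublinear R t^-1.
  rewrite invr_gt0 lnV ?posrE// => /(_ t0) l1 l2.
  have : 0 < t^-1 by rewrite invr_gt0.
  by rewrite ler_norml => ?; apply/andP; split; lra.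
have z0 := powR_ge0 t (p - 2); have z1 := powR_ge0 t (p - 3).
rewrite normrM ger0_norm ?powR_ge0// e1 [leRHS]mulrC -mulrA ler_pM2l//.
apply: le_trans (ler_wpM2l z0 (ler_normD _ _)) _.
rewrite mulrDr normrM; apply: lerD; first by rewrite ler_wpM2r.
rewrite mulrCA ler_wpM2l//.
apply: le_trans (ler_wpM2l z0 l) _; rewrite mulrDr; apply: lerD.
  by apply: ler_pM => //; exact: ltW.
by rewrite e2 mulrAC divff ?gt_eqF// mul1r.
Qed.

Lemma plog_MVT c1 c2 x y : 0 < x -> x < y ->
  exists2 c, x < c < y & plog c1 c2 y - plog c1 c2 x = dplog c1 c2 c * (y - x).
Proof.
move=> x0 xy.
have [|||c] := @MVT R (fun t => t `^ p * (c1 + c2 * (2 * ln t))) (dplog c1 c2) x y.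
- exact: xy.
- by move=> z; rewrite in_itv/= => /andP[xz _]; apply: is_derive_plog; lra.
- apply: derivable_within_continuous => z; rewrite in_itv/= => /andP[xz _].
  have z0 : 0 < z by lra.
  by have := is_derive_plog c1 c2 z0 => -[].
rewrite in_itv/= => cxy E; exists c => //.
by rewrite !plog_gt0E// (lt_trans x0).
Qed.

(** The factor [|s| + |t|] makes the right side quadratic, so that after summation it is controlled
    by l^2 norms. By evenness the mean value theorem is needed only between nonnegative
    arguments. *)
Lemma plog_lip c1 c2 M : 0 < M -> exists2 C, 0 <= C &
  forall s t, `|s| <= M -> `|t| <= M ->
    `|plog c1 c2 s - plog c1 c2 t| <= C * (`|s| + `|t|) * `|s - t|.
Proof.
move=> M0.
have [C1 C10 H1] := powlog_bound (p * c1 + 2 * c2) (2 * p * c2) M0.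
have [C2 C20 H2] := powlog_bound c1 (2 * c2) M0.
exists (C1 + C2) => [|s t sM tM]; first lra.
wlog ts : s t sM tM / `|t| <= `|s|.
  move=> H; have [/H|/ltW/H] := leP `|t| `|s|; first exact.
  by rewrite distrC (distrC t s) (addrC `|s|); apply.
rewrite -(plog_norm _ _ s) -(plog_norm _ _ t).
suff : `|plog c1 c2 `|s| - plog c1 c2 `|t| | <= (C1 + C2) * (`|s| + `|t|) * (`|s| - `|t|).
  move=> /le_trans; apply; apply: ler_wpM2l.
    by rewrite mulr_ge0// addr_ge0.
  by have := ler_dist_dist s t; have := ler_norm (`|s| - `|t|); lra.
move: sM tM ts; set x := `|s|; set y := `|t|.
have: 0 <= x by exact: normr_ge0.
have : 0 <= y by exact: normr_ge0.
clearbody x y => y0 x0 xM yM yx.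
have [yx'|yx'|<-] := ltgtP y x; last 2 first.
- lra.
- by rewrite !subrr normr0 mulr0.
have [y0'|y0'|y0'] := ltgtP 0 y; last 2 first.
- lra.
(* The mean value theorem is available only on positive intervals, so the endpoint 0 is estimated
   directly. *)
- rewrite -y0' plog0 !subr0 addr0 plog_gt0E; last lra.
  have x0' : 0 < x by lra.
  have -> : x `^ p * (c1 + c2 * (2 * ln x)) = x * (x `^ (p - 1) * (c1 + 2 * c2 * ln x)).
    by rewrite -(@mulr_powRB1 _ x p)//; ring.
  rewrite normrM ger0_norm//; apply: le_trans (ler_wpM2l x0 (H2 x x0' xM)) _.
  by have := mulr_ge0 C10 (mulr_ge0 x0 x0); lra.
have [c /andP[yc cx] ->] := plog_MVT c1 c2 y0' yx'.
rewrite normrM (@gtr0_norm _ (x - y)) ?subr_gt0//; apply: ler_wpM2r; first lra.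
apply: le_trans (H1 c _ _) _; [lra..|].
by apply: ler_pM; lra.
Qed.

Lemma plog_sqr_le c1 c2 M : 0 < M -> exists2 C, 0 <= C &
  forall t, `|t| <= M -> `|plog c1 c2 t| <= C * t ^+ 2.
Proof.
move=> M0; have [C C0 H] := plog_lip c1 c2 M0; exists C => // t tM.
have := H t 0 tM; rewrite normr0 plog0 !subr0 addr0 => /(_ (ltW M0)).
by rewrite -mulrA -expr2 real_normK ?num_real.
Qed.

Definition flog (t : R) : R := `|t| `^ (p - 2) * t * ln (t ^+ 2).
(** The primitive of [flog] vanishing at 0: with these constants the term of [dplog] without a
    logarithm cancels. *)
Definition Flog (t : R) : R := plog (- 2 / p ^+ 2) p^-1 t.

Lemma flogN t : flog (- t) = - flog t.
Proof. by rewrite /flog normrN sqrrN; ring. Qed.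

Lemma flog0 : flog 0 = 0.
Proof. by rewrite /flog mulr0 mul0r. Qed.

Lemma flog_gt0E t : 0 < t -> flog t = t `^ (p - 1) * (2 * ln t).
Proof.
move=> t0; rewrite /flog gtr0_norm// lnXn// mulr_natl [_ * t]mulrC; congr (_ * _).
rewrite -(@mulr_powRB1 _ t (p - 1)) ?ltW//; last by have := p3; lra.
by congr (_ * _ `^ _); ring.
Qed.

Lemma dplog_flog t : 0 < t -> dplog (- 2 / p ^+ 2) p^-1 t = flog t.
Proof.
move=> t0; rewrite flog_gt0E// /dplog; congr (_ * _).
by field; rewrite gt_eqF.
Qed.

Lemma flogM t : flog t * t = plog 0 1 t.
Proof.
have [->|t0] := eqVneq t 0; first by rewrite mulr0 plog0.
rewrite /flog /plog add0r mul1r.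
have -> : `|t| `^ (p - 2) * t * ln (t ^+ 2) * t = `|t| `^ (p - 2) * t ^+ 2 * ln (t ^+ 2) by ring.
congr (_ * _).
rewrite -[X in _ * X]real_normK ?num_real// -powR_mulrn// -powRD.
  by congr (_ `^ _); ring.
by rewrite normr_eq0 t0 implybT.
Qed.

Lemma flog_le M : 0 < M -> exists2 C, 0 <= C &
  forall t, `|t| <= M -> `|flog t| <= C * `|t|.
Proof.
move=> M0; have [C C0 H] := powlog_bound 0 2 M0; exists C => // t tM.
have [->|t0] := eqVneq t 0; first by rewrite flog0 normr0 mulr0.
have t0' : 0 < `|t| by rewrite normr_gt0.
have := H _ t0' tM; rewrite add0r -flog_gt0E//.
by have [t1|t1] := ler0P t; rewrite ?flogN ?normrN.
Qed.

Lemma flog_continuous t : 0 < t -> {for t, continuous (fun t => t `^ (p - 1) * (2 * ln t))}.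
Proof.
move=> t0; apply: differentiable_continuous; apply/derivable1_diffP.
have d1 := is_derive1_powR (p - 1) t0; have d2 := is_derive1_ln t0.
by apply: ex_derive.
Qed.

(** A strict derivative: the base point [y] moves too. This is needed because the competitors start
    from points whose value at the perturbed site is only close to that of the minimizer. *)
Lemma Flog_strict_derivative c e : 0 < e -> exists2 dl, 0 < dl &
  forall y t, `|y - c| < dl -> `|t| < dl ->
    `|Flog (y + t) - Flog y - t * flog c| <= e * `|t|.
Proof.
move=> e0.
have pos c' : 0 < c' -> exists2 dl, 0 < dl &
  forall y t, `|y - c'| < dl -> `|t| < dl ->
    `|Flog (y + t) - Flog y - t * flog c'| <= e * `|t|.
  move=> c0; have /cvgrPdist_lt/(_ e e0)/nbhs_ballP[r /= r0 rP] := flog_continuous c0.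
  (* Twice the minimum serves as radius: [y], [y + t] and the intermediate point all stay positive
     and within [r] of [c']. *)
  have near0 z : `|z - c'| < Num.min (r / 2) (c' / 2) + Num.min (r / 2) (c' / 2) ->
      0 < z /\ `|flog c' - flog z| < e.
    move=> zc; have m1 : Num.min (r / 2) (c' / 2) <= r / 2 by rewrite ge_min lexx.
    have m2 : Num.min (r / 2) (c' / 2) <= c' / 2 by rewrite ge_min lexx orbT.
    have z0 : 0 < z by move: zc; rewrite ltr_norml => /andP[]; lra.
    split=> //; rewrite !flog_gt0E//; apply: rP.
    by rewrite /ball/= distrC; lra.
  exists (Num.min (r / 2) (c' / 2)) => [|y t yc tt]; first by rewrite lt_min; apply/andP; split; lra.
  set m := Num.min _ _ in near0 yc tt.
  have N1 : `|y - c'| < m + m by have := normr_ge0 t; lra.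
  have N2 : `|y + t - c'| < m + m.
    by apply: le_lt_trans (_ : `|y - c'| + `|t| < _); [rewrite addrAC ler_normD|lra].
  have [y0 _] := near0 _ N1; have [yt0 _] := near0 _ N2.
  have [tpos|tneg|<-] := ltgtP 0 t; last first.
  - by rewrite addr0 subrr mul0r subrr normr0 mulr0.
  - have yt : y + t < y by lra.
    have [z /andP[z1 z2]] := plog_MVT (- 2 / p ^+ 2) p^-1 yt0 yt.
    have zc : `|z - c'| < m + m.
      move: N1 N2; rewrite !ltr_norml => /andP[? ?] /andP[? ?].
      by apply/andP; split; lra.
    have [z0 ze] := near0 _ zc.
    rewrite dplog_flog// -/(Flog _) -/(Flog _) => E.
    have -> : Flog (y + t) - Flog y - t * flog c' = t * (flog z - flog c') by lra.
    by rewrite normrM mulrC ler_wpM2r// distrC ltW.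
  - have yt : y < y + t by lra.
    have [z /andP[z1 z2]] := plog_MVT (- 2 / p ^+ 2) p^-1 y0 yt.
    have zc : `|z - c'| < m + m.
      move: N1 N2; rewrite !ltr_norml => /andP[? ?] /andP[? ?].
      by apply/andP; split; lra.
    have [z0 ze] := near0 _ zc.
    rewrite dplog_flog// -/(Flog _) -/(Flog _) => E.
    have -> : Flog (y + t) - Flog y - t * flog c' = t * (flog z - flog c') by lra.
    by rewrite normrM mulrC ler_wpM2r// distrC ltW.
have [c0|c0|<-] := ltgtP 0 c; first exact: pos.
- have [|dl dl0 H] := pos (- c); first lra.
  exists dl => // y t yc tt.
  have := H (- y) (- t); have -> : - y + - t = - (y + t) by ring.
  have -> : - y - - c = - (y - c) by ring.
  by rewrite !normrN /Flog !plogN flogN mulrNN; apply.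
(* At 0 the derivative vanishes and the Lipschitz factor [|y + t| + |y|] is itself small, at most
   three times the radius. *)
- have [C C0 H] := plog_lip (- 2 / p ^+ 2) p^-1 (@ltr0Sn R 1).
  have C1 : 0 < 3 * C + 1 by lra.
  exists (Num.min 1 (e / (3 * C + 1))) => [|y t]; first by rewrite lt_min ltr01 divr_gt0.
  rewrite subr0 !lt_min flog0 mulr0 subr0 => /andP[y1 y2] /andP[t1 t2].
  have yt := ler_normD y t.
  have := H (y + t) y; rewrite addrAC subrr add0r => /(_ ltac:(lra) ltac:(lra)).
  move=> /le_trans; apply; apply: ler_wpM2r => //.
  apply: (@le_trans _ _ (C * (3 * (e / (3 * C + 1))))).
    by apply: ler_wpM2l => //; lra.
  have -> : C * (3 * (e / (3 * C + 1))) = (3 * C * e) / (3 * C + 1) by ring.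
  by rewrite ler_pdivrMr//; lra.
Qed.

(** The logarithm makes scaling additive in [a]; this is why the cones are parametrized by
    exponentials. *)
Lemma plog_expR c1 c2 a t :
  plog c1 c2 (expR a * t) = expR (p * a) * (plog c1 c2 t + 2 * a * plog c2 0 t).
Proof.
have [->|t0] := eqVneq t 0; first by rewrite mulr0 !plog0 !mulr0 addr0 mulr0.
rewrite /plog normrM (gtr0_norm (expR_gt0 a)) powRM ?expR_ge0//.
have -> : expR a `^ p = expR (p * a) by rewrite /powR gt_eqF ?expR_gt0// expRK.
have t20 : 0 < t ^+ 2 by rewrite -real_normK ?num_real// exprn_gt0// normr_gt0.
have -> : ln ((expR a * t) ^+ 2) = 2 * a + ln (t ^+ 2).
  have a20 : 0 < expR a ^+ 2 by rewrite exprn_gt0// expR_gt0.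
  by rewrite exprMn lnM ?posrE// -expRM_natl expRK.
by ring.
Qed.

Lemma plog_le0 t : `|t| <= 1 -> plog 0 1 t <= 0.
Proof.
move=> t1; rewrite /plog add0r mul1r mulr_ge0_le0 ?powR_ge0// ln_le0//.
by rewrite -real_normK ?num_real// exprn_ile1.
Qed.

Lemma plog_ge0 t : 0 <= plog 1 0 t.
Proof. by rewrite /plog mul0r addr0 mulr1 powR_ge0. Qed.

Lemma plog_gt0 t : t != 0 -> 0 < plog 1 0 t.
Proof. by move=> t0; rewrite /plog mul0r addr0 mulr1 powR_gt0// normr_gt0. Qed.

Lemma plogE c1 c2 t : plog c1 c2 t = c1 * plog 1 0 t + c2 * plog 0 1 t.
Proof. by rewrite /plog; ring. Qed.

End PowLog.
(** * Energy on the two-parameter cone spanned by the positive and negative parts *)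

Section Cone.
Variables (R : realType) (a b p : R).
Hypothesis a0 : 0 <= a.
Hypothesis b0 : 0 <= b.
Hypothesis p4 : 4 <= p.

Lemma expR_tangent (y c : R) : expR y * (1 + c - y) <= expR c.
Proof.
have -> : expR c = expR y * expR (c - y) by rewrite -expRD addrC subrK.
by rewrite ler_pM2l ?expR_gt0//; have := expR_ge1Dx (c - y); lra.
Qed.

(** The tangent at [y] gives [e^(r y) >= e^y (1 + (r - 1) y)], and evaluated at 0 it gives
    [e^y y >= e^y - 1]. *)
Lemma expR_bernoulli (r y : R) : 1 <= r -> r * (expR y - 1) <= expR (r * y) - 1.
Proof.
move=> r1; have h1 := expR_tangent y (r * y); have h2 := expR_tangent y 0.
rewrite expR0 in h2; have r10 : 0 <= r - 1 by lra.
by have := ler_wpM2l r10 h2; lra.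
Qed.

(* [A B D] stand for [E(P,P)], [E(N,N)], [E(P,N)], and [H S L] for the sums of
   [h P^2], [|P|^p], [|P|^p ln P^2]; [dcone] is then the derivative of the energy
   at [z = e^x P + e^y N] in direction [z^+ = e^x P]. *)
Definition qcone (A B D x y : R) : R :=
  expR x ^+ 2 * A + 2 * (expR x * expR y * D) + expR y ^+ 2 * B.

Definition dcone (A B D H S L x y : R) : R :=
  (a + b * qcone A B D x y) * (expR x ^+ 2 * A + expR x * expR y * D)
  + expR x ^+ 2 * H - expR (p * x) * (L + 2 * x * S).

(** The energy of [e^x P + e^y N], primed letters belonging to [N]. Before scaling,
    [p^-1 (L - 2/p S)] is the sum of [Flog] over [P]; the term [2 x S] comes from the logarithm of
    the scaling factor. *)
Definition Jcone (A B D H H' S S' L L' x y : R) : R :=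
  2^-1 * (a * qcone A B D x y + (expR x ^+ 2 * H + expR y ^+ 2 * H'))
  + b / 4 * qcone A B D x y ^+ 2
  - p^-1 * (expR (p * x) * (L + 2 * x * S - 2 / p * S)
          + expR (p * y) * (L' + 2 * y * S' - 2 / p * S')).

Lemma qconeC A B D x y : qcone A B D x y = qcone B A D y x.
Proof. by rewrite /qcone; ring. Qed.

Lemma qcone_mono A B D x y y' : 0 <= B -> 0 <= D -> y <= y' ->
  qcone A B D x y <= qcone A B D x y'.
Proof.
move=> B0 D0 yy; have ey : expR y <= expR y' by rewrite ler_expR.
have e1 := expR_gt0 x; have e2 := expR_gt0 y.
rewrite /qcone; apply: lerD; first apply: lerD => //.
  by rewrite ler_pM2l// ler_wpM2r// ler_pM2l.
by rewrite ler_wpM2r// lerXn2r ?nnegrE ?expR_ge0.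
Qed.

Lemma qcone_ge0 A B D x y : 0 <= A -> 0 <= B -> 0 <= D -> 0 <= qcone A B D x y.
Proof.
move=> *; rewrite /qcone !addr_ge0// ?mulr_ge0// ?expR_ge0//; apply: mulr_ge0 => //.
all: by rewrite exprn_ge0 ?expR_ge0.
Qed.

Lemma dcone_mono A B D H S L x y y' : 0 <= A -> 0 <= B -> 0 <= D -> y <= y' ->
  dcone A B D H S L x y <= dcone A B D H S L x y'.
Proof.
move=> A0 B0 D0 yy; rewrite /dcone lerD2r lerD2r.
have e1 := expR_ge0 x; have e2 := expR_ge0 y.
have q0 : 0 <= qcone A B D x y by exact: qcone_ge0.
apply: ler_pM.
- by rewrite addr_ge0// mulr_ge0.
- by rewrite addr_ge0// mulr_ge0// ?exprn_ge0// mulr_ge0.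
- by rewrite lerD2l ler_wpM2l// qcone_mono.
- by rewrite lerD2l ler_wpM2r// ler_wpM2l// ler_expR.
Qed.

Lemma dcone_continuous A B D H S L :
  continuous (fun z : R * R => dcone A B D H S L z.1 z.2).
Proof.
move=> z; rewrite /dcone /qcone.
have c1 : (fun z : R * R => z.1) @ z --> z.1 by exact: cvg_fst.
have c2 : (fun z : R * R => z.2) @ z --> z.2 by exact: cvg_snd.
have e1 : (fun z : R * R => expR z.1) @ z --> expR z.1.
  by apply: continuous_cvg c1; exact: continuous_expR.
have e2 : (fun z : R * R => expR z.2) @ z --> expR z.2.
  by apply: continuous_cvg c2; exact: continuous_expR.
have e3 : (fun z : R * R => expR (p * z.1)) @ z --> expR (p * z.1).
  by apply: continuous_cvg; [exact: continuous_expR|apply: cvgM => //; exact: cvg_cst].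
have s1 : (fun z : R * R => expR z.1 ^+ 2) @ z --> expR z.1 ^+ 2 by exact: cvgM.
have s2 : (fun z : R * R => expR z.2 ^+ 2) @ z --> expR z.2 ^+ 2 by exact: cvgM.
have K (k : R) (f : R * R -> R) (l : R) : f @ z --> l -> (fun z => k * f z) @ z --> k * l.
  by move=> fl; apply: cvgM => //; exact: cvg_cst.
have K' (k : R) (f : R * R -> R) (l : R) : f @ z --> l -> (fun z => f z * k) @ z --> l * k.
  by move=> fl; apply: cvgM => //; exact: cvg_cst.
have e12 : (fun z : R * R => expR z.1 * expR z.2 * D) @ z --> expR z.1 * expR z.2 * D.
  by apply: (K' _); exact: cvgM.
apply: cvgB.
  apply: cvgD; last exact: (K' _).
  apply: cvgM; last by apply: cvgD => //; exact: (K' _).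
  apply: cvgD; first exact: cvg_cst.
  apply: (K _); apply: cvgD; last exact: (K' _).
  by apply: cvgD; [exact: (K' _)|exact: (K _)].
apply: cvgM => //; apply: cvgD; first exact: cvg_cst.
by apply: (K' _); exact: (K _).
Qed.

Lemma dcone_incr A B D H S L x y : 0 < dcone A B D H S L x y ->
  exists2 e, 0 < e & forall t, 0 < t -> t < e -> 0 < dcone A B D H S L (x + t) y.
Proof.
move=> d0; have /cvgrPdist_lt/(_ _ d0)/nbhs_ballP[e /= e0 he] :=
  @dcone_continuous A B D H S L (x, y).
exists e => // t t0 te; have := he (x + t, y).
rewrite /ball/= /prod_ball/= /ball/= subrr normr0 opprD addrA subrr sub0r normrN gtr0_norm//.
by move=> /(_ (conj te e0)); rewrite ltr_norml => /andP[]; lra.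
Qed.

(* A maximal point of the sublattice where both derivatives are nonnegative is a
   common zero, because each derivative is monotone in the other variable. *)
Lemma cone_box A B D H H' S S' L L' l r :
  0 <= A -> 0 <= B -> 0 <= D -> l <= r ->
  0 <= dcone A B D H S L l l -> 0 <= dcone B A D H' S' L' l l ->
  dcone A B D H S L r r < 0 -> dcone B A D H' S' L' r r < 0 ->
  exists x y, [/\ l <= x <= r, l <= y <= r,
    dcone A B D H S L x y = 0 & dcone B A D H' S' L' y x = 0].
Proof.
move=> A0 B0 D0 lr dPl dNl dPr dNr.
set dP := dcone A B D H S L; set dN := dcone B A D H' S' L'.
pose K := (`[l, r]%classic `*` `[l, r]%classic : set (R * R)) `&`
  ([set z | 0 <= dP z.1 z.2] `&` [set z | 0 <= dN z.2 z.1]).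
have cK : compact K.
  apply: compact_closedI; first by apply: compact_setX; exact: segment_compact.
  apply: closedI.
  + apply: (@closed_comp _ _ (fun z : R * R => dP z.1 z.2) [set t | 0 <= t]).
        by move=> z _; exact: dcone_continuous.
      exact: closed_ge.
  + apply: (@closed_comp _ _ (fun z : R * R => dN z.2 z.1) [set t | 0 <= t]).
        move=> z _; apply: (@continuous_comp _ _ _ (fun z : R * R => (z.2, z.1)) (fun z => dN z.1 z.2)).
          exact: (@swap_continuous R R).
        exact: dcone_continuous.
      exact: closed_ge.
have K0 : K !=set0 by exists (l, l); split; split=> //=; rewrite in_itv/= lexx.
have [|[x y] /set_mem] := @compact_EVT_max _ R (fun z : R * R => z.1 + z.2) K K0 cK.
  apply: continuous_subspaceT => z.
  by apply: cvgD; [exact: cvg_fst|exact: cvg_snd].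
rewrite /K /= !in_itv/= => -[[/andP[lx xr] /andP[ly yr]] [dPxy dNxy]] maxK.
exists x, y; split; rewrite ?lx ?ly//.
- have [//|ne] := eqVneq (dP x y) 0; exfalso.
  have dPpos : 0 < dP x y by rewrite lt_neqAle eq_sym ne.
  have xr' : x < r.
    rewrite lt_neqAle xr andbT; apply: contraTneq dPpos => ->; rewrite -leNgt.
    by apply: le_trans (ltW dPr); exact: dcone_mono.
  have [e e0 he] := dcone_incr dPpos.
  pose t := Num.min (e / 2) (r - x).
  have t0 : 0 < t by rewrite lt_min divr_gt0//= subr_gt0.
  have te : t < e by rewrite gt_min; apply/orP; left; lra.
  have tr : t <= r - x by rewrite ge_min lexx orbT.
  (* Increasing [x] keeps [dP] nonnegative by continuity and [dN] nonnegative by monotonicity, but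
     it increases [x + y]. *)
  suff : (x + t, y) \in K by move=> /maxK /=; lra.
  apply/mem_set; split; split => //=; rewrite ?in_itv/=.
  + by apply/andP; split; lra.
  + by rewrite ly.
  + exact/ltW/he.
  + by apply: le_trans dNxy _; apply: dcone_mono => //; lra.
- have [//|ne] := eqVneq (dN y x) 0; exfalso.
  have dNpos : 0 < dN y x by rewrite lt_neqAle eq_sym ne.
  have yr' : y < r.
    rewrite lt_neqAle yr andbT; apply: contraTneq dNpos => ->; rewrite -leNgt.
    by apply: le_trans (ltW dNr); exact: dcone_mono.
  have [e e0 he] := dcone_incr dNpos.
  pose t := Num.min (e / 2) (r - y).
  have t0 : 0 < t by rewrite lt_min divr_gt0//= subr_gt0.
  have te : t < e by rewrite gt_min; apply/orP; left; lra.
  have tr : t <= r - y by rewrite ge_min lexx orbT.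
  suff : (x, y + t) \in K by move=> /maxK /=; lra.
  apply/mem_set; split; split => //=; rewrite ?in_itv/=.
  + by rewrite lx.
  + by apply/andP; split; lra.
  + by apply: le_trans dPxy _; apply: dcone_mono => //; lra.
  + exact/ltW/he.
Qed.

(** [cone_box] tests only the corners [(l, l)] and [(r, r)], so signs are needed on the diagonal
    alone, where the derivative is this combination of exponentials. *)
Lemma cone_ray A B D H S L x : dcone A B D H S L x x =
  expR (2 * x) * (a * (A + D) + H) +
  expR (4 * x) * (b * (A + 2 * D + B) * (A + D)) - expR (p * x) * (L + 2 * x * S).
Proof.
rewrite /dcone /qcone.
have -> : expR (2 * x) = expR x ^+ 2 by rewrite -expRM_natl.
have -> : expR (4 * x) = expR x ^+ 4 by rewrite -expRM_natl.
by ring.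
Qed.

(** The vanishing at 0 gives [L = c2 + c4]. Then [e^(p x)] beats both [e^(2 x)] and [e^(4 x)] for
    [x > 0], the reverse holds for [x < 0], and [x S] has the sign of [x]. *)
Lemma cone_ray_crit A B D H S L x : 0 <= A -> 0 <= B -> 0 <= D -> 0 < H -> 0 <= S ->
  dcone A B D H S L 0 0 = 0 ->
  (0 < x -> dcone A B D H S L x x < 0) /\ (x < 0 -> 0 < dcone A B D H S L x x).
Proof.
move=> A0 B0 D0 H0 S0; rewrite !cone_ray !mulr0 expR0 !mul1r mul0r addr0.
set c2 := a * (A + D) + H; set c4 := b * _ * _ => LE.
have c20 : 0 < c2 by rewrite ltr_wpDl// mulr_ge0// addr_ge0.
have c40 : 0 <= c4 by rewrite !mulr_ge0// !addr_ge0// mulr_ge0.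
have -> : L = c2 + c4 by lra.
have ep := expR_gt0 (p * x).
split=> x0.
- have h1 : expR (2 * x) < expR (p * x) by rewrite ltr_expR ltr_pM2r//; have := p4; lra.
  have h2 : expR (4 * x) <= expR (p * x) by rewrite ler_expR ler_pM2r.
  have := ltr_pM2r c20 (expR (2 * x)) (expR (p * x)); rewrite h1 => k1.
  have k2 := ler_wpM2r c40 h2.
  have : 0 <= expR (p * x) * (x * S) by apply: mulr_ge0; [exact: ltW|apply: mulr_ge0 => //; exact: ltW].
  lra.
- have h1 : expR (p * x) < expR (2 * x) by rewrite ltr_expR ltr_nM2r//; have := p4; lra.
  have h2 : expR (p * x) <= expR (4 * x) by rewrite ler_expR ler_nM2r.
  have := ltr_pM2r c20 (expR (p * x)) (expR (2 * x)); rewrite h1 => k1.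
  have k2 := ler_wpM2r c40 h2.
  have : 0 <= expR (p * x) * (- x * S) by apply: mulr_ge0; [exact: ltW|apply: mulr_ge0 => //; lra].
  lra.
Qed.

Lemma cone_ray_small A B D H S L : 0 <= A -> 0 <= B -> 0 <= D -> 0 < H -> 0 <= S ->
  exists t, forall x, x <= t -> 0 < dcone A B D H S L x x.
Proof.
move=> A0 B0 D0 H0 S0; set c2 := a * (A + D) + H.
have c20 : 0 < c2 by rewrite ltr_wpDl// mulr_ge0// addr_ge0.
exists (- (`|L| / c2)) => x xt; rewrite cone_ray -/c2; set c4 := b * _ * _.
have c40 : 0 <= c4 by rewrite !mulr_ge0// !addr_ge0// mulr_ge0.
have L0 : 0 <= `|L| / c2 by rewrite divr_ge0// ltW.
have x0 : x <= 0 by lra.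
have e2 := expR_gt0 (2 * x); have e4 := expR_gt0 (4 * x).
have -> : expR (p * x) = expR (2 * x) * expR ((p - 2) * x).
  by rewrite -expRD; congr expR; ring.
set z := expR ((p - 2) * x); have z0 : 0 < z by exact: expR_gt0.
(* After factoring out [e^(2 x)] the quadratic coefficient must dominate [z L]. The tangent
   inequality gives [z (1 - (p - 2) x) <= 1], and the threshold makes the bracket at least
   [1 + |L| / c2]. *)
have k1 : z * `|L| < c2.
  have h := expR_tangent ((p - 2) * x) 0; rewrite -/z expR0 addr0 in h.
  have : z * (1 + `|L| / c2) <= 1.
    apply: le_trans h; rewrite ler_pM2l// lerD2l.
    have : 0 <= (p - 3) * (- x) by apply: mulr_ge0; have := p4; lra.
    by lra.
  move=> /(ler_wpM2l (ltW c20)).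
  have -> : c2 * (z * (1 + `|L| / c2)) = z * c2 + z * `|L| by field; rewrite gt_eqF.
  by have := mulr_gt0 z0 c20; lra.
have k2 : z * L <= z * `|L| by rewrite ler_pM2l// ler_norm.
have k3 : 0 <= z * (- x * S) by apply: mulr_ge0; [exact: ltW|apply: mulr_ge0 => //; lra].
have k4 : 0 <= expR (4 * x) * c4 by rewrite mulr_ge0// ltW.
have : 0 < expR (2 * x) * (c2 - z * (L + 2 * x * S)) by rewrite mulr_gt0//; lra.
lra.
Qed.

Lemma cone_ray_large A B D H S L : 0 <= A -> 0 <= B -> 0 <= D -> 0 < H -> 0 < S ->
  exists t, forall x, t <= x -> dcone A B D H S L x x < 0.
Proof.
move=> A0 B0 D0 H0 S0; set c2 := a * (A + D) + H; set c4 := b * (A + 2 * D + B) * (A + D).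
have c20 : 0 < c2 by rewrite ltr_wpDl// mulr_ge0// addr_ge0.
have c40 : 0 <= c4 by rewrite !mulr_ge0// !addr_ge0// mulr_ge0.
have T0 : 0 <= (c2 + c4 + `|L|) / S.
  by apply: divr_ge0; [have := normr_ge0 L; lra|exact: ltW].
(* Beyond this point [x S] exceeds all constants; the exponents 2 and 4 are raised to [p] so that a
   common factor comes out. *)
exists ((c2 + c4 + `|L|) / S) => x; rewrite cone_ray -/c2 -/c4 => xt.
have x0 : 0 <= x by lra.
move: xt; rewrite ler_pdivrMr// => xt.
have h1 : expR (2 * x) <= expR (p * x) by rewrite ler_expR ler_wpM2r//; have := p4; lra.
have h2 : expR (4 * x) <= expR (p * x) by rewrite ler_expR ler_wpM2r.
have k1 := ler_wpM2r (ltW c20) h1; have k2 := ler_wpM2r c40 h2.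
have Lb := ler_norm (- L); rewrite normrN in Lb.
have L0 := normr_ge0 L.
have : expR (p * x) * (c2 + c4 - L - 2 * x * S) < 0 by rewrite pmulr_rlt0 ?expR_gt0//; lra.
lra.
Qed.

(** The two critical equations eliminate [L] and [L']. The energy difference then splits into
    multiples of the elementary inequalities [bern] and [ent], once [qle] and [qsq] have separated
    [x] from [y]. *)
Lemma cone_max A B D H H' S S' L L' x y :
  0 <= A -> 0 <= B -> 0 <= D -> 0 <= H -> 0 <= H' -> 0 <= S -> 0 <= S' ->
  dcone A B D H S L 0 0 = 0 -> dcone B A D H' S' L' 0 0 = 0 ->
  Jcone A B D H H' S S' L L' x y <= Jcone A B D H H' S S' L L' 0 0.
Proof.
move=> A0 B0 D0 H0 H'0 S0 S'0; rewrite !cone_ray !mulr0 expR0 !mul1r !mul0r !addr0.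
have -> : B + 2 * D + A = A + 2 * D + B by ring.
set Q := A + 2 * D + B => EL EL'.
have p0 : 0 < p by have := p4; lra.
rewrite /Jcone.
have -> : qcone A B D 0 0 = Q by rewrite /qcone !expR0 expr1n /Q; ring.
rewrite !mulr0 !expR0 expr1n !mul1r mul0r !addr0.
set q := qcone A B D x y.
set X := expR (p * x); set Y := expR (p * y).
(* Bernoulli with ratio [p / n] at [n z], for [n = 2] (quadratic terms) and [n = 4] (Kirchhoff
   term); the latter requires [4 <= p]. *)
have bern z : p^-1 * (1 - expR (p * z)) <= 2^-1 * (1 - expR z ^+ 2) /\
              p^-1 * (1 - expR (p * z)) <= 4^-1 * (1 - expR z ^+ 4).
  have h (n : nat) : 0 < n%:R :> R -> n%:R <= p -> p^-1 * (1 - expR (p * z)) <= n%:R^-1 * (1 - expR z ^+ n).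
    move=> n0 np; have : 1 <= p / n%:R by rewrite ler_pdivlMr// mul1r.
    move=> /(expR_bernoulli (n%:R * z)).
    have -> : p / n%:R * (n%:R * z) = p * z by field; rewrite gt_eqF.
    rewrite expRM_natl => k.
    have pi0 : 0 <= p^-1 by rewrite invr_ge0 ltW.
    have := ler_wpM2l pi0 k.
    have -> : p^-1 * (p / n%:R * (expR z ^+ n - 1)) = n%:R^-1 * (expR z ^+ n - 1).
      by field; rewrite !gt_eqF.
    lra.
  by split; apply: h => //; have := p4; lra.
(* The tangent at [p z] evaluated at 0; it absorbs the terms that the logarithm produces. *)
have ent z : 0 <= 1 - expR (p * z) + expR (p * z) * (p * z).
  by have := expR_tangent (p * z) 0; rewrite expR0; lra.
have [bx2 bx4] := bern x; have [by2 by4] := bern y.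
have EE : L = (a + b * Q) * (A + D) + H by lra.
have EE' : L' = (a + b * Q) * (B + D) + H' by lra.
have pi0 : 0 <= p^-1 * (2 / p).
  by rewrite mulr_ge0 ?divr_ge0 ?invr_ge0//; exact: ltW.
have Sx : 0 <= p^-1 * (2 / p) * (1 - X + X * (p * x)) * S.
  exact: mulr_ge0 (mulr_ge0 pi0 (ent x)) S0.
have Sy : 0 <= p^-1 * (2 / p) * (1 - Y + Y * (p * y)) * S'.
  exact: mulr_ge0 (mulr_ge0 pi0 (ent y)) S'0.
have kS : p^-1 * (2 / p) * (1 - X + X * (p * x)) * S
   = p^-1 * (X * (2 * x * S - 2 / p * S) + 2 / p * S) by field; rewrite gt_eqF.
have kS' : p^-1 * (2 / p) * (1 - Y + Y * (p * y)) * S'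
   = p^-1 * (Y * (2 * y * S' - 2 / p * S') + 2 / p * S') by field; rewrite gt_eqF.
have AD0 : 0 <= A + D by lra. have BD0 : 0 <= B + D by lra.
have kH := ler_wpM2r H0 bx2; have kH' := ler_wpM2r H'0 by2.
have ka1 := ler_wpM2r (mulr_ge0 a0 AD0) bx2; have ka2 := ler_wpM2r (mulr_ge0 a0 BD0) by2.
have Q0 : 0 <= Q by rewrite /Q; lra.
have kb1 := ler_wpM2r (mulr_ge0 (mulr_ge0 b0 Q0) AD0) bx4.
have kb2 := ler_wpM2r (mulr_ge0 (mulr_ge0 b0 Q0) BD0) by4.
have qle : q <= expR x ^+ 2 * (A + D) + expR y ^+ 2 * (B + D).
  have : 0 <= D * (expR x - expR y) ^+ 2 by rewrite mulr_ge0 ?sqr_ge0.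
  by rewrite /q /qcone; lra.
have q0 : 0 <= q by exact: qcone_ge0.
(* Convexity of the square with weights [A + D] and [B + D], whose sum is [Q]. *)
have qsq : q ^+ 2 <= Q * (expR x ^+ 4 * (A + D) + expR y ^+ 4 * (B + D)).
  apply: (@le_trans _ _ ((expR x ^+ 2 * (A + D) + expR y ^+ 2 * (B + D)) ^+ 2)).
    by rewrite lerXn2r ?nnegrE// (le_trans q0).
  have : 0 <= (A + D) * (B + D) * (expR x ^+ 2 - expR y ^+ 2) ^+ 2.
    by rewrite mulr_ge0 ?sqr_ge0 ?mulr_ge0.
  by rewrite /Q; lra.
have kq := ler_wpM2l b0 qsq; have kq1 := ler_wpM2l a0 qle.
rewrite EE EE'.
have QE : Q = (A + D) + (B + D) by rewrite /Q; ring.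
clear EL EL' EE EE' bx2 bx4 by2 by4 ent bern qsq qle A0 B0 D0 H0 H'0 S0 S'0 q0 Q0.
rewrite -!/X -!/Y in kH kH' ka1 ka2 kb1 kb2.
move: QE kq kq1 kH kH' ka1 ka2 kb1 kb2; rewrite kS in Sx; rewrite kS' in Sy.
move: (A + D) (B + D) => U V -> *.
lra.
Qed.

End Cone.
(** * The energy functional and the sign-changing Nehari set *)

(** Of the kernel's decay only the row bound [W] is kept, and the growth of [h] is stated with
    finite exceptional sets in place of balls. *)
Record setting (R : realType) (d : nat) (w : Zd d -> Zd d -> R) (W a b p : R)
    (h : Zd d -> R) (h0 : R) : Prop := Setting {
  st_wC : forall x y : Zd d, x != y -> w x y = w y x;
  st_w : forall x y : Zd d, x != y -> 0 < w x y;
  st_W : forall (x : Zd d) (A : {fset Zd d}), \sum_(y <- A | y != x) w x y <= W;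
  st_a : 0 < a;
  st_b : 0 < b;
  st_p : 6 < p;
  st_h0 : 0 < h0;
  st_h : forall x, h0 <= h x;
  st_hoo : forall M : R, exists A : {fset Zd d}, forall x, x \notin A -> M <= h x }.

Section PositiveNegativeParts.
Variables (R : realType) (d : nat).
Implicit Types (u : Zd d -> R) (x : Zd d).

Lemma pos_part_ge0 u x : 0 <= pos_part u x.
Proof. by rewrite /pos_part le_max lexx orbT. Qed.

Lemma neg_part_le0 u x : neg_part u x <= 0.
Proof. by rewrite /neg_part ge_min lexx orbT. Qed.

Lemma pos_neg_cases u x :
  (pos_part u x = u x /\ neg_part u x = 0) \/ (pos_part u x = 0 /\ neg_part u x = u x).
Proof.
rewrite /pos_part /neg_part; case: (leP (u x) 0) => ux; [right|left] => //.
Qed.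

Lemma pos_neg_mul u x : pos_part u x * neg_part u x = 0.
Proof. by case: (pos_neg_cases u x) => -[-> ->]; rewrite ?mulr0 ?mul0r. Qed.

Lemma pos_part_norm_le u x : `|pos_part u x| <= `|u x|.
Proof. by case: (pos_neg_cases u x) => -[-> _]; rewrite ?normr0. Qed.

Lemma neg_part_norm_le u x : `|neg_part u x| <= `|u x|.
Proof. by case: (pos_neg_cases u x) => -[_ ->]; rewrite ?normr0. Qed.

Definition zc u (s t : R) := fun x => expR s * pos_part u x + expR t * neg_part u x.

Lemma zc00 u : zc u 0 0 = u.
Proof.
apply/funext => x; rewrite /zc expR0 !mul1r.
by case: (pos_neg_cases u x) => -[-> ->]; rewrite ?addr0 ?add0r.
Qed.

Lemma pos_zc u s t : pos_part (zc u s t) = (fun x => expR s * pos_part u x).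
Proof.
apply/funext => x; rewrite {1}/pos_part /zc.
have := pos_part_ge0 u x; have := neg_part_le0 u x.
have es := expR_gt0 s; have et := expR_gt0 t.
case: (pos_neg_cases u x) => -[-> ->] n0 p0; rewrite ?mulr0 ?addr0 ?add0r.
  by apply/max_idPl; rewrite mulr_ge0// ltW.
by apply/max_idPr; rewrite pmulr_rle0.
Qed.

Lemma neg_zc u s t : neg_part (zc u s t) = (fun x => expR t * neg_part u x).
Proof.
apply/funext => x; rewrite {1}/neg_part /zc.
have := pos_part_ge0 u x; have := neg_part_le0 u x.
have es := expR_gt0 s; have et := expR_gt0 t.
case: (pos_neg_cases u x) => -[-> ->] n0 p0; rewrite ?mulr0 ?addr0 ?add0r.
  by apply/min_idPr; rewrite mulr_ge0// ltW.
by apply/min_idPl; rewrite pmulr_rle0.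
Qed.

Lemma fun_neq0 u : u <> (fun=> 0) -> exists x, u x != 0.
Proof.
move=> u0; apply: contrapT => /forallNP n; apply: u0; apply/funext => x.
by apply/eqP; apply: contrapT => /negP; exact: n.
Qed.

End PositiveNegativeParts.

Section Functional.
Variables (R : realType) (d : nat) (w : Zd d -> Zd d -> R) (W a b p : R)
  (h : Zd d -> R) (h0 : R).
Hypothesis st : setting w W a b p h h0.
Local Notation T := (Zd d).
Implicit Types (u v phi : T -> R) (x : T).

Let a_gt0 := st_a st.
Let b_gt0 := st_b st.
Let p_gt6 := st_p st.
Let h0_gt0 := st_h0 st.
Let h_ge := st_h st.
Let p_gt3 : 3 < p. Proof. by have := p_gt6; lra. Qed.
Let p_ge4 : 4 <= p. Proof. by have := p_gt6; lra. Qed.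
Let p_gt0 : 0 < p. Proof. by have := p_gt6; lra. Qed.

Lemma h_gt0 x : 0 < h x.
Proof. by have := h_ge x; have := h0_gt0; lra. Qed.

Local Notation E u v := (sumZ (gradprod w u v)).

Definition hl2 u := summ (fun x => h x * u x ^+ 2).
Definition Nh u := sumZ (fun x => h x * u x ^+ 2).

Lemma hsq_ge0 u x : 0 <= h x * u x ^+ 2.
Proof. by rewrite mulr_ge0 ?sqr_ge0// ltW// h_gt0. Qed.

Lemma Nh_ge0 u : 0 <= Nh u.
Proof. by apply: sumZ_ge0 => x; exact: hsq_ge0. Qed.

Lemma hl2_le u v : hl2 v -> (forall x, `|u x| <= `|v x|) -> hl2 u.
Proof.
move=> hv uv; apply: summ_le hv _ => x.
rewrite (ger0_norm (hsq_ge0 u x)) (ger0_norm (hsq_ge0 v x)) ler_pM2l ?h_gt0//.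
rewrite -(real_normK (num_real (u x))) -(real_normK (num_real (v x))).
by rewrite lerXn2r ?nnegrE.
Qed.

Lemma hl2_l2 u : hl2 u -> l2 u.
Proof.
move=> hu; apply: summ_le0 (summZ h0^-1 hu) _ => x.
rewrite ger0_norm ?sqr_ge0// mulrC ler_pdivlMr// mulrC.
by rewrite ler_wpM2r ?sqr_ge0.
Qed.

Lemma sumsq_le_Nh u : hl2 u -> sumZ (fun x => u x ^+ 2) <= Nh u / h0.
Proof.
move=> hu; rewrite mulrC -sumZZ//; apply: ler_sumZ; first exact: hl2_l2.
  exact: summZ.
move=> x; rewrite mulrC ler_pdivlMr// mulrC.
by rewrite ler_wpM2r ?sqr_ge0.
Qed.

Lemma hl2Z c u : hl2 u -> hl2 (fun x => c * u x).
Proof.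
move=> hu; rewrite /hl2; under eq_fun do rewrite exprMn mulrCA.
exact: summZ.
Qed.

Lemma hl2D u v : hl2 u -> hl2 v -> hl2 (fun x => u x + v x).
Proof.
move=> hu hv; apply: summ_le0 (summD (summZ 2 hu) (summZ 2 hv)) _ => x.
rewrite ger0_norm; last exact: (hsq_ge0 (fun x => u x + v x)).
have : 0 <= h x * (u x - v x) ^+ 2 by exact: (hsq_ge0 (fun x => u x - v x)).
lra.
Qed.

Lemma hl2_pos u : hl2 u -> hl2 (pos_part u).
Proof. by move=> hu; apply: hl2_le hu _ => x; exact: pos_part_norm_le. Qed.

Lemma hl2_neg u : hl2 u -> hl2 (neg_part u).
Proof. by move=> hu; apply: hl2_le hu _ => x; exact: neg_part_norm_le. Qed.

Lemma hl2_zc u s t : hl2 u -> hl2 (zc u s t).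
Proof.
move=> hu; apply: hl2D; apply: hl2Z; [exact: hl2_pos|exact: hl2_neg].
Qed.

(** Since [h >= h0 > 0], finiteness of the weighted sum already places [u] in l^2, hence in
    [W^{s,2}]; afterwards the completion need not be mentioned. *)
Lemma inHP u : inH w h u <-> hl2 u.
Proof.
split=> [[_ hu]|hu]; first by apply: esum_summ hu => x; exact: hsq_ge0.
split; first exact: (l2_inW (st_wC st) (st_w st) (st_W st) (hl2_l2 hu)).
by rewrite nnsumE ?ltry// => x; exact: hsq_ge0.
Qed.

Lemma summ_hM u v : hl2 u -> hl2 v -> summ (fun x => h x * u x * v x).
Proof.
move=> hu hv; apply: summ_le0 (summD hu hv) _ => x.
rewrite -mulrA normrM gtr0_norm ?h_gt0// -mulrDr ler_pM2l ?h_gt0//.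
exact: normM_le_sqr.
Qed.

Lemma summ_plog c1 c2 u : l2 u -> summ (fun x => plog p c1 c2 (u x)).
Proof.
move=> lu; have [M M0 uM] := l2_bounded lu.
have [C C0 HC] := plog_sqr_le p_gt3 c1 c2 M0.
by apply: summ_le0 (summZ C lu) _ => x; exact: HC.
Qed.

Lemma summ_flogM u v : l2 u -> l2 v -> summ (fun x => flog p (u x) * v x).
Proof.
move=> lu lv; have [M M0 uM] := l2_bounded lu.
have [C C0 HC] := flog_le p_gt3 M0.
apply: summ_le0 (summZ C (summ_norm (summM lu lv))) _ => x.
by rewrite normrM (normrM (u x)) mulrA ler_wpM2r// HC.
Qed.

Let sg u v (lu : l2 u) (lv : l2 v) := summ_gradprod (st_wC st) (st_w st) (st_W st) lu lv.

Lemma JE u : hl2 u -> J w a b p h u =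
  2^-1 * (a * E u u + Nh u) + b / 4 * E u u ^+ 2 - sumZ (fun x => Flog p (u x)).
Proof.
move=> hu; have lu := hl2_l2 hu; have sguu := sg lu lu.
rewrite /J /normH2 /gradnorm2 sumZD//; last exact: summZ.
rewrite sumZZ// -/(Nh u).
have -> : sumZ (fun x => `|u x| `^ p) = sumZ (fun x => plog p 1 0 (u x)).
  by apply: sumZ_eq => x; rewrite /plog; ring.
have -> : sumZ (fun x => `|u x| `^ p * ln (u x ^+ 2)) = sumZ (fun x => plog p 0 1 (u x)).
  by apply: sumZ_eq => x; rewrite /plog; ring.
have -> : sumZ (fun x => Flog p (u x)) =
    - 2 / p ^+ 2 * sumZ (fun x => plog p 1 0 (u x)) + p^-1 * sumZ (fun x => plog p 0 1 (u x)).
  have s1 := summ_plog 1 0 lu; have s2 := summ_plog 0 1 lu.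
  rewrite -!sumZZ// -sumZD; [|exact: summZ..].
  by apply: sumZ_eq => x; rewrite /Flog plogE.
ring.
Qed.

Lemma dJE u phi : hl2 u -> hl2 phi -> dJ w a b p h u phi =
  (a + b * E u u) * E u phi + sumZ (fun x => h x * u x * phi x)
  - sumZ (fun x => flog p (u x) * phi x).
Proof.
move=> hu hphi; have lu := hl2_l2 hu; have lphi := hl2_l2 hphi.
have s1 := sg lu lphi.
rewrite /dJ /gradnorm2 sumZD; [|exact: summZ|exact: summ_hM].
rewrite sumZZ//.
have -> : sumZ (fun x => `|u x| `^ (p - 2) * u x * phi x * ln (u x ^+ 2)) =
    sumZ (fun x => flog p (u x) * phi x).
  by apply: sumZ_eq => x; rewrite /flog; ring.
ring.
Qed.

Definition cA u := E (pos_part u) (pos_part u).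
Definition cB u := E (neg_part u) (neg_part u).
Definition cD u := E (pos_part u) (neg_part u).
Definition cS u := sumZ (fun x => plog p 1 0 (u x)).
Definition cL u := sumZ (fun x => plog p 0 1 (u x)).

Definition DP u := dcone a b p (cA u) (cB u) (cD u) (Nh (pos_part u))
  (cS (pos_part u)) (cL (pos_part u)).
(** The same [dcone] with [P] and [N] exchanged, each part's own parameter coming first: [zc u s t]
    therefore corresponds to [DN u t s]. *)
Definition DN u := dcone a b p (cB u) (cA u) (cD u) (Nh (neg_part u))
  (cS (neg_part u)) (cL (neg_part u)).

Lemma cA_ge0 u : 0 <= cA u.
Proof. exact: E_ge0 (st_w st) _. Qed.

Lemma cB_ge0 u : 0 <= cB u.
Proof. exact: E_ge0 (st_w st) _. Qed.

Lemma cD_ge0 u : 0 <= cD u.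
Proof.
apply: (E_disjoint_ge0 (st_w st)); [exact: pos_part_ge0|exact: neg_part_le0|].
exact: pos_neg_mul.
Qed.

Lemma cS_ge0 u : 0 <= cS u.
Proof. by apply: sumZ_ge0 => x; exact: plog_ge0. Qed.

Lemma Nh_gt0 u : hl2 u -> u <> (fun=> 0) -> 0 < Nh u.
Proof.
move=> hu /fun_neq0[x ux]; apply: lt_le_trans (ler_term_sumZ x (hsq_ge0 u) hu).
by rewrite mulr_gt0 ?h_gt0// exprn_even_gt0.
Qed.

Lemma cS_gt0 u : hl2 u -> u <> (fun=> 0) -> 0 < cS u.
Proof.
move=> hu /fun_neq0[x ux].
apply: lt_le_trans (ler_term_sumZ x (fun x => plog_ge0 p (u x)) (summ_plog 1 0 (hl2_l2 hu))).
exact: plog_gt0.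
Qed.

Section OnCone.
Variable u : T -> R.
Hypothesis hu : hl2 u.
Let P := pos_part u.
Let N := neg_part u.
Let lP : l2 P := hl2_l2 (hl2_pos hu).
Let lN : l2 N := hl2_l2 (hl2_neg hu).
Let EDl u1 u2 v (k1 : l2 u1) (k2 : l2 u2) (k3 : l2 v) :=
  E_Dl (st_wC st) (st_w st) (st_W st) k1 k2 k3.
Let EZl c u1 v (k1 : l2 u1) (k3 : l2 v) :=
  E_Zl (st_wC st) (st_w st) (st_W st) c k1 k3.
Let EC u1 v : E u1 v = E v u1 := E_C w u1 v.

Lemma E_zc_l s t v : l2 v -> E (zc u s t) v = expR s * E P v + expR t * E N v.
Proof.
move=> lv; rewrite /zc (EDl (l2Z (expR s) lP) (l2Z (expR t) lN) lv).
by rewrite (EZl (expR s) lP lv) (EZl (expR t) lN lv).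
Qed.

Lemma E_zc s t : E (zc u s t) (zc u s t) = qcone (cA u) (cB u) (cD u) s t.
Proof.
have lz : l2 (zc u s t) by exact: hl2_l2 (hl2_zc _ _ hu).
rewrite (E_zc_l s t lz) (EC P (zc u s t)) (EC N (zc u s t)) (E_zc_l s t lP) (E_zc_l s t lN).
rewrite (EC N P) /qcone /cA /cB /cD /P /N; ring.
Qed.

Lemma E_zc_pos s t : E (zc u s t) (pos_part (zc u s t)) =
  expR s ^+ 2 * cA u + expR s * expR t * cD u.
Proof.
rewrite pos_zc (E_zc_l s t (l2Z (expR s) lP)) (EC P (fun x => _)) (EC N (fun x => _)).
rewrite (EZl (expR s) lP lP) (EZl (expR s) lP lN) /cA /cD /P /N; ring.
Qed.

Lemma E_zc_neg s t : E (zc u s t) (neg_part (zc u s t)) =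
  expR t ^+ 2 * cB u + expR t * expR s * cD u.
Proof.
rewrite neg_zc (E_zc_l s t (l2Z (expR t) lN)) (EC P (fun x => _)) (EC N (fun x => _)).
rewrite (EZl (expR t) lN lP) (EZl (expR t) lN lN) (EC N P) /cB /cD /P /N; ring.
Qed.

Lemma Nh_zc s t : Nh (zc u s t) = expR s ^+ 2 * Nh P + expR t ^+ 2 * Nh N.
Proof.
rewrite /Nh -!sumZZ; [|exact: hl2_neg|exact: hl2_pos].
rewrite -sumZD; [|apply: summZ; exact: hl2_pos|apply: summZ; exact: hl2_neg].
apply: sumZ_eq => x; rewrite /zc; have := pos_neg_mul u x; rewrite -/P -/N => e.
have -> : expR s ^+ 2 * (h x * P x ^+ 2) + expR t ^+ 2 * (h x * N x ^+ 2) =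
  h x * (expR s * P x + expR t * N x) ^+ 2 - 2 * h x * expR s * expR t * (P x * N x) by ring.
by rewrite e mulr0 subr0.
Qed.

Lemma sum_plog_expR c1 c2 s v : l2 v -> sumZ (fun x => plog p c1 c2 (expR s * v x)) =
  expR (p * s) * (sumZ (fun x => plog p c1 c2 (v x)) + 2 * s * (c2 * cS v)).
Proof.
move=> lv; have s1 := summ_plog c1 c2 lv; have s2 := summ_plog 1 0 lv.
have s3 := summZ (2 * s) (summZ c2 s2).
rewrite /cS -(sumZZ c2 s2) -(sumZZ (2 * s) (summZ c2 s2)) -(sumZD s1 s3).
rewrite -(sumZZ (expR (p * s)) (summD s1 s3)).
by apply: sumZ_eq => x; rewrite (plog_expR p_gt3) (plogE p c2); ring.
Qed.

Lemma J_zc s t : J w a b p h (zc u s t) =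
  Jcone a b p (cA u) (cB u) (cD u) (Nh P) (Nh N) (cS P) (cS N) (cL P) (cL N) s t.
Proof.
rewrite JE; last exact: hl2_zc.
rewrite E_zc Nh_zc.
have lsP : l2 (fun x => expR s * P x) by exact: l2Z.
have ltN : l2 (fun x => expR t * N x) by exact: l2Z.
have -> : sumZ (fun x => Flog p (zc u s t x)) =
    sumZ (fun x => Flog p (expR s * P x)) + sumZ (fun x => Flog p (expR t * N x)).
  rewrite -sumZD; [|exact: summ_plog..]; apply: sumZ_eq => x.
  rewrite /zc /P /N; case: (pos_neg_cases u x) => -[-> ->].
    by rewrite mulr0 addr0 /Flog plog0 ?addr0// ltW.
  by rewrite mulr0 add0r /Flog plog0 ?add0r// ltW.
have FE v : l2 v -> sumZ (fun x => Flog p (v x)) = p^-1 * (cL v - 2 / p * cS v).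
  move=> lv; rewrite /cL /cS -sumZZ; last exact: summ_plog.
  rewrite -sumZB; [|exact: summ_plog|by apply: summZ; exact: summ_plog].
  rewrite -sumZZ; last by apply: summB; [|apply: summZ]; exact: summ_plog.
  apply: sumZ_eq => x; rewrite /Flog plogE; field; rewrite gt_eqF//.
rewrite !sum_plog_expR// !FE// /Jcone; field; rewrite gt_eqF//.
Qed.

Lemma dJ_zc_pos s t : dJ w a b p h (zc u s t) (pos_part (zc u s t)) = DP u s t.
Proof.
have hz := hl2_zc s t hu.
rewrite dJE//; last exact: hl2_pos.
rewrite E_zc E_zc_pos pos_zc.
have -> : sumZ (fun x => h x * zc u s t x * (expR s * P x)) = expR s ^+ 2 * Nh P.
  rewrite -sumZZ; last exact: hl2_pos.
  apply: sumZ_eq => x; rewrite /zc; have := pos_neg_mul u x; rewrite -/P -/N => e.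
  have -> : h x * (expR s * P x + expR t * N x) * (expR s * P x) =
    expR s ^+ 2 * (h x * P x ^+ 2) + h x * expR s * expR t * (P x * N x) by ring.
  by rewrite e mulr0 addr0.
have -> : sumZ (fun x => flog p (zc u s t x) * (expR s * P x)) =
    sumZ (fun x => plog p 0 1 (expR s * P x)).
  apply: sumZ_eq => x; rewrite -flogM// /zc /P; case: (pos_neg_cases u x) => -[-> ->].
    by rewrite mulr0 addr0.
  by rewrite !mulr0.
by rewrite sum_plog_expR// mul1r.
Qed.

Lemma dJ_zc_neg s t : dJ w a b p h (zc u s t) (neg_part (zc u s t)) = DN u t s.
Proof.
have hz := hl2_zc s t hu.
rewrite dJE//; last exact: hl2_neg.
rewrite E_zc E_zc_neg neg_zc.
have -> : sumZ (fun x => h x * zc u s t x * (expR t * N x)) = expR t ^+ 2 * Nh N.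
  rewrite -sumZZ; last exact: hl2_neg.
  apply: sumZ_eq => x; rewrite /zc; have := pos_neg_mul u x; rewrite -/P -/N => e.
  have -> : h x * (expR s * P x + expR t * N x) * (expR t * N x) =
    expR t ^+ 2 * (h x * N x ^+ 2) + h x * expR s * expR t * (P x * N x) by ring.
  by rewrite e mulr0 addr0.
have -> : sumZ (fun x => flog p (zc u s t x) * (expR t * N x)) =
    sumZ (fun x => plog p 0 1 (expR t * N x)).
  apply: sumZ_eq => x; rewrite -flogM// /zc /N; case: (pos_neg_cases u x) => -[-> ->].
    by rewrite !mulr0.
  by rewrite mulr0 add0r.
by rewrite sum_plog_expR// mul1r qconeC.
Qed.

Hypothesis P0 : P <> (fun=> 0).
Hypothesis N0 : N <> (fun=> 0).

Lemma Mset_zc s t : DP u s t = 0 -> DN u t s = 0 -> Mset w a b p h (zc u s t).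
Proof.
move=> dP dN; split; first by apply/inHP; exact: hl2_zc.
have nz c v : v <> (fun=> 0) -> (fun x : T => expR c * v x) <> (fun=> 0).
  move=> /fun_neq0[x vx] /(congr1 (@^~ x)) /eqP; rewrite mulf_eq0 (negPf vx) orbF.
  by rewrite gt_eqF// expR_gt0.
by rewrite dJ_zc_pos dJ_zc_neg dP dN pos_zc neg_zc; do ! split; exact: nz.
Qed.

Lemma Mset_box l r : l <= r -> 0 <= DP u l l -> 0 <= DN u l l ->
  DP u r r < 0 -> DN u r r < 0 ->
  exists s t, [/\ l <= s <= r, l <= t <= r & Mset w a b p h (zc u s t)].
Proof.
move=> lr d1 d2 d3 d4.
have [s [t [ls lt dP dN]]] := cone_box (ltW a_gt0) (ltW b_gt0)
  (cA_ge0 u) (cB_ge0 u) (cD_ge0 u) lr d1 d2 d3 d4.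
by exists s, t; split=> //; exact: Mset_zc.
Qed.

Lemma Mset_proj : exists s t, Mset w a b p h (zc u s t).
Proof.
have [A0 B0 D0] := And3 (cA_ge0 u) (cB_ge0 u) (cD_ge0 u).
have HP := Nh_gt0 (hl2_pos hu) P0; have HN := Nh_gt0 (hl2_neg hu) N0.
have SP := cS_gt0 (hl2_pos hu) P0; have SN := cS_gt0 (hl2_neg hu) N0.
have [l1 l1P] := cone_ray_small (ltW a_gt0) (ltW b_gt0) p_ge4 (cL P) A0 B0 D0 HP (ltW SP).
have [l2 l2P] := cone_ray_small (ltW a_gt0) (ltW b_gt0) p_ge4 (cL N) B0 A0 D0 HN (ltW SN).
have [r1 r1P] := cone_ray_large (ltW a_gt0) (ltW b_gt0) p_ge4 (cL P) A0 B0 D0 HP SP.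
have [r2 r2P] := cone_ray_large (ltW a_gt0) (ltW b_gt0) p_ge4 (cL N) B0 A0 D0 HN SN.
pose l := Num.min l1 l2; pose r := Num.max l (Num.max r1 r2).
have [|||||s [t [_ _ M]]] := @Mset_box l r.
- by rewrite /r le_max lexx.
- by apply/ltW/l1P; rewrite ge_min lexx.
- by apply/ltW/l2P; rewrite ge_min lexx orbT.
- by apply: r1P; rewrite /r !le_max lexx orbT.
- by apply: r2P; rewrite /r !le_max lexx !orbT.
by exists s, t.
Qed.

End OnCone.

Lemma MsetE u : Mset w a b p h u ->
  [/\ hl2 u, pos_part u <> (fun=> 0), neg_part u <> (fun=> 0), DP u 0 0 = 0 & DN u 0 0 = 0].
Proof.
move=> [/inHP hu [P0 [N0 [dP dN]]]]; split=> //.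
  by rewrite -dJ_zc_pos// zc00.
by rewrite -dJ_zc_neg// zc00.
Qed.

Lemma Mset_max u s t : Mset w a b p h u -> J w a b p h (zc u s t) <= J w a b p h u.
Proof.
move=> /MsetE[hu P0 N0 dP dN]; rewrite -{2}(zc00 u) !J_zc//.
exact: (cone_max (ltW a_gt0) (ltW b_gt0) p_ge4 s t (cA_ge0 u) (cB_ge0 u) (cD_ge0 u)
  (Nh_ge0 _) (Nh_ge0 _) (cS_ge0 _) (cS_ge0 _) dP dN).
Qed.

(** Both signs are strict at the corners of every box around the origin; the perturbation argument
    depends on this strictness. *)
Lemma Mset_ray u : Mset w a b p h u ->
  (forall r, 0 < r -> DP u r r < 0 /\ DN u r r < 0) /\
  (forall r, r < 0 -> 0 < DP u r r /\ 0 < DN u r r).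
Proof.
move=> /MsetE[hu P0 N0 dP dN].
have k1 r := cone_ray_crit (ltW a_gt0) (ltW b_gt0) p_ge4 r (cA_ge0 u) (cB_ge0 u) (cD_ge0 u)
  (Nh_gt0 (hl2_pos hu) P0) (cS_ge0 _) dP.
have k2 r := cone_ray_crit (ltW a_gt0) (ltW b_gt0) p_ge4 r (cB_ge0 u) (cA_ge0 u) (cD_ge0 u)
  (Nh_gt0 (hl2_neg hu) N0) (cS_ge0 _) dN.
by split=> r r0; split; [have [+ _] := k1 r|have [+ _] := k2 r|have [_ +] := k1 r|have [_ +] := k2 r]; apply.
Qed.

(* On the Nehari set, [J u = J u - dJ u u / p], in which every term is nonnegative. *)
Lemma Mset_coercive u : Mset w a b p h u -> (2^-1 - p^-1) * Nh u <= J w a b p h u.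
Proof.
move=> /MsetE[hu P0 N0]; rewrite /DP /DN !cone_ray !mulr0 expR0 !mul1r !mul0r !addr0 => dP dN.
have A0 := cA_ge0 u; have B0 := cB_ge0 u; have D0 := cD_ge0 u.
have SP := cS_ge0 (pos_part u); have SN := cS_ge0 (neg_part u).
rewrite -{2}(zc00 u) J_zc// -{1}(zc00 u) Nh_zc// /Jcone !mulr0 expR0 expr1n !mul1r !mul0r !addr0.
have -> : qcone (cA u) (cB u) (cD u) 0 0 = cA u + 2 * cD u + cB u.
  by rewrite /qcone expR0; ring.
set Q := cA u + 2 * cD u + cB u; have Q0 : 0 <= Q by rewrite /Q; lra.
have EL : cL (pos_part u) + cL (neg_part u) =
    a * Q + Nh (pos_part u) + Nh (neg_part u) + b * Q ^+ 2.
  by move: dP dN; rewrite /Q; lra.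
set S1 := cS _ in SP *; set S2 := cS _ in SN *.
have -> : p^-1 * (cL (pos_part u) - 2 / p * S1 + (cL (neg_part u) - 2 / p * S2)) =
   p^-1 * (cL (pos_part u) + cL (neg_part u)) - 2 * (p^-1 ^+ 2 * (S1 + S2)) by ring.
rewrite EL.
have pi0 : 0 < p^-1 by rewrite invr_gt0.
have pi4 : p^-1 <= 4^-1 by rewrite lef_pV2 ?posrE.
have k1 : 0 <= p^-1 ^+ 2 * (S1 + S2) by rewrite mulr_ge0 ?sqr_ge0// addr_ge0.
have k2 : 0 <= (4^-1 - p^-1) * (b * Q ^+ 2).
  by rewrite mulr_ge0 ?subr_ge0// mulr_ge0 ?sqr_ge0// ltW.
have k3 : 0 <= (2^-1 - p^-1) * (a * Q).
  by apply: mulr_ge0; [lra|rewrite mulr_ge0// ltW].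
lra.
Qed.

(** Each constraint makes the sum of [|t|^p ln (t^2)] over the corresponding part positive, while
    its terms are nonpositive when [|t| <= 1]. The threshold is independent of [u], so it survives
    limits. *)
Lemma Mset_gt1 u : Mset w a b p h u -> (exists x, 1 < u x) /\ (exists x, u x < - 1).
Proof.
move=> /MsetE[hu P0 N0]; rewrite /DP /DN !cone_ray !mulr0 expR0 !mul1r !mul0r !addr0 => dP dN.
have A0 := cA_ge0 u; have B0 := cB_ge0 u; have D0 := cD_ge0 u.
have HP := Nh_gt0 (hl2_pos hu) P0; have HN := Nh_gt0 (hl2_neg hu) N0.
have LP : 0 < cL (pos_part u).
  have : 0 <= a * (cA u + cD u) by apply: mulr_ge0; [exact: ltW|lra].
  have : 0 <= b * (cA u + 2 * cD u + cB u) * (cA u + cD u).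
    by apply: mulr_ge0; [apply: mulr_ge0; [exact: ltW|lra]|lra].
  lra.
have LN : 0 < cL (neg_part u).
  have : 0 <= a * (cB u + cD u) by apply: mulr_ge0; [exact: ltW|lra].
  have : 0 <= b * (cB u + 2 * cD u + cA u) * (cB u + cD u).
    by apply: mulr_ge0; [apply: mulr_ge0; [exact: ltW|lra]|lra].
  lra.
have nonpos v : hl2 v -> (forall x, `|v x| <= 1) -> cL v <= 0.
  move=> hv v1; rewrite -(sumZ0 R d); apply: ler_sumZ.
  - exact: (summ_plog 0 1 (hl2_l2 hv)).
  - exact: summ_const0.
  - by move=> x; exact: plog_le0.
split; apply: contrapT => /forallNP H.
- suff /(nonpos _ (hl2_pos hu)) : forall x, `|pos_part u x| <= 1 by lra.
  move=> x.
  rewrite ger0_norm ?pos_part_ge0// /pos_part ge_max ler01 andbT leNgt.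
  exact/negP/H.
- suff /(nonpos _ (hl2_neg hu)) : forall x, `|neg_part u x| <= 1 by lra.
  move=> x.
  rewrite ler0_norm ?neg_part_le0// /neg_part lerNl le_min lerN10 andbT leNgt.
  exact/negP/H.
Qed.

End Functional.
(** * Limits along sequences *)

Section SequenceLimits.
Variable R : realType.

(** The hypothesis has the shape that Young's inequality delivers: cross terms split into an
    arbitrarily small part and a large multiple of the squared increment. *)
Lemma quasi_cvg (X r : nat -> R) (l : R) : (forall n, 0 <= r n) -> r @ \oo --> 0 ->
  (forall e, 0 < e -> exists2 C, 0 <= C &
     forall n, r n <= 1 -> `|X n - l| <= e + C * r n) ->
  X @ \oo --> l.
Proof.
move=> r0 r_cvg H; apply/cvgrPdistC_lt => e e0.
have [|C C0 HC] := H (e / 2); first by rewrite divr_gt0.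
have C1 : 0 < C + 1 by lra.
near=> n.
have rn1 : r n < 1 by near: n; apply: (cvgr_lt _ r_cvg).
have rn2 : r n < (e / 2) / (C + 1).
  by near: n; apply: (cvgr_lt _ r_cvg); rewrite !divr_gt0.
apply: le_lt_trans (HC n (ltW rn1)) _.
move: rn2; rewrite ltr_pdivlMr//; have := r0 n; lra.
Unshelve. all: by end_near. Qed.

Lemma near_seq (I : eqType) (s : seq I) (P : I -> nat -> Prop) :
  (forall x, x \in s -> \forall n \near \oo, P x n) ->
  \forall n \near \oo, forall x, x \in s -> P x n.
Proof.
elim: s => [|y s ih] H; first by near=> n.
have h1 : \forall n \near \oo, P y n by apply: H; rewrite mem_head.
have h2 : \forall n \near \oo, forall x, x \in s -> P x n.
  by apply: ih => x xs; apply: H; rewrite inE xs orbT.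
near=> n; move=> x; rewrite inE => /orP[/eqP ->|]; last by move: x; near: n.
by near: n.
Unshelve. all: by end_near. Qed.

Lemma cvg_seq_sum (I : Type) (s : seq I) (f : I -> nat -> R) (l : I -> R) :
  (forall x, f x @ \oo --> l x) -> (fun n => \sum_(x <- s) f x n) @ \oo --> \sum_(x <- s) l x.
Proof.
move=> H; elim: s => [|x s ih].
  by under eq_fun do rewrite big_nil; rewrite big_nil; exact: cvg_cst.
by under eq_fun do rewrite big_cons; rewrite big_cons; apply: cvgD.
Qed.

Lemma pointwise_subseq (I : countType) (K : R) (u : nat -> I -> R) :
  (forall n x, `|u n x| <= K) ->
  exists (v : I -> R) (k : nat -> nat), (forall n, (n <= k n)%N) /\
    forall x, (fun n => u (k n) x) @ \oo --> v x.
Proof.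
move=> uK.
have cK := @tychonoff I (fun _ => R : topologicalType) (fun _ => `[- K, K]%classic)
  (fun _ => @segment_compact R (- K) K).
have [|v [_ clv]] := cK (u @ \oo) _.
  by exists 0%N => // n _ /= x; rewrite in_itv/= -ler_norml.
pose s n : seq I := pmap choice.unpickle (iota 0 n).
have nearv (n : nat) (l : seq I) :
    nbhs v [set f | forall x, x \in l -> `|v x - f x| < n.+1%:R^-1].
  elim: l => [|y l ih]; first exact: filterE.
  have hy : nbhs v [set f | `|v y - f y| < n.+1%:R^-1].
    have B : nbhs (v y : R) [set t : R | `|v y - t| < n.+1%:R^-1].
      by apply/nbhs_ballP; exists n.+1%:R^-1 => //=; rewrite invr_gt0 ltr0n.
    exact: (@proj_continuous I (fun _ => R : topologicalType) y v _ B).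
  apply: filterS2 hy ih => f fy fl x; rewrite inE => /orP[/eqP -> //|].
  exact: fl.
have /choice[k kP] : forall n, exists m, (n <= m)%N /\
    forall x, x \in s n -> `|v x - u m x| < n.+1%:R^-1.
  move=> n; have [|f [[m nm <-] fl]] := clv (u @` [set m | (n <= m)%N]) _ _ (nearv n (s n)).
  - by exists n => // m nm; exists m.
  - by exists m.
exists v, k; split=> [n|x]; first by have [] := kP n.
apply/cvgrPdist_lt => e e0; near=> n; have [_ kn] := kP n.
have xn : x \in s n.
  rewrite mem_pmap; apply/mapP; exists (choice.pickle x); last by rewrite choice.pickleK.
  by rewrite mem_iota/= add0n; near: n; exists (choice.pickle x).+1.
apply: lt_trans (kn x xn) _; near: n.
exact: (near_infty_natSinv_lt (PosNum e0)).
Unshelve. all: by end_near. Qed.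

End SequenceLimits.

(** * Continuity, semicontinuity and compactness of the terms of the energy *)

Section FunctionalLimits.
Variables (R : realType) (d : nat) (w : Zd d -> Zd d -> R) (W a b p : R)
  (h : Zd d -> R) (h0 : R).
Hypothesis st : setting w W a b p h h0.
Local Notation T := (Zd d).
Implicit Types (u v z : T -> R) (x : T).
Local Notation E u v := (sumZ (gradprod w u v)).
Local Notation SQ u := (sumZ (fun x => u x ^+ 2)).
Let p_gt3 : 3 < p. Proof. by have := st_p st; lra. Qed.
Let h_gt0 := h_gt0 st.

Lemma SQ_ge0 u : 0 <= SQ u.
Proof. by apply: sumZ_ge0 => x; exact: sqr_ge0. Qed.

Let W0 : 0 <= W := W_ge0 (st_w st) (st_W st) (finfun (fun=> 0)).

Lemma SQZ c u : l2 u -> SQ (fun x => c * u x) = c ^+ 2 * SQ u.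
Proof. by move=> lu; rewrite -sumZZ//; apply: sumZ_eq => x; rewrite exprMn. Qed.

(** Young's inequality for the form: [E_le] applied to [c u] and [c^-1 v], which leaves [E u v]
    unchanged. *)
Lemma E_le_scaled c u v : 0 < c -> l2 u -> l2 v ->
  `|E u v| <= W * (c ^+ 2 * SQ u + c^-1 ^+ 2 * SQ v).
Proof.
move=> c0 lu lv.
have := E_le (st_wC st) (st_w st) (st_W st) (l2Z c lu) (l2Z c^-1 lv).
rewrite (E_Zl (st_wC st) (st_w st) (st_W st) c lu (l2Z c^-1 lv)).
rewrite (E_Zr (st_wC st) (st_w st) (st_W st) c^-1 lv lu) mulrA divff ?gt_eqF// mul1r.
by rewrite (SQZ c lu) (SQZ c^-1 lv).
Qed.

Lemma E_add z g : l2 z -> l2 g ->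
  E (fun x => z x + g x) (fun x => z x + g x) = E z z + 2 * E z g + E g g.
Proof.
move=> lz lg; have lzg := l2D lz lg.
rewrite (E_Dl (st_wC st) (st_w st) (st_W st) lz lg lzg).
rewrite (E_Dr (st_wC st) (st_w st) (st_W st) lz lg lz).
rewrite (E_Dr (st_wC st) (st_w st) (st_W st) lz lg lg) (E_C w g z); ring.
Qed.

Lemma small_mul (k e : R) : 0 <= k -> 0 < e -> exists2 c, 0 < c & c * k <= e /\ c ^+ 2 * k <= e.
Proof.
move=> k0 e0; have k1 : 0 < k + 1 by lra.
pose c := Num.min 1 (e / (k + 1)).
have c0 : 0 < c by rewrite lt_min ltr01 divr_gt0.
have c1 : c <= 1 by rewrite ge_min lexx.
have ce : c * (k + 1) <= e by rewrite -ler_pdivlMr// ge_min lexx orbT.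
have ck : c * k <= e by lra.
exists c => //; split=> //; apply: le_trans ck; apply: ler_wpM2r => //.
by rewrite expr2 ger_pMr.
Qed.

Lemma subfunE (f z : T -> R) : f = (fun x => z x + (f x - z x)).
Proof. by apply/funext => x; rewrite addrC subrK. Qed.

Lemma cvg_E z (zn : nat -> T -> R) : l2 z -> (forall n, l2 (zn n)) ->
  (fun n => SQ (fun x => zn n x - z x)) @ \oo --> 0 ->
  (fun n => E (zn n) (zn n)) @ \oo --> E z z.
Proof.
move=> lz lzn g0; apply: (@quasi_cvg R _ _ _ (fun n => SQ_ge0 _) g0) => e e0.
have k0 : 0 <= 2 * W * SQ z by rewrite !mulr_ge0// SQ_ge0.
have [c c0 [_ ce]] := small_mul k0 e0.
exists (2 * W * c^-1 ^+ 2 + 2 * W) => [|n _].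
  have := mulr_ge0 W0 (sqr_ge0 c^-1); have := W0; lra.
have lg := l2B (lzn n) lz.
rewrite [in E (zn n) (zn n)](subfunE (zn n) z) (E_add lz lg).
have := E_le_scaled c0 lz lg; have := E_sqr_le (st_wC st) (st_w st) (st_W st) lg.
have := E_ge0 (st_w st) (fun x => zn n x - z x).
set G := SQ (fun x => zn n x - z x).
set Eg := E (fun x => zn n x - z x) (fun x => zn n x - z x).
set Ezg := E z (fun x => zn n x - z x); set Ez := E z z; set Z := SQ z in ce *.
move=> Eg0 Egle; rewrite !ler_norml => /andP[k1 k2].
have G0 : 0 <= W * (c^-1 ^+ 2 * G).
  by apply: mulr_ge0 => //; apply: mulr_ge0; [exact: sqr_ge0|exact: SQ_ge0].
have G1 : 0 <= W * G by apply: mulr_ge0 => //; exact: SQ_ge0.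
clearbody G Eg Ezg Ez Z.
by apply/andP; split; lra.
Qed.

Lemma cvg_plog c1 c2 z (zn : nat -> T -> R) : l2 z -> (forall n, l2 (zn n)) ->
  (fun n => SQ (fun x => zn n x - z x)) @ \oo --> 0 ->
  (fun n => sumZ (fun x => plog p c1 c2 (zn n x))) @ \oo --> sumZ (fun x => plog p c1 c2 (z x)).
Proof.
move=> lz lzn g0; apply: (@quasi_cvg R _ _ _ (fun n => SQ_ge0 _) g0) => e e0.
have [M M0 zM] := l2_bounded lz.
(* [quasi_cvg] asks only for squared increments of sum at most 1, so every [zn n] in question is
   bounded by [M + 1] and one Lipschitz constant serves. *)
have M10 : 0 < M + 1 by lra.
have [C C0 HC] := plog_lip p_gt3 c1 c2 M10.
have k0 : 0 <= C * SQ z by rewrite mulr_ge0 ?SQ_ge0.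
have [c c0 [ce _]] := small_mul k0 e0.
have ci0 : 0 < c^-1 by rewrite invr_gt0.
exists (C * (c^-1 + 1)) => [|n G1]; first by rewrite mulr_ge0// addr_ge0// ltW.
have lg := l2B (lzn n) lz.
have sz := summ_plog st c1 c2 lz; have sn := summ_plog st c1 c2 (lzn n).
have sd := summB sn sz.
rewrite -sumZB//; apply: le_trans (sumZ_norm_le sd) _.
have sb : summ (fun x => C * c * z x ^+ 2 + C * (c^-1 + 1) * (zn n x - z x) ^+ 2).
  by apply: summD; exact: summZ.
apply: (@le_trans _ _ (sumZ (fun x => C * c * z x ^+ 2 + C * (c^-1 + 1) * (zn n x - z x) ^+ 2))).
  apply: ler_sumZ => //; first exact: summ_norm.
  move=> x; set g := zn n x - z x.
  have g1 : `|g| <= 1.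
    have := le_trans (sqr_term_le x lg) G1; rewrite -/g -(real_normK (num_real g)) => h1.
    by have := normr_ge0 g; nra.
  have znE : zn n x = z x + g by rewrite /g addrC subrK.
  have nz : `|zn n x| <= `|z x| + `|g| by rewrite znE ler_normD.
  apply: le_trans (HC _ _ _ _) _.
  - by have := zM x; lra.
  - by have := zM x; lra.
  rewrite -/g -!mulrA -mulrDr ler_wpM2l// -(real_normK (num_real g)) -(real_normK (num_real (z x))).
  have gg := normr_ge0 g; have zz := normr_ge0 (z x).
  apply: (@le_trans _ _ ((2 * `|z x| + `|g|) * `|g|)); first by apply: ler_wpM2r => //; lra.
  have : 0 <= c^-1 * (c * `|z x| - `|g|) ^+ 2 by rewrite mulr_ge0 ?sqr_ge0// ltW.
  have -> : c^-1 * (c * `|z x| - `|g|) ^+ 2 =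
    c * `|z x| ^+ 2 - 2 * `|z x| * `|g| + c^-1 * `|g| ^+ 2 by field; rewrite gt_eqF.
  lra.
rewrite sumZD; [|exact: summZ|exact: summZ].
rewrite !sumZZ//; lra.
Qed.

Lemma hfset_le_Nh u (A : {fset T}) : hl2 h u -> \sum_(x <- A) h x * u x ^+ 2 <= Nh h u.
Proof. by move=> hu; apply: ler_fset_sumZ => // x; exact: (hsq_ge0 st). Qed.

Lemma cvg_hfset (A : {fset T}) (zn : nat -> T -> R) z :
  (forall x, (fun n => zn n x) @ \oo --> z x) ->
  (fun n => \sum_(x <- A) h x * zn n x ^+ 2) @ \oo --> \sum_(x <- A) h x * z x ^+ 2.
Proof.
move=> zcvg; apply: (@cvg_seq_sum R T A (fun x n => h x * zn n x ^+ 2)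
  (fun x => h x * z x ^+ 2)) => x.
by apply: cvgM; [exact: cvg_cst|apply: cvgM; exact: zcvg].
Qed.

(** Fatou through finite sums: a finite set carries [Nh h z] up to [e / 2], and there the sums
    converge. *)
Lemma Nh_lsc (zn : nat -> T -> R) z e : 0 < e -> (forall n, hl2 h (zn n)) ->
  (forall x, (fun n => zn n x) @ \oo --> z x) ->
  \forall n \near \oo, Nh h z <= Nh h (zn n) + e.
Proof.
move=> e0 hn zcvg.
have [|A Ae] := sumZ_approx (hsq_ge0 st z) (_ : 0 < e / 2); first by rewrite divr_gt0.
have Acvg := cvg_hfset (A := A) zcvg.
near=> n.
have : \sum_(x <- A) h x * z x ^+ 2 - e / 2 < \sum_(x <- A) h x * zn n x ^+ 2.
  by near: n; apply: (cvgr_gt _ Acvg); lra.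
by have := hfset_le_Nh A (hn n); rewrite /Nh; lra.
Unshelve. all: by end_near. Qed.

Lemma hl2_limit (un : nat -> T -> R) v C : (forall n, hl2 h (un n)) ->
  (forall n, Nh h (un n) <= C) -> (forall x, (fun n => un n x) @ \oo --> v x) -> hl2 h v.
Proof.
move=> hun unC ucvg.
exists C => A; rewrite (eq_bigr (fun x => h x * v x ^+ 2)); last first.
  by move=> x _; rewrite ger0_norm//; exact: (hsq_ge0 st).
rewrite leNgt; apply/negP => CA.
have [N _ HN] := cvgr_gt _ (cvg_hfset (A := A) ucvg) _ CA.
by have := HN N (leqnn N); have := hfset_le_Nh A (hun N); have := unC N; lra.
Qed.

Lemma fset_indicatorE (f : T -> R) (A : {fset T}) :
  (fun x => if x \in A then f x else 0) =
  (fun x => \sum_(y <- A) (if x == y then f y else 0)).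
Proof.
apply/funext => x; case: ifPn => xA.
  rewrite (big_fsetD1 x)//= eqxx big_seq big1 ?addr0// => y.
  by rewrite !inE => /andP[yx _]; rewrite eq_sym (negPf yx).
rewrite big_seq big1// => y yA; case: eqP => // xy.
by rewrite xy yA in xA.
Qed.

Lemma sumZ_fset (f : T -> R) (A : {fset T}) :
  summ (fun x => if x \in A then f x else 0) /\
  sumZ (fun x => if x \in A then f x else 0) = \sum_(x <- A) f x.
Proof.
rewrite fset_indicatorE.
have s1 y : summ (fun x : T => if x == y then f y else 0).
  by apply: (@summ_single R d _ y) => x /negPf ->.
split; first exact: summ_sum.
rewrite sumZ_sum//; apply: eq_bigr => y _.
by rewrite (@sumZ_single R d _ y) ?eqxx// => x /negPf ->.
Qed.

(* As [h] tends to infinity, a bound on [Nh] makes the tails uniformly small. *)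
Lemma tight_l2 (un : nat -> T -> R) v C : (forall n, hl2 h (un n)) ->
  (forall n, Nh h (un n) <= C) -> (forall x, (fun n => un n x) @ \oo --> v x) ->
  (fun n => SQ (fun x => un n x - v x)) @ \oo --> 0.
Proof.
move=> hun unC ucvg; have hv := hl2_limit hun unC ucvg.
apply/cvgr0Pnorm_lt => e e0.
have K0 : 0 <= C + Nh h v.
  by have := Nh_ge0 st v; have := Nh_ge0 st (un 0%N); have := unC 0%N; lra.
(* Off [A] the squared difference is at most [2 / M] times [h un^2 + h v^2]; this [M] makes the
   total at most [e / 2]. *)
have M0 : 0 < 4 * (C + Nh h v + 1) / e by rewrite divr_gt0//; lra.
set M := 4 * _ / e in M0.
have [A AM] := st_hoo st M.
have fin0 : (fun n => \sum_(x <- A) (un n x - v x) ^+ 2) @ \oo --> (0 : R).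
  have := @cvg_seq_sum R T A (fun x n => (un n x - v x) ^+ 2) (fun=> 0).
  rewrite big1_eq; apply => x; rewrite -[X in _ --> X](mulr0 0).
  have vv : (fun n => un n x - v x) @ \oo --> (0 : R).
    by rewrite -(subrr (v x)); apply: cvgB; [exact: ucvg|exact: cvg_cst].
  exact: cvgM.
near=> n; rewrite ger0_norm ?SQ_ge0//.
have fn : \sum_(x <- A) (un n x - v x) ^+ 2 < e / 2.
  by near: n; apply: (cvgr_lt _ fin0); rewrite divr_gt0.
have [sA sAE] := sumZ_fset (fun x => (un n x - v x) ^+ 2) A.
have lg := l2B (hl2_l2 st (hun n)) (hl2_l2 st hv).
have sn := hun n.
have sh : summ (fun x => 2 / M * (h x * un n x ^+ 2 + h x * v x ^+ 2)).
  by apply: summZ; exact: summD.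
apply: le_lt_trans (_ : sumZ (fun x => (if x \in A then (un n x - v x) ^+ 2 else 0)
   + 2 / M * (h x * un n x ^+ 2 + h x * v x ^+ 2)) < e).
  apply: ler_sumZ; [exact: lg|exact: summD|move=> x].
  have hu0 := hsq_ge0 st (un n) x; have hv0 := hsq_ge0 st v x.
  have M20 : 0 <= 2 / M by rewrite divr_ge0// ltW.
  case: ifPn => xA; first by rewrite lerDl mulr_ge0// addr_ge0.
  rewrite add0r -mulrDr mulrA.
  have hM : 2 <= 2 / M * h x by rewrite mulrAC ler_pdivlMr// ler_pM2l// AM.
  apply: (@le_trans _ _ (2 * (un n x ^+ 2 + v x ^+ 2))).
    by have := sqr_ge0 (un n x + v x); lra.
  by rewrite ler_wpM2r// addr_ge0 ?sqr_ge0.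
rewrite sumZD// sAE sumZZ; last exact: summD.
rewrite sumZD// -/(Nh h (un n)) -/(Nh h v).
have : 2 / M * (Nh h (un n) + Nh h v) <= 2 / M * (C + Nh h v + 1).
  by rewrite ler_wpM2l ?divr_ge0 ?ltW//; have := unC n; lra.
have -> : 2 / M * (C + Nh h v + 1) = e / 2.
  by rewrite /M; field; rewrite !gt_eqF//; lra.
lra.
Unshelve. all: by end_near. Qed.

End FunctionalLimits.
(** * Existence of a minimizer *)

Section Lipschitz.
Variable R : realType.

Lemma lip_cvg (f : R -> R) (K : R) (X : nat -> R) (l : R) : 0 < K ->
  (forall r r', `|f r - f r'| <= K * `|r - r'|) -> X @ \oo --> l ->
  (fun n => f (X n)) @ \oo --> f l.
Proof.
move=> K0 fK /cvgrPdist_lt Xl; apply/cvgrPdist_lt => e e0; near=> n.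
apply: le_lt_trans (fK _ _) _; rewrite mulrC -ltr_pdivlMr//.
by near: n; apply: Xl; rewrite divr_gt0.
Unshelve. all: by end_near. Qed.

Definition zs (s t r : R) := expR s * Num.max r 0 + expR t * Num.min r 0.

Lemma zs_lip s t r r' : `|zs s t r - zs s t r'| <= (expR s + expR t) * `|r - r'|.
Proof.
have es := expR_gt0 s; have et := expR_gt0 t.
wlog rr : r r' / r <= r'.
  move=> H; have [/H //|/ltW/H] := leP r r'.
  by rewrite distrC (distrC r').
rewrite /zs [X in _ <= _ * X]ler0_norm ?subr_le0//.
have M1 : Num.max r 0 <= Num.max r' 0.
  by rewrite ge_max !le_max rr lexx/= orbT.
have M2 : Num.max r' 0 - Num.max r 0 <= r' - r.
  by case: (leP r 0) => ?; case: (leP r' 0) => ?; lra.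
have M3 : Num.min r 0 <= Num.min r' 0.
  by rewrite le_min !ge_min rr lexx/= orbT.
have M4 : Num.min r' 0 - Num.min r 0 <= r' - r.
  by case: (leP r 0) => ?; case: (leP r' 0) => ?; lra.
have k1 := ler_wpM2l (ltW es) M2; have k2 := ler_wpM2l (ltW et) M4.
have k3 := ler_wpM2l (ltW es) M1; have k4 := ler_wpM2l (ltW et) M3.
by rewrite ler_norml; apply/andP; split; lra.
Qed.

Lemma zs_cvg s t (X : nat -> R) (l : R) : X @ \oo --> l ->
  (fun n => zs s t (X n)) @ \oo --> zs s t l.
Proof.
by apply: lip_cvg (@zs_lip s t); rewrite addr_gt0 ?expR_gt0.
Qed.

Lemma invS_cvg0 : (fun n => n.+1%:R^-1 : R) @ \oo --> 0.
Proof.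
apply/cvgr0Pnorm_lt => e e0; near=> n; rewrite ger0_norm ?invr_ge0//.
by near: n; exact: (near_infty_natSinv_lt (PosNum e0)).
Unshelve. all: by end_near. Qed.

End Lipschitz.

Section Minimizer.
Variables (R : realType) (d : nat) (w : Zd d -> Zd d -> R) (W a b p : R)
  (h : Zd d -> R) (h0 : R).
Hypothesis st : setting w W a b p h h0.
Local Notation T := (Zd d).
Implicit Types (u v z : T -> R) (x : T).
Local Notation E u v := (sumZ (gradprod w u v)).
Local Notation SQ u := (sumZ (fun x => u x ^+ 2)).
Local Notation M := (Mset w a b p h).
Local Notation Jf := (J w a b p h).

Definition dirac x (c : R) : T -> R := fun y => if y == x then c else 0.

Lemma hl2_dirac x c : hl2 h (dirac x c).
Proof.
apply: (@summ_single R d _ x) => y /negPf yx.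
by rewrite /dirac yx expr0n mulr0.
Qed.

Lemma Mset_nonempty (x y : T) : x != y -> exists u, M u.
Proof.
move=> xy; pose u := fun t => dirac x 1 t + dirac y (- 1) t.
have hu : hl2 h u by apply: (hl2D st); exact: hl2_dirac.
have ux : u x = 1 by rewrite /u /dirac eqxx (negPf xy) addr0.
have uy : u y = - 1 by rewrite /u /dirac eqxx eq_sym (negPf xy) add0r.
have [||s [t Mz]] := Mset_proj st hu.
- move=> /(congr1 (@^~ x)); rewrite /pos_part ux (max_idPl ler01) => /eqP.
  by rewrite oner_eq0.
- move=> /(congr1 (@^~ y)); rewrite /neg_part uy (min_idPl (lerN10 R)) => /eqP.
  by rewrite oppr_eq0 oner_eq0.
by exists (zc u s t).
Qed.

Lemma zc_zs u s t x : zc u s t x = zs s t (u x).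
Proof. by []. Qed.

Lemma cvg_SQ_zc (un : nat -> T -> R) v s t : (forall n, l2 (fun x => un n x - v x)) ->
  (forall n, l2 (fun x => zc (un n) s t x - zc v s t x)) ->
  (fun n => SQ (fun x => un n x - v x)) @ \oo --> 0 ->
  (fun n => SQ (fun x => zc (un n) s t x - zc v s t x)) @ \oo --> 0.
Proof.
move=> l1 l2' H; set K := expR s + expR t.
have H' : (fun n => K ^+ 2 * SQ (fun x => un n x - v x)) @ \oo --> (0 : R).
  by rewrite -[X in _ --> X](mulr0 (K ^+ 2)); apply: cvgM => //; exact: cvg_cst.
apply: squeeze_cvgr (cvg_cst 0) H'; near=> n; apply/andP; split.
  by apply: sumZ_ge0 => x; exact: sqr_ge0.
rewrite -sumZZ; last exact: l1.
apply: ler_sumZ; [exact: l2'|apply: summZ; exact: l1|move=> x].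
rewrite !zc_zs -exprMn -(real_normK (num_real (zs _ _ _ - _))) -(real_normK (num_real (K * _))).
rewrite lerXn2r ?nnegrE// normrM (@gtr0_norm _ K) ?addr_gt0 ?expR_gt0//.
exact: zs_lip.
Unshelve. all: by end_near. Qed.

Let q0 : 0 < 2^-1 - p^-1.
Proof.
have pp := st_p st; rewrite subr_gt0 ltf_pV2 ?posrE//; lra.
Qed.

Lemma Mset_J_ge0 u : M u -> 0 <= Jf u.
Proof.
move=> Mu; apply: le_trans (Mset_coercive st Mu).
by apply: mulr_ge0; [exact: ltW|exact: (Nh_ge0 st)].
Qed.

(* Outside a finite set, [h] is so large that [u x > 1] would violate the bound on [Nh]. *)
Lemma limit_parts_neq0 (un : nat -> T -> R) v C : (forall n, M (un n)) ->
  (forall n, Nh h (un n) <= C) -> (forall x, (fun n => un n x) @ \oo --> v x) ->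
  pos_part v <> (fun=> 0) /\ neg_part v <> (fun=> 0).
Proof.
move=> Mun unC ucvg.
have C0 : 0 <= C by exact: le_trans (Nh_ge0 st (un 0%N)) (unC 0%N).
have [A AC] := st_hoo st (C + 1).
have inA n x : 1 < `|un n x| -> x \in A.
  move=> u1; apply: contrapT => /negP /AC hC.
  have [hn _ _ _ _] := MsetE st (Mun n).
  have := ler_term_sumZ x (hsq_ge0 st (un n)) hn; have := unC n; rewrite /Nh.
  rewrite -(real_normK (num_real (un n x))) => k1 k2.
  have : 1 <= `|un n x| ^+ 2 by rewrite exprn_ege1// ltW.
  by move=> k3; have := ler_pM (_ : 0 <= C + 1) ler01 hC k3; rewrite mulr1; lra.
split.
- move=> v0.
  have [N _ HN] : \forall n \near \oo, forall x, x \in (A : seq T) -> un n x < 1.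
    apply: near_seq => x _; apply: (cvgr_lt _ (ucvg x)).
    have := congr1 (@^~ x) v0; rewrite /pos_part => /max_idPr; lra.
  have [[x ux] _] := Mset_gt1 st (Mun N).
  have xA : x \in A by apply: (inA N); rewrite (lt_le_trans ux)// ler_norm.
  by have := HN N (leqnn N) x xA; lra.
- move=> v0.
  have [N _ HN] : \forall n \near \oo, forall x, x \in (A : seq T) -> - 1 < un n x.
    apply: near_seq => x _; apply: (cvgr_gt _ (ucvg x)).
    have := congr1 (@^~ x) v0; rewrite /neg_part => /min_idPr; lra.
  have [_ [x ux]] := Mset_gt1 st (Mun N).
  have xA : x \in A.
    by apply: (inA N); have := ler_norm (- un N x); rewrite normrN; lra.
  by have := HN N (leqnn N) x xA; lra.
Qed.

Lemma minimizer_exists : (exists x y : T, x != y) ->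
  exists2 v, M v & forall u, M u -> Jf v <= Jf u.
Proof.
move=> [x0 [y0 xy]]; pose S := [set Jf u | u in [set u | M u]].
have lbS : lbound S 0 by move=> _ [u Mu <-]; exact: Mset_J_ge0.
have infS : has_inf S.
  split; last by exists 0.
  by have [u Mu] := Mset_nonempty xy; exists (Jf u); exists u.
pose m := inf S.
have mS u : M u -> m <= Jf u by move=> Mu; apply: inf_lbound; [exists 0|exists u].
have /choice[un unP] : forall n, exists u, M u /\ Jf u < m + n.+1%:R^-1.
  move=> n; have [|_ [u Mu <-] uJ] := @inf_adherent R S n.+1%:R^-1 _ infS.
    by rewrite invr_gt0.
  by exists u.
(* The coercivity bound at energy level [m + 1], below which the whole sequence lies. *)
pose C := (m + 1) / (2^-1 - p^-1).
have unC n : Nh h (un n) <= C.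
  have [Mu uJ] := unP n; rewrite ler_pdivlMr// mulrC.
  apply: le_trans (Mset_coercive st Mu) _; apply: le_trans (ltW uJ) _.
  by rewrite lerD2l invf_le1// ler1n.
have h00 := st_h0 st.
have hun n : hl2 h (un n) by have [] := MsetE st (unP n).1.
have unK n x : `|un n x| <= 1 + C / h0.
  have k1 := sqr_term_le x (hl2_l2 st (hun n)); have k2 := sumsq_le_Nh st (hun n).
  have k3 : Nh h (un n) / h0 <= C / h0 by rewrite ler_pM2r ?invr_gt0.
  have : `|un n x| ^+ 2 <= C / h0 by rewrite real_normK ?num_real//; lra.
  by have := sqr_ge0 (`|un n x| - 1); have := normr_ge0 (un n x); nra.
have [v [k [kn kcvg]]] := pointwise_subseq unK.
pose vn n := un (k n).
have Mvn n : M (vn n) := (unP (k n)).1.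
have hvn n : hl2 h (vn n) := hun (k n).
have vnC n : Nh h (vn n) <= C := unC (k n).
have vnJ n : Jf (vn n) < m + n.+1%:R^-1.
  apply: lt_le_trans (unP (k n)).2 _; rewrite lerD2l lef_pV2 ?posrE//.
  by rewrite ler_nat ltnS.
have hv : hl2 h v := hl2_limit st hvn vnC kcvg.
have SQ0 := tight_l2 st hvn vnC kcvg.
have [P0 N0] := limit_parts_neq0 Mvn vnC kcvg.
have [s [t Mz]] := Mset_proj st hv P0 N0.
exists (zc v s t) => // u Mu; apply: le_trans (mS u Mu).
have hz := hl2_zc st s t hv; have lz := hl2_l2 st hz.
have hzn n : hl2 h (zc (vn n) s t) := hl2_zc st s t (hvn n).
have lzn n : l2 (zc (vn n) s t) := hl2_l2 st (hzn n).
have SQz : (fun n => SQ (fun x => zc (vn n) s t x - zc v s t x)) @ \oo --> 0.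
  apply: cvg_SQ_zc SQ0 => n; apply: l2B => //; exact: (hl2_l2 st).
have zcvg x : (fun n => zc (vn n) s t x) @ \oo --> zc v s t x.
  by apply: zs_cvg; exact: kcvg.
have Ecvg := cvg_E st lz lzn SQz.
have Fcvg := cvg_plog (c1 := - 2 / p ^+ 2) (c2 := p^-1) st lz lzn SQz.
(* The part of the energy that converges; the omitted weighted sum is only lower semicontinuous. *)
pose I z := 2^-1 * (a * E z z) + b / 4 * (E z z * E z z) - sumZ (fun x => Flog p (z x)).
have Icvg : (fun n => I (zc (vn n) s t)) @ \oo --> I (zc v s t).
  apply: cvgB; last exact: Fcvg.
  apply: cvgD; apply: cvgM; try exact: cvg_cst.
    by apply: cvgM; [exact: cvg_cst|exact: Ecvg].
  by apply: cvgM; exact: Ecvg.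
have JI z : hl2 h z -> Jf z = I z + 2^-1 * Nh h z.
  by move=> hz'; rewrite (JE st hz') /I; ring.
apply/ler_addgt0Pr => e e0.
have e3 : 0 < e / 3 by rewrite divr_gt0.
have [N _ HN] : \forall n \near \oo, Nh h (zc v s t) <= Nh h (zc (vn n) s t) + e / 3
    /\ (I (zc v s t) < I (zc (vn n) s t) + e / 3 /\ n.+1%:R^-1 < e / 3).
  apply: filterI; first exact: (Nh_lsc st e3 hzn zcvg).
  apply: filterI; last exact: (cvgr_lt _ (@invS_cvg0 R) _ e3).
  have lt3 : I (zc v s t) - e / 3 < I (zc v s t) by rewrite ltrBlDr ltrDl.
  by apply: filterS (cvgr_gt _ Icvg _ lt3) => n; rewrite ltrBlDr.
have [k1 [k2 k3]] := HN N (leqnn N).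
(* The parameters [s] and [t] project the limit, not [vn N]; still [vn N] maximizes the energy on
   its own cone, so they do not raise it. *)
have k4 := Mset_max st s t (Mvn N); have k5 := vnJ N.
rewrite (JI _ hz); move: k4; rewrite (JI _ (hzn N)); move: k1 k2 k3 k5.
set j := Jf _; set i := I _; set i' := I _; set n1 := Nh _ _; set n2 := Nh _ _.
clearbody j i i' n1 n2; move: (N.+1%:R^-1) (m : R) (e : R) e0 => q m' e' e'0; lra.
Qed.

End Minimizer.
(** * Minimizers are critical points *)

Section ScalarParts.
Variable R : realType.

Lemma max0_lip (r r' : R) : `|Num.max r 0 - Num.max r' 0| <= 1 * `|r - r'|.
Proof.
rewrite mul1r; wlog rr : r r' / r <= r'.
  by move=> H; have [/H //|/ltW/H] := leP r r'; rewrite distrC (distrC r').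
rewrite (@ler0_norm _ (r - r')) ?subr_le0// ler_norml.
by case: (leP r 0) => ?; case: (leP r' 0) => ?; apply/andP; split; lra.
Qed.

Lemma min0_lip (r r' : R) : `|Num.min r 0 - Num.min r' 0| <= 1 * `|r - r'|.
Proof.
rewrite mul1r; wlog rr : r r' / r <= r'.
  by move=> H; have [/H //|/ltW/H] := leP r r'; rewrite distrC (distrC r').
rewrite (@ler0_norm _ (r - r')) ?subr_le0// ler_norml.
by case: (leP r 0) => ?; case: (leP r' 0) => ?; apply/andP; split; lra.
Qed.

Lemma zs_ge0 (s t r : R) : 0 <= r -> zs s t r = expR s * r.
Proof. by move=> r0; rewrite /zs (max_idPl r0) (min_idPr r0) mulr0 addr0. Qed.

Lemma zs_le0 (s t r : R) : r <= 0 -> zs s t r = expR t * r.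
Proof. by move=> r0; rewrite /zs (max_idPr r0) (min_idPl r0) mulr0 add0r. Qed.

(** The map [zs s t] is linear on each half-line. A perturbation that does not cross 0 is multiplied
    by one of the two slopes; starting from 0, the sign of [c] selects the slope. *)
Lemma zs_add (s t r e c : R) : 0 < e -> r = 0 \/ e * `|c| < `|r| ->
  exists2 k, k = expR s * e \/ k = expR t * e & zs s t (r + e * c) = zs s t r + k * c.
Proof.
move=> e0 [->|ec].
  have [c0|c0] := leP 0 c.
    exists (expR s * e); first by left.
    by rewrite add0r !zs_ge0 ?mulr_ge0// ?ltW// mulr0 add0r mulrA.
  have ec0 : e * c <= 0 by rewrite pmulr_rle0// ltW.
  exists (expR t * e); first by right.
  by rewrite add0r !zs_le0// mulr0 add0r mulrA.
have : `|e * c| < `|r| by rewrite normrM gtr0_norm.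
have [r0|r0] := leP 0 r.
  rewrite (ger0_norm r0) ltr_norml => /andP[k1 k2].
  exists (expR s * e); first by left.
  by rewrite !zs_ge0//; [ring|lra].
rewrite (ltr0_norm r0) ltr_norml => /andP[k1 k2].
exists (expR t * e); first by right.
by rewrite !zs_le0//; [ring|exact: ltW|lra].
Qed.

End ScalarParts.

Section CriticalPoint.
Variables (R : realType) (d : nat) (w : Zd d -> Zd d -> R) (W a b p : R)
  (h : Zd d -> R) (h0 : R).
Hypothesis st : setting w W a b p h h0.
Local Notation T := (Zd d).
Implicit Types (u v z phi : T -> R) (x : T).
Local Notation E u v := (sumZ (gradprod w u v)).
Local Notation SQ u := (sumZ (fun x => u x ^+ 2)).
Local Notation M := (Mset w a b p h).
Local Notation Jf := (J w a b p h).
Local Notation dJf := (dJ w a b p h).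
Let p_gt3 : 3 < p. Proof. by have := st_p st; lra. Qed.

(** For a perturbation at one site only one term of each sum moves, so even the weighted norm
    converges. *)
Lemma single_limits z (zn : nat -> T -> R) x : hl2 h z ->
  (forall n y, y != x -> zn n y = z y) -> (fun n => zn n x) @ \oo --> z x ->
  [/\ forall n, hl2 h (zn n), (fun n => SQ (fun y => zn n y - z y)) @ \oo --> 0
    & (fun n => Nh h (zn n)) @ \oo --> Nh h z].
Proof.
move=> hz off zx.
have hzn n : hl2 h (zn n).
  have -> : zn n = (fun y => z y + dirac x (zn n x - z x) y).
    apply/funext => y; rewrite /dirac; case: eqVneq => [->|/off ->].
      by rewrite addrC subrK.
    by rewrite addr0.
  by apply: (hl2D st) => //; exact: hl2_dirac.
have zx0 : (fun n => zn n x - z x) @ \oo --> (0 : R).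
  by rewrite -(subrr (z x)); apply: cvgB => //; exact: cvg_cst.
split=> //.
- have -> : (fun n => SQ (fun y => zn n y - z y)) = (fun n => (zn n x - z x) * (zn n x - z x)).
    apply/funext => n; rewrite (@sumZ_single R d _ x) ?expr2// => y /off ->.
    by rewrite subrr expr0n.
  by rewrite -[X in _ --> X](mulr0 0); exact: cvgM.
- have -> : (fun n => Nh h (zn n)) =
      (fun n => Nh h z + h x * (zn n x * zn n x - z x * z x)).
    apply/funext => n; apply/eqP; rewrite addrC -subr_eq; apply/eqP.
    rewrite -sumZB; [|exact: hzn|exact: hz].
    by rewrite (@sumZ_single R d _ x) => [|y /off ->]; [ring|rewrite subrr].
  rewrite -[X in _ --> X]addr0 -(mulr0 (h x)) -(subrr (z x * z x)).
  apply: cvgD; first exact: cvg_cst.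
  apply: cvgM; first exact: cvg_cst.
  by apply: cvgB; [exact: cvgM|exact: cvg_cst].
Qed.

(** Polarization: continuity of the mixed term follows from that of the quadratic form. *)
Lemma cDE u : hl2 h u -> cD w u = 2^-1 * (E u u - cA w u - cB w u).
Proof.
move=> hu; have := E_zc st hu 0 0; rewrite zc00 /qcone expR0 => ->.
by field.
Qed.

Lemma D_cvg (un : nat -> T -> R) v x r : hl2 h v ->
  (forall n y, y != x -> un n y = v y) -> (fun n => un n x) @ \oo --> v x ->
  (fun n => DP w a b p h (un n) r r) @ \oo --> DP w a b p h v r r /\
  (fun n => DN w a b p h (un n) r r) @ \oo --> DN w a b p h v r r.
Proof.
move=> hv off vx.
have [hun SQu _] := single_limits hv off vx.
have [hP SQP NP] : [/\ forall n, hl2 h (pos_part (un n)),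
    (fun n => SQ (fun y => pos_part (un n) y - pos_part v y)) @ \oo --> 0
    & (fun n => Nh h (pos_part (un n))) @ \oo --> Nh h (pos_part v)].
  apply: (single_limits (hl2_pos st hv) (x := x)).
    by move=> n y /off; rewrite /pos_part => ->.
  exact: lip_cvg ltr01 (@max0_lip R) vx.
have [hN SQN NN] : [/\ forall n, hl2 h (neg_part (un n)),
    (fun n => SQ (fun y => neg_part (un n) y - neg_part v y)) @ \oo --> 0
    & (fun n => Nh h (neg_part (un n))) @ \oo --> Nh h (neg_part v)].
  apply: (single_limits (hl2_neg st hv) (x := x)).
    by move=> n y /off; rewrite /neg_part => ->.
  exact: lip_cvg ltr01 (@min0_lip R) vx.
have L f (hf : hl2 h f) := hl2_l2 st hf.
have cAc : (fun n => cA w (un n)) @ \oo --> cA w v.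
  exact: (cvg_E st (L _ (hl2_pos st hv)) (fun n => L _ (hP n)) SQP).
have cBc : (fun n => cB w (un n)) @ \oo --> cB w v.
  exact: (cvg_E st (L _ (hl2_neg st hv)) (fun n => L _ (hN n)) SQN).
have Ec := cvg_E st (L _ hv) (fun n => L _ (hun n)) SQu.
have K (k : R) (f : nat -> R) (l : R) : f @ \oo --> l -> (fun n => k * f n) @ \oo --> k * l.
  by move=> fl; apply: cvgM => //; exact: cvg_cst.
have cDc : (fun n => cD w (un n)) @ \oo --> cD w v.
  rewrite (cDE hv); under eq_fun do rewrite (cDE (hun _)).
  by apply: (K _); apply: cvgB => //; apply: cvgB.
have SP := cvg_plog (c1 := 1) (c2 := 0) st (L _ (hl2_pos st hv)) (fun n => L _ (hP n)) SQP.
have LP := cvg_plog (c1 := 0) (c2 := 1) st (L _ (hl2_pos st hv)) (fun n => L _ (hP n)) SQP.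
have SN := cvg_plog (c1 := 1) (c2 := 0) st (L _ (hl2_neg st hv)) (fun n => L _ (hN n)) SQN.
have LN := cvg_plog (c1 := 0) (c2 := 1) st (L _ (hl2_neg st hv)) (fun n => L _ (hN n)) SQN.
have G (A B D H S L' : nat -> R) (A' B' D' H' S' L0 : R) :
  A @ \oo --> A' -> B @ \oo --> B' -> D @ \oo --> D' -> H @ \oo --> H' -> S @ \oo --> S' ->
  L' @ \oo --> L0 ->
  (fun n => dcone a b p (A n) (B n) (D n) (H n) (S n) (L' n) r r) @ \oo -->
  dcone a b p A' B' D' H' S' L0 r r.
  move=> Ac Bc Dc Hc Sc Lc; rewrite cone_ray; under eq_fun do rewrite cone_ray.
  apply: cvgB; last by apply: (K _); apply: cvgD => //; exact: (K _).
  apply: cvgD; apply: (K _); first by apply: cvgD => //; apply: (K _); exact: cvgD.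
  apply: cvgM; last exact: cvgD.
  by apply: (K _); apply: cvgD => //; apply: cvgD => //; exact: (K _).
by split; exact: G.
Qed.

(** An exact expansion: apart from one difference of [Flog], the increment is [k] times a polynomial
    in [k], so dividing by [k] and passing to the limit is elementary. *)
Lemma J_add_dirac V x c k : hl2 h V ->
  let rho := E V (dirac x c) in let Q := E (dirac x c) (dirac x c) in
  Jf (fun y => V y + k * dirac x c y) = Jf V
   + k * ((a + b * E V V) * rho + h x * V x * c
     + k * (2^-1 * (a * Q + h x * c ^+ 2)
            + b / 4 * (4 * (rho * rho) + 2 * E V V * Q + 4 * k * rho * Q + k * k * (Q * Q))))
   - (Flog p (V x + k * c) - Flog p (V x)).
Proof.
move=> hV rho Q; have hd := hl2_dirac h x c; have lV := hl2_l2 st hV; have ld := hl2_l2 st hd.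
have hkd := hl2Z k hd; have lkd := hl2_l2 st hkd; have hVd := hl2D st hV hkd.
rewrite (JE st hVd) (JE st hV) (E_add st lV lkd).
rewrite (E_Zr (st_wC st) (st_w st) (st_W st) k ld lV).
rewrite (E_Zl (st_wC st) (st_w st) (st_W st) k ld lkd).
rewrite (E_Zr (st_wC st) (st_w st) (st_W st) k ld ld) -/rho -/Q.
have -> : Nh h (fun y => V y + k * dirac x c y) =
    Nh h V + h x * (2 * V x * (k * c) + (k * c) ^+ 2).
  apply/eqP; rewrite addrC -subr_eq; apply/eqP.
  rewrite -sumZB; [|exact: hVd|exact: hV].
  rewrite (@sumZ_single R d _ x) /dirac => [|y /negPf ->]; first by rewrite eqxx; ring.
  by rewrite mulr0 addr0 subrr.
have -> : sumZ (fun y => Flog p (V y + k * dirac x c y)) =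
    sumZ (fun y => Flog p (V y)) + (Flog p (V x + k * c) - Flog p (V x)).
  apply/eqP; rewrite addrC -subr_eq; apply/eqP.
  rewrite -sumZB; [|exact: (summ_plog st _ _ (hl2_l2 st hVd))|exact: (summ_plog st)].
  rewrite (@sumZ_single R d _ x) /dirac => [|y /negPf ->]; first by rewrite eqxx.
  by rewrite mulr0 addr0 subrr.
by field.
Qed.

Lemma dJ_dirac v x c : hl2 h v -> dJf v (dirac x c) =
  (a + b * E v v) * E v (dirac x c) + h x * v x * c - flog p (v x) * c.
Proof.
move=> hv; rewrite (dJE st hv (hl2_dirac h x c)).
by congr (_ + _ - _); rewrite (@sumZ_single R d _ x) /dirac ?eqxx// => y /negPf ->; rewrite mulr0.
Qed.

Section AtMinimizer.
Variable v : T -> R.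
Hypothesis Mv : M v.
Hypothesis vmin : forall u, M u -> Jf v <= Jf u.

Let hv : hl2 h v. Proof. by have [] := MsetE st Mv. Qed.

(* The cone over [v + e dirac] meets the Nehari set near [v]; there the energy is at
   least [Jf v], which dominates the energy at the same point of the cone over [v]. *)
Lemma cone_competitor x c (j : nat) : exists s t k,
  [/\ `|s| <= j.+1%:R^-1, `|t| <= j.+1%:R^-1, 0 < k <= expR 1 * j.+1%:R^-1
    & Jf (zc v s t) <= Jf (fun y => zc v s t y + k * dirac x c y)].
Proof.
pose un n : T -> R := fun y => v y + n.+1%:R^-1 * dirac x c y.
have inv_cvg := @invS_cvg0 R.
have ucvg y : (fun n => un n y) @ \oo --> v y.
  rewrite -[X in _ --> X]addr0 -(mul0r (dirac x c y)).
  apply: cvgD; first exact: cvg_cst.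
  by apply: cvgM => //; exact: cvg_cst.
have off n y : y != x -> un n y = v y.
  by move=> /negPf yx; rewrite /un /dirac yx mulr0 addr0.
pose r : R := j.+1%:R^-1; have r0 : 0 < r by rewrite invr_gt0.
have r1 : r <= 1 by rewrite invf_le1// ler1n.
have [ray1 ray2] := Mset_ray st Mv.
have [dP1 dN1] := ray1 r r0; have [|dP2 dN2] := ray2 (- r); first by rewrite oppr_lt0.
have [cP1 cN1] := D_cvg r hv off (ucvg x).
have [cP2 cN2] := D_cvg (- r) hv off (ucvg x).
have [_ P0 N0 _ _] := MsetE st Mv.
have [yp yp0] := fun_neq0 P0; have [yn yn0] := fun_neq0 N0.
have vyp : 0 < v yp.
  rewrite ltNge; apply: contra_neqN yp0 => vy; exact/max_idPr.
have vyn : v yn < 0.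
  rewrite ltNge; apply: contra_neqN yn0 => vy; exact/min_idPr.
(* Eventually the perturbation is too small to change the sign of a nonzero [v x], as [zs_add]
   requires. *)
have vx : \forall n \near \oo, v x = 0 \/ n.+1%:R^-1 * `|c| < `|v x|.
  have [->|vx0] := eqVneq (v x) 0; first by near=> n; left.
  have cc : (fun n => n.+1%:R^-1 * `|c|) @ \oo --> (0 : R).
    by rewrite -(mul0r `|c|); apply: cvgM => //; exact: cvg_cst.
  near=> n; right; near: n; apply: (cvgr_lt _ cc); by rewrite normr_gt0.
have [n [jn dPr dNr [dPl dNl [up uq vxn]]]] : exists n, [/\ (j <= n)%N,
    DP w a b p h (un n) r r < 0, DN w a b p h (un n) r r < 0 &
    [/\ 0 < DP w a b p h (un n) (- r) (- r), 0 < DN w a b p h (un n) (- r) (- r) &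
     [/\ 0 < un n yp, un n yn < 0 & v x = 0 \/ n.+1%:R^-1 * `|c| < `|v x|]]].
  apply: (@filter_ex _ \oo); near=> n; split.
  - by near: n; exists j.
  - by near: n; exact: (cvgr_lt _ cP1 _ dP1).
  - by near: n; exact: (cvgr_lt _ cN1 _ dN1).
  split.
  - by near: n; exact: (cvgr_gt _ cP2 _ dP2).
  - by near: n; exact: (cvgr_gt _ cN2 _ dN2).
  split.
  - by near: n; exact: (cvgr_gt _ (ucvg yp) _ vyp).
  - by near: n; exact: (cvgr_lt _ (ucvg yn) _ vyn).
  - by near: n; exact: vx.
have hun : hl2 h (un n) by apply: (hl2D st) => //; apply: hl2Z; exact: hl2_dirac.
have uP : pos_part (un n) <> (fun=> 0).
  move=> /(congr1 (@^~ yp)); rewrite /pos_part (max_idPl (ltW up)) => e.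
  by rewrite e ltxx in up.
have uN : neg_part (un n) <> (fun=> 0).
  move=> /(congr1 (@^~ yn)); rewrite /neg_part (min_idPl (ltW uq)) => e.
  by rewrite e ltxx in uq.
have rr : - r <= r by lra.
have [s [t [sr tr Mz]]] := Mset_box st hun uP uN rr (ltW dPl) (ltW dNl) dPr dNr.
have e0 : 0 < n.+1%:R^-1 :> R by rewrite invr_gt0.
have [k kE kz] := zs_add s t e0 vxn.
exists s, t, k; split; rewrite ?ler_norml//.
  (* The factor [k] is [e^s] or [e^t] times [1/(n+1)], and both parameters are at most [r <= 1]. *)
  have nj : n.+1%:R^-1 <= r by rewrite lef_pV2 ?posrE// ler_nat ltnS.
  move: sr tr => /andP[_ sr] /andP[_ tr].
  by case: kE => ->; rewrite mulr_gt0 ?expR_gt0//=; apply: ler_pM;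
    rewrite ?expR_ge0 ?invr_ge0 ?ler_expR//; lra.
apply: le_trans (Mset_max st s t Mv) _; apply: le_trans (vmin Mz) _.
rewrite le_eqVlt; apply/orP; left; apply/eqP; congr (J _ _ _ _ _ _).
apply/funext => y; rewrite !zc_zs /un /dirac; case: eqVneq => [->|_] //.
by rewrite !mulr0 !addr0.
Unshelve. all: by end_near. Qed.

Lemma dJ_dirac_ge0 x c : 0 <= dJf v (dirac x c).
Proof.
rewrite leNgt; apply/negP => neg.
have /choice[s /choice[t /choice[k skt]]] := cone_competitor x c.
pose phi := dirac x c.
have hphi : hl2 h phi := hl2_dirac h x c; have lphi := hl2_l2 st hphi.
have inv_cvg := @invS_cvg0 R.
have to0 (f : nat -> R) (C : R) : (forall j, `|f j| <= C * j.+1%:R^-1) -> f @ \oo --> 0.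
  move=> fC; apply/cvgr0Pnorm_lt => e e0.
  have cc : (fun j => C * j.+1%:R^-1) @ \oo --> (0 : R).
    by rewrite -[X in _ --> X](mulr0 C); apply: cvgM => //; exact: cvg_cst.
  near=> j; apply: le_lt_trans (fC j) _; near: j; exact: (cvgr_lt _ cc _ e0).
have s0 : s @ \oo --> 0 by apply: (to0 _ 1) => j; rewrite mul1r; have [] := skt j.
have t0 : t @ \oo --> 0 by apply: (to0 _ 1) => j; rewrite mul1r; have [] := skt j.
have k0 : k @ \oo --> 0.
  apply: (to0 _ (expR 1)) => j; have [_ _ /andP[kpos kle] _] := skt j.
  by rewrite gtr0_norm.
have es : (fun j => expR (s j)) @ \oo --> (1 : R).
  by rewrite -(@expR0 R); apply: continuous_cvg s0; exact: continuous_expR.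
have et : (fun j => expR (t j)) @ \oo --> (1 : R).
  by rewrite -(@expR0 R); apply: continuous_cvg t0; exact: continuous_expR.
have K (m : R) (f : nat -> R) (l : R) : f @ \oo --> l -> (fun n => m * f n) @ \oo --> m * l.
  by move=> fl; apply: cvgM => //; exact: cvg_cst.
have K' (m : R) (f : nat -> R) (l : R) : f @ \oo --> l -> (fun n => f n * m) @ \oo --> l * m.
  by move=> fl; apply: cvgM => //; exact: cvg_cst.
pose V j := zc v (s j) (t j).
have hV j : hl2 h (V j) := hl2_zc st _ _ hv.
have Vx : (fun j => V j x) @ \oo --> v x.
  rewrite -[X in _ --> X](congr1 (@^~ x) (zc00 v)) /zc !expR0.
  by apply: cvgD; exact: (K' _).
have EV : (fun j => E (V j) (V j)) @ \oo --> E v v.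
  have -> : E v v = qcone (cA w v) (cB w v) (cD w v) 0 0 by rewrite -(E_zc st hv) zc00.
  under eq_fun do rewrite (E_zc st hv); rewrite /qcone !expR0.
  apply: cvgD; last by apply: (K' _); exact: cvgM.
  apply: cvgD; first by apply: (K' _); exact: cvgM.
  by apply: (K _); apply: (K' _); exact: cvgM.
have rho : (fun j => E (V j) phi) @ \oo --> E v phi.
  have -> : E v phi = 1 * E (pos_part v) phi + 1 * E (neg_part v) phi.
    by have := E_zc_l st hv 0 0 lphi; rewrite zc00 expR0.
  under eq_fun do rewrite (E_zc_l st hv _ _ lphi).
  by apply: cvgD; exact: (K' _).
pose Q := E phi phi.
(* Chosen so that the error [ee |c|] of the difference quotient stays below the assumed negative
   slope; the [+ 1] covers [c = 0]. *)
pose ee := - dJf v phi / (2 * (`|c| + 1)).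
have c1 : 0 < `|c| + 1 by have := normr_ge0 c; lra.
have ee0 : 0 < ee by rewrite divr_gt0 ?mulr_gt0// oppr_gt0.
have eec : ee * `|c| < - dJf v phi.
  have : ee * (2 * (`|c| + 1)) = - dJf v phi by rewrite /ee divfK// gt_eqF// mulr_gt0.
  by have := mulr_ge0 (ltW ee0) (normr_ge0 c); lra.
have [dl dl0 HF] := Flog_strict_derivative p_gt3 (v x) ee0.
(* An upper bound for the difference quotient of the energy from [V j] in direction [phi], with the
   [Flog] increment replaced by its strict derivative. Its limit is negative, while the quotient is
   nonnegative. *)
pose Y j := (a + b * E (V j) (V j)) * E (V j) phi + h x * V j x * c
     + k j * (2^-1 * (a * Q + h x * c ^+ 2)
       + b / 4 * (4 * (E (V j) phi * E (V j) phi) + 2 * E (V j) (V j) * Q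
                  + 4 * k j * E (V j) phi * Q + k j * k j * (Q * Q)))
     - flog p (v x) * c + ee * `|c|.
have Ycvg : Y @ \oo --> dJf v phi + ee * `|c|.
  have -> : dJf v phi = (a + b * E v v) * E v phi + h x * v x * c
     + 0 * (2^-1 * (a * Q + h x * c ^+ 2)
       + b / 4 * (4 * (E v phi * E v phi) + 2 * E v v * Q
                  + 4 * 0 * E v phi * Q + 0 * 0 * (Q * Q))) - flog p (v x) * c.
    by rewrite (dJ_dirac x c hv) mul0r addr0.
  apply: cvgD; last exact: cvg_cst.
  apply: cvgB; last exact: cvg_cst.
  apply: cvgD.
    apply: cvgD; last by apply: (K' _); exact: (K _).
    by apply: cvgM => //; apply: cvgD; [exact: cvg_cst|exact: (K _)].
  apply: cvgM => //; apply: cvgD; first exact: cvg_cst.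
  apply: (K _); apply: cvgD; last by apply: (K' _); exact: cvgM.
  apply: cvgD; last by apply: (K' _); apply: cvgM => //; exact: (K _).
  by apply: cvgD; [apply: (K _); exact: cvgM|apply: (K' _); exact: (K _)].
have Yneg : dJf v phi + ee * `|c| < 0 by lra.
have kc0 : (fun j => k j * c) @ \oo --> (0 : R).
  by rewrite -(mul0r c); exact: (K' _).
have [j [Yj Vj kj]] : exists j, [/\ Y j < 0, `|V j x - v x| < dl & `|k j * c| < dl].
  apply: (@filter_ex _ \oo); near=> j; split.
  - by near: j; exact: (cvgr_lt _ Ycvg _ Yneg).
  - by near: j; move/cvgrPdistC_lt : Vx; exact.
  - by near: j; move/cvgr0Pnorm_lt : kc0; exact.
have [_ _ /andP[kpos _] Jle] := skt j.
have := HF _ _ Vj kj; rewrite normrM (gtr0_norm kpos) ler_norml => /andP[Fge _].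
move: Jle; rewrite (J_add_dirac x c (k j) (hV j)) -/phi -/Q.
have : k j * Y j < 0 by rewrite pmulr_rlt0.
rewrite /Y; lra.
Unshelve. all: by end_near. Qed.

End AtMinimizer.
End CriticalPoint.

(** * From point masses to all test functions *)

Section CriticalOnH.
Variables (R : realType) (d : nat) (w : Zd d -> Zd d -> R) (W a b p : R)
  (h : Zd d -> R) (h0 : R).
Hypothesis st : setting w W a b p h h0.
Local Notation T := (Zd d).
Implicit Types (u v z phi psi g : T -> R) (x : T).
Local Notation E u v := (sumZ (gradprod w u v)).
Local Notation SQ u := (sumZ (fun x => u x ^+ 2)).
Local Notation M := (Mset w a b p h).
Local Notation Jf := (J w a b p h).
Local Notation dJf := (dJ w a b p h).
Let p_gt3 : 3 < p. Proof. by have := st_p st; lra. Qed.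

Lemma dJ_add v phi psi : hl2 h v -> hl2 h phi -> hl2 h psi ->
  dJf v (fun x => phi x + psi x) = dJf v phi + dJf v psi.
Proof.
move=> hv hphi hpsi; have hs := hl2D st hphi hpsi.
have lv := hl2_l2 st hv; have lphi := hl2_l2 st hphi; have lpsi := hl2_l2 st hpsi.
rewrite (dJE st hv hs) (dJE st hv hphi) (dJE st hv hpsi).
rewrite (E_Dr (st_wC st) (st_w st) (st_W st) lphi lpsi lv).
have -> : sumZ (fun x => h x * v x * (phi x + psi x)) =
    sumZ (fun x => h x * v x * phi x) + sumZ (fun x => h x * v x * psi x).
  rewrite -sumZD; [|exact: (summ_hM st)|exact: (summ_hM st)].
  by apply: sumZ_eq => x; ring.
have -> : sumZ (fun x => flog p (v x) * (phi x + psi x)) =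
    sumZ (fun x => flog p (v x) * phi x) + sumZ (fun x => flog p (v x) * psi x).
  rewrite -sumZD; [|exact: (summ_flogM st)|exact: (summ_flogM st)].
  by apply: sumZ_eq => x; ring.
ring.
Qed.

Lemma dJ_scale v c phi : hl2 h v -> hl2 h phi -> dJf v (fun x => c * phi x) = c * dJf v phi.
Proof.
move=> hv hphi; have hs := hl2Z c hphi.
have lv := hl2_l2 st hv; have lphi := hl2_l2 st hphi.
rewrite (dJE st hv hs) (dJE st hv hphi) (E_Zr (st_wC st) (st_w st) (st_W st) c lphi lv).
have -> : sumZ (fun x => h x * v x * (c * phi x)) = c * sumZ (fun x => h x * v x * phi x).
  by rewrite -sumZZ; [apply: sumZ_eq => x; ring|exact: (summ_hM st)].
have -> : sumZ (fun x => flog p (v x) * (c * phi x)) = c * sumZ (fun x => flog p (v x) * phi x).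
  by rewrite -sumZZ; [apply: sumZ_eq => x; ring|exact: (summ_flogM st)].
ring.
Qed.

Lemma normM_le_scaled (c r r' : R) : 0 < c ->
  `|r| * `|r'| <= c ^+ 2 * r ^+ 2 + c^-1 ^+ 2 * r' ^+ 2.
Proof.
move=> c0; rewrite -normrM; have -> : r * r' = (c * r) * (c^-1 * r').
  by field; rewrite gt_eqF.
by apply: le_trans (normM_le_sqr _ _) _; rewrite !exprMn.
Qed.

(** Continuity at 0 of the linear map [g -> dJ v g], in Young form so that no square root of
    [Nh h g] occurs. *)
Lemma dJ_continuous v e : hl2 h v -> 0 < e -> exists2 C, 0 <= C &
  forall g, hl2 h g -> `|dJf v g| <= e + C * Nh h g.
Proof.
move=> hv e0; have lv := hl2_l2 st hv; have h00 := st_h0 st.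
have [B B0 vB] := l2_bounded lv; have [Cf Cf0 HCf] := flog_le p_gt3 B0.
have W0 : 0 <= W := W_ge0 (st_w st) (st_W st) (finfun (fun=> 0)).
have SQ0 u : 0 <= SQ u by exact: SQ_ge0.
set q := `|a + b * E v v|; have q0 : 0 <= q by exact: normr_ge0.
have K10 : 0 <= q * (W * SQ v) + Nh h v + Cf * SQ v.
  by apply: addr_ge0; [apply: addr_ge0; [rewrite !mulr_ge0|exact: (Nh_ge0 st)]|rewrite mulr_ge0].
have [c c0 [_ ce]] := small_mul K10 e0.
exists (c^-1 ^+ 2 * (q * W / h0 + 1 + Cf / h0)) => [|g hg].
  apply: mulr_ge0; first exact: sqr_ge0.
  by rewrite !addr_ge0// divr_ge0 ?mulr_ge0// ltW.
have lg := hl2_l2 st hg; have SQg := sumsq_le_Nh st hg.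
rewrite (dJE st hv hg).
have b1 : `|(a + b * E v v) * E v g| <= q * (W * (c ^+ 2 * SQ v + c^-1 ^+ 2 * SQ g)).
  by rewrite normrM ler_wpM2l//; exact: (E_le_scaled st c0 lv lg).
have b2 : `|sumZ (fun x => h x * v x * g x)| <= c ^+ 2 * Nh h v + c^-1 ^+ 2 * Nh h g.
  have sh := summ_hM st hv hg.
  apply: le_trans (sumZ_norm_le sh) _; rewrite -!sumZZ// -sumZD; [|exact: summZ|exact: summZ].
  apply: ler_sumZ; [exact: summ_norm|by apply: summD; exact: summZ|move=> x].
  have hx := h_gt0 st x; rewrite -mulrA normrM (gtr0_norm hx) normrM.
  have -> : c ^+ 2 * (h x * v x ^+ 2) + c^-1 ^+ 2 * (h x * g x ^+ 2) =
    h x * (c ^+ 2 * v x ^+ 2 + c^-1 ^+ 2 * g x ^+ 2) by ring.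
  by rewrite ler_pM2l// normM_le_scaled.
have b3 : `|sumZ (fun x => flog p (v x) * g x)| <= Cf * (c ^+ 2 * SQ v + c^-1 ^+ 2 * SQ g).
  have sh := summ_flogM st lv lg.
  apply: le_trans (sumZ_norm_le sh) _; rewrite -!sumZZ// -sumZD; [|exact: summZ|exact: summZ].
  rewrite -sumZZ; last by apply: summD; exact: summZ.
  apply: ler_sumZ; [exact: summ_norm|by apply: summZ; apply: summD; exact: summZ|move=> x].
  rewrite normrM; apply: (@le_trans _ _ (Cf * (`|v x| * `|g x|))).
    by rewrite mulrA ler_wpM2r// HCf.
  by rewrite ler_wpM2l// normM_le_scaled.
apply: le_trans (ler_normB _ _) _; apply: le_trans (lerD (ler_normD _ _) (lexx _)) _.
apply: le_trans (lerD (lerD b1 b2) b3) _.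
have ci0 : 0 <= c^-1 ^+ 2 by exact: sqr_ge0.
have k1 := ler_wpM2l (mulr_ge0 (mulr_ge0 q0 W0) ci0) SQg.
have k2 := ler_wpM2l (mulr_ge0 Cf0 ci0) SQg.
have -> : c^-1 ^+ 2 * (q * W / h0 + 1 + Cf / h0) * Nh h g =
  q * W * c^-1 ^+ 2 * (Nh h g / h0) + c^-1 ^+ 2 * Nh h g + Cf * c^-1 ^+ 2 * (Nh h g / h0).
  by ring.
lra.
Qed.

Section Minimum.
Variable v : T -> R.
Hypothesis Mv : M v.
Hypothesis vmin : forall u, M u -> Jf v <= Jf u.

Let hv : hl2 h v. Proof. by have [] := MsetE st Mv. Qed.

(** The one-sided inequality holds for [c] and for [- c]. *)
Lemma dJ_dirac_eq0 x c : dJf v (dirac x c) = 0.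
Proof.
apply/le_anti/andP; split; last exact: (dJ_dirac_ge0 st Mv vmin).
have := dJ_dirac_ge0 st Mv vmin x (- c).
have -> : dirac x (- c) = (fun y => - 1 * dirac x c y).
  by apply/funext => y; rewrite /dirac; case: ifP; rewrite ?mulr0// mulN1r.
by rewrite (dJ_scale _ hv (hl2_dirac h x c)); lra.
Qed.

Lemma dJ_finite_eq0 phi (s : seq T) :
  hl2 h (fun y => \sum_(x <- s) dirac x (phi x) y) /\
  dJf v (fun y => \sum_(x <- s) dirac x (phi x) y) = 0.
Proof.
elim: s => [|x s [hs ih]].
  have -> : (fun y : T => \sum_(x <- [::]) dirac x (phi x) y) = (fun y => 0 * v y).
    by apply/funext => y; rewrite big_nil mul0r.
  by split; [exact: hl2Z|rewrite (dJ_scale _ hv hv) mul0r].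
have -> : (fun y => \sum_(z <- x :: s) dirac z (phi z) y) =
    (fun y => dirac x (phi x) y + \sum_(z <- s) dirac z (phi z) y).
  by apply/funext => y; rewrite big_cons.
have hd := hl2_dirac h x (phi x).
by split; [exact: (hl2D st)|rewrite (dJ_add hv hd hs) ih dJ_dirac_eq0 addr0].
Qed.

Lemma dJ_eq0 phi : hl2 h phi -> dJf v phi = 0.
Proof.
move=> hphi; apply/eqP; rewrite -normr_le0; apply/ler_addgt0Pr => e e0; rewrite add0r.
have e2 : 0 < e / 2 by rewrite divr_gt0.
have [C C0 HC] := dJ_continuous hv e2.
have C1 : 0 < C + 1 by lra.
have [A Ae] := sumZ_tail (hsq_ge0 st phi) hphi (divr_gt0 e2 C1).
pose g : T -> R := fun y => if y \in A then 0 else phi y.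
have hg : hl2 h g.
  by apply: (hl2_le st hphi) => y; rewrite /g; case: ifP; rewrite ?normr0.
have Ng : Nh h g = sumZ (fun x => if x \in A then 0 else h x * phi x ^+ 2).
  by apply: sumZ_eq => y; rewrite /g; case: ifP; rewrite ?expr0n ?mulr0.
have [hA dA] := dJ_finite_eq0 phi A.
have -> : phi = (fun y => \sum_(x <- A) dirac x (phi x) y + g y).
  apply/funext => y; rewrite /g.
  have := congr1 (@^~ y) (fset_indicatorE phi A) => /= <-.
  by case: ifP; rewrite ?addr0 ?add0r.
rewrite (dJ_add hv hA hg) dA add0r; apply: le_trans (HC g hg) _.
have Ng0 := Nh_ge0 st g.
by move: Ae; rewrite -Ng ltr_pdivlMr//; lra.
Qed.

End Minimum.

Lemma sign_changing_minimizer : (exists x y : T, x != y) ->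
  exists v, M v /\ (forall phi, inH w h phi -> dJf v phi = 0) /\
    (forall u, M u -> Jf v <= Jf u).
Proof.
move=> xy; have [v Mv vmin] := minimizer_exists st xy; exists v; split=> //; split=> //.
by move=> phi /(inHP st) hphi; exact: dJ_eq0.
Qed.

End CriticalOnH.

(** * Reduction to the stated hypotheses on the kernel and the potential *)

Lemma dist_ball_fset (d : nat) (x0 : Zd d) (r : nat) :
  exists A : {fset Zd d}, forall x, x \notin A -> (r < distZ x x0)%N.
Proof.
(* A point of the ball is decoded from [d] pairs of a magnitude at most [r] and a sign. *)
pose dec (f : {ffun 'I_d -> 'I_r.+1 * bool}) : Zd d :=
  [ffun i => x0 i + int_code ((f i).1 : nat, (f i).2)].
exists [fset x in codom dec]%fset => x; apply: contraNT; rewrite -leqNgt => xr.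
rewrite !inE; apply/codomP.
exists [ffun i => (inord (absz (x i - x0 i)), 0 <= x i - x0 i)].
apply/ffunP => i; rewrite !ffunE/= inordK; last first.
  by rewrite ltnS (leq_trans (distZ_ge x x0 i)).
by rewrite int_codeK addrCA subrr addr0.
Qed.

Theorem theorem1p2 (R : realType) (d : nat) (s : R) (w : Zd d -> Zd d -> R)
  (a b p : R) (h : Zd d -> R) :
  (1 <= d)%N -> 0 < s < 1 ->
  (forall x y : Zd d, x != y -> w x y = w y x) ->
  (forall x y : Zd d, x != y -> 0 < w x y) ->
  (exists c C : R, 0 < c /\ c <= C /\
     forall x y : Zd d, x != y ->
       c * powR (distZ x y)%:R (- (d%:R + 2 * s)) <= w x y /\
       w x y <= C * powR (distZ x y)%:R (- (d%:R + 2 * s))) ->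
  0 < a -> 0 < b -> 6 < p ->
  (* (h1) *)
  (exists h0 : R, 0 < h0 /\ forall x, h0 <= h x) ->
  (* (h2) *)
  (exists x0 : Zd d, forall M : R, exists r : nat,
     forall x : Zd d, (r < distZ x x0)%N -> M <= h x) ->
  exists v : Zd d -> R,
    Mset w a b p h v /\
    (forall phi, inH w h phi -> dJ w a b p h v phi = 0) /\
    (forall u, Mset w a b p h u -> J w a b p h v <= J w a b p h u).
Proof.
move=> d1 /andP[s0 _] wC w0 [c [C [c0 [cC wP]]]] a0 b0 p6 [h0 [h00 hh]] [x0 hoo].
have [W0 HW] := dist_row_sum d1 s0.
have C0 : 0 <= C by lra.
have st : setting w (C * W0) a b p h h0.
  split=> // [x A|K].
    apply: le_trans (ler_wpM2l C0 (HW x A)); rewrite mulr_sumr; apply: ler_sum => y yx.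
    by have [] := wP x y; rewrite 1?eq_sym.
  have [r hr] := hoo K; have [A HA] := dist_ball_fset x0 r.
  by exists A => x /HA; exact: hr.
(* Since [d >= 1] there are two distinct sites, enough to carry a sign-changing function. *)
apply: (sign_changing_minimizer st); exists [ffun=> 0], [ffun=> 1].
by apply/eqP => /ffunP /(_ (Ordinal d1)); rewrite !ffunE.
Qed.
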